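(* Let $c\in\mathbb{R}$, $c\neq 0$, let $I\subseteq\mathbb{R}$ be an open interval, let $a:I\to\mathbb{R}$ be a positive real analytic function and let $b:I\to\mathbb{C}$ be a real analytic function with $2\,\mathrm{Re}\, b(s)=a'(s)$ on $I$. Consider the Cauchy problem for a real function $\phi$ on a neighbourhood of $I\equiv I\times\{0\}$ in $\mathbb{C}$ ($z=s+it$): $$(\log\phi)_{z\bar z}=-\frac{c}{2}\,\phi,\qquad \phi(s,0)=a(s),\qquad \phi_z(s,0)=b(s).\qquad (\ast)$$ Let $T:I\to\mathbb{C}$ be an arbitrary solution of the differential equation $\{T,s\}=\Upsilon(s)$, where $$2\Upsilon(s)=2\left(\frac{b(s)}{a(s)}\right)'-\left(\frac{b(s)}{a(s)}\right)^2+c\,a(s),$$ and define $R$ by $$\overline{R(s)}=\frac1c\,\frac{T''(s)-(b(s)/a(s))\,T'(s)}{2T'(s)^2-T(s)T''(s)+(b(s)/a(s))\,T(s)T'(s)}.$$ If $T(z),R(z)$ are meromorphic extensions of $T(s),R(s)$ to an open set $D\subset\mathbb{C}$ containing $I$, then $$\phi(s,t)=\frac{4\,T_z\,\overline{R_z}}{(1+c\,T\,\overline{R})^2}$$ is the only solution to the Cauchy problem $(\ast)$.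
   Context: $\partial_z=(\partial_s-i\partial_t)/2$ and $\partial_{\bar z}=(\partial_s+i\partial_t)/2$. The Schwarzian derivative of a function $f$ with respect to a (real or complex) parameter $x$ is $\{f,x\}=\left(\frac{f''}{f'}\right)'-\frac12\left(\frac{f''}{f'}\right)^2$, with $'=d/dx$. Some of the functions involved may fail to be well defined at isolated points; formulas are understood away from such points and then extended by analytic continuation. *)

(* Defs.v *)
(* Complex numbers are Coquelicot's C = R * R; the point z = s + i t is (s, t). *)
From Stdlib Require Import Reals.
From Coquelicot Require Import Coquelicot.

Local Open Scope R_scope.

Definition interval_oo (lo hi : Rbar) (s : R) : Prop :=
  Rbar_lt lo s /\ Rbar_lt s hi.

Definition real_analytic_on {V : NormedModule R_AbsRing}
    (I : R -> Prop) (f : R -> V) : Prop :=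
  forall s0, I s0 ->
    exists u : nat -> V, locally s0 (fun s => is_pseries u (s - s0) (f s)).

(* [P] holds on [X] away from isolated points; the exceptional set has no
   accumulation point in [X]. [X] is meant to be open. *)
Definition off_isolated {S : UniformSpace} (X P : S -> Prop) : Prop :=
  forall x0, X x0 -> locally' x0 P.

(* Derivative of a complex-valued function of a real variable; total, hence
   only meaningful together with differentiability. *)
Definition rD (f : R -> C) (s : R) : C :=
  (Derive (fun x => Re (f x)) s, Derive (fun x => Im (f x)) s).

Definition schwarzian (f : R -> C) (s : R) : C :=
  (rD (fun x => rD (rD f) x / rD f x) s - / 2 * (rD (rD f) s / rD f s) ^ 2)%C.

(* The nonvanishing of [T'] is what gives the Schwarzian a meaning. *)
Definition schwarzian_eq_at (T U : R -> C) (s : R) : Prop :=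
  ex_derive (V := C_R_NormedModule) T s /\
  ex_derive (V := C_R_NormedModule) (rD T) s /\
  ex_derive (V := C_R_NormedModule) (rD (rD T)) s /\
  rD T s <> RtoC 0 /\
  schwarzian T s = U s.

Section CauchyData.

Variables (c : R) (a : R -> R) (b : R -> C).

Definition b_over_a (s : R) : C := (b s / RtoC (a s))%C.

Definition Upsilon (s : R) : C :=
  ((2 * rD b_over_a s - b_over_a s ^ 2 + RtoC c * RtoC (a s)) / 2)%C.

Definition R_data (T : R -> C) (s : R) : C :=
  Cconj
    (/ RtoC c *
     ((rD (rD T) s - b_over_a s * rD T s) /
      (2 * rD T s ^ 2 - T s * rD (rD T) s + b_over_a s * T s * rD T s)))%C.

End CauchyData.

Definition holomorphic_at (f : C -> C) (z0 : C) : Prop :=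
  locally (T := C_UniformSpace) z0
    (fun z => ex_derive (K := C_AbsRing) (V := C_NormedModule) f z).

(* The values of [F] at its poles (and at removable singularities) are
   irrelevant: [F] is only constrained on punctured neighbourhoods. *)
Definition meromorphic_on (D : C -> Prop) (F : C -> C) : Prop :=
  forall z0, D z0 ->
    exists (n : nat) (g : C -> C), holomorphic_at g z0 /\
      locally' (T := C_UniformSpace) z0
        (fun z => F z = (g z / (z - z0) ^ n)%C).

Definition meromorphic_extension
    (I : R -> Prop) (f : R -> C) (D : C -> Prop) (F : C -> C) : Prop :=
  meromorphic_on D F /\
  off_isolated (S := R_UniformSpace) I (fun s => F (RtoC s) = f s).

Definition ps (f : C -> R) (z : C) : R := Derive (fun s => f (s, Im z)) (Re z).
Definition pt (f : C -> R) (z : C) : R := Derive (fun t => f (Re z, t)) (Im z).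

Definition cps (F : C -> C) (z : C) : C :=
  (ps (fun w => Re (F w)) z, ps (fun w => Im (F w)) z).
Definition cpt (F : C -> C) (z : C) : C :=
  (pt (fun w => Re (F w)) z, pt (fun w => Im (F w)) z).

Definition dz (F : C -> C) (z : C) : C := ((cps F z - Ci * cpt F z) / 2)%C.
Definition dzbar (F : C -> C) (z : C) : C := ((cps F z + Ci * cpt F z) / 2)%C.

Fixpoint Ck_on (k : nat) (U : C -> Prop) (f : C -> R) : Prop :=
  match k with
  | O => forall z, U z ->
           continuous (T := C_UniformSpace) (U := R_UniformSpace) f z
  | S k' =>
      (forall z, U z -> ex_derive (fun s => f (s, Im z)) (Re z) /\
                        ex_derive (fun t => f (Re z, t)) (Im z)) /\
      Ck_on k' U (ps f) /\ Ck_on k' U (pt f)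
  end.

(* For an open set, connectedness may be tested on open covers of the plane. *)
Definition connected_open (U : C -> Prop) : Prop :=
  open (T := C_UniformSpace) U /\
  forall A B : C -> Prop,
    open (T := C_UniformSpace) A -> open (T := C_UniformSpace) B ->
    (forall z, U z -> A z \/ B z) ->
    (exists z, U z /\ A z) -> (exists z, U z /\ B z) ->
    exists z, U z /\ A z /\ B z.

(* [phi] is a classical solution, on the open neighbourhood [U] of [I], of
     (log phi)_{z zbar} = - (c / 2) phi,  phi(s, 0) = a(s),  phi_z(s, 0) = b(s);
   positivity is needed for [log phi] to make sense. *)
Definition cauchy_solution (c : R) (I : R -> Prop) (a : R -> R) (b : R -> C)
    (U : C -> Prop) (phi : C -> R) : Prop :=
  open (T := C_UniformSpace) U /\
  (forall s, I s -> U (RtoC s)) /\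
  Ck_on 2 U phi /\
  (forall z, U z -> 0 < phi z) /\
  (forall z, U z ->
     dzbar (dz (fun w => RtoC (ln (phi w)))) z = RtoC (- (c / 2) * phi z)) /\
  (forall s, I s ->
     phi (RtoC s) = a s /\ dz (fun w => RtoC (phi w)) (RtoC s) = b s).

Definition liouville_regular (c : R) (T R : C -> C) (z : C) : Prop :=
  holomorphic_at T z /\ holomorphic_at R z /\
  (1 + RtoC c * T z * Cconj (R z))%C <> RtoC 0.

Definition liouville_formula (c : R) (T R : C -> C) (z : C) : C :=
  (4 * dz T z * Cconj (dz R z) / (1 + RtoC c * T z * Cconj (R z)) ^ 2)%C.

(* Main.v *)
Require Import Defs.
From Stdlib Require Import Reals Lra Lia Psatz ClassicalEpsilon.
From Coquelicot Require Import Coquelicot.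

(* Write [w] for the [z]-derivative of [log phi]. For a solution of the Liouville
   equation, [Q = w_z - w^2 / 2] is holomorphic, and the jet [(phi, w, conj w)] solves
   a total first-order system whose coefficients involve only [Q]; hence it is
   determined by [Q] and by its value at one point.

   Uniqueness: for a merely C^2 solution, [Q] is continuous and [Q dz - dw] is a closed
   C^1 form, so [Q] is holomorphic by Morera's argument. On the axis the Cauchy data
   determine [Q], so two solutions have the same [Q] by the identity theorem, and then
   the same jet by Gronwall and connectedness.

   Existence: near a point of the interval a Moebius transformation turns [T] into a
   holomorphic [S] with [S = 0] there, and the Schwarzian equation forces [S' <> 0].
   The Liouville expression is invariant when [R] is transformed contragrediently, so
   it extends across the poles. The extension and its conjugate have jets with the same
   [Q] and the same value on the axis, so it is real. *)

Local Open Scope R_scope.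

(** * Derivatives of complex-valued functions *)

(** On the axis a solution has [w = b/a], and its [s]-derivative reads (b/a)' = Q + (b/a)^2/2 -
    (c/2) a. So [Q] continues [Upsilon], and the Schwarzian equation says exactly that a formula
    built from [T] has the right [Q]. What [T] leaves free is [R]: after clearing denominators, the
    condition [w = b/a] on the axis is linear in conj(R), and its solution is the quotient that
    defines [R]. The value [a] on the axis then follows from the Schwarzian equation, and 2 Re b =
    a' makes the third jet entry there the conjugate of the second. Formally Q_zbar = -(c/2) phi w +
    (c/2) w phi = 0, but this differentiates [phi] three times. The form Q dz - dw equals -(w^2/2)
    dz + (c/2) phi dzbar, which needs one derivative of [phi] and [w] only; hence Goursat and
    Morera. The jet carries its third entry as an independent unknown, so that uniqueness applies to
    the formula before it is known to be real. The formula is literally undefined at poles of [T] or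
    [R]. Each point of the interval therefore gets its own chart and a small square whose centre is
    the only exceptional point. *)

Lemma Rlt_Rmin x a b : x < Rmin a b -> x < a /\ x < b.
Proof. intros H; generalize (Rmin_l a b) (Rmin_r a b); lra. Qed.

(* [iota] is the identity for the complex derivative, and [RtoC] for the derivative of a
   complex-valued function of a real variable. *)
Definition der {X : Type} (iota f : X -> C) (x : X) (l : C) : Prop :=
  forall eps, 0 < eps -> exists d, 0 < d /\ forall y, Cmod (iota y - iota x) < d ->
    Cmod (f y - f x - l * (iota y - iota x))%C <= eps * Cmod (iota y - iota x).

Lemma Cmod_minus_sym (x y : C) : Cmod (x - y)%C = Cmod (y - x)%C.
Proof. replace (x - y)%C with (- (y - x))%C by ring. apply Cmod_opp. Qed.

Lemma Cmod_le_plus (x y : C) (a b : R) : Cmod x <= a -> Cmod y <= b -> Cmod (x + y)%C <= a + b.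
Proof. intros; generalize (Cmod_triangle x y); lra. Qed.

Lemma Cmod_sub_ge (x y : C) : Cmod x - Cmod y <= Cmod (x - y)%C.
Proof.
  generalize (Cmod_triangle (x - y) y); replace (x - y + y)%C with x by ring; lra.
Qed.

Section Der.
Context {X : Type} (iota : X -> C).

Lemma der_eq (f : X -> C) x l l' : l = l' -> der iota f x l -> der iota f x l'.
Proof. now intros ->. Qed.

Lemma der_lip (f : X -> C) x l : der iota f x l -> exists d, 0 < d /\ forall y,
  Cmod (iota y - iota x) < d -> Cmod (f y - f x)%C <= (Cmod l + 1) * Cmod (iota y - iota x).
Proof.
  intros H; destruct (H 1 Rlt_0_1) as [d [Hd Hy]]; exists d; split; auto.
  intros y Hyd; specialize (Hy y Hyd).
  replace (f y - f x)%C with (l * (iota y - iota x) + (f y - f x - l * (iota y - iota x)))%C by ring.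
  eapply Rle_trans; [apply Cmod_triangle|]; rewrite Cmod_mult; lra.
Qed.

Lemma der_cont (f : X -> C) x l : der iota f x l -> forall eps, 0 < eps ->
  exists d, 0 < d /\ forall y, Cmod (iota y - iota x) < d -> Cmod (f y - f x)%C < eps.
Proof.
  intros H eps He; destruct (der_lip f x l H) as [d [Hd Hy]].
  generalize (Cmod_ge_0 l); intros Hl.
  exists (Rmin d (eps / (Cmod l + 1))); split.
  - apply Rmin_pos; auto; apply Rdiv_lt_0_compat; lra.
  - intros y Hyd; eapply Rle_lt_trans; [apply Hy|].
    + eapply Rlt_le_trans; [apply Hyd|apply Rmin_l].
    + assert (Cmod (iota y - iota x) < eps / (Cmod l + 1)).
      { eapply Rlt_le_trans; [apply Hyd|apply Rmin_r]. }
      apply Rmult_lt_compat_l with (r := Cmod l + 1) in H0; [|lra].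
      replace ((Cmod l + 1) * (eps / (Cmod l + 1))) with eps in H0 by (field; lra). lra.
Qed.

Lemma der_ext_loc (f g : X -> C) x l d : 0 < d ->
  (forall y, Cmod (iota y - iota x) < d -> f y = g y) -> der iota f x l -> der iota g x l.
Proof.
  intros Hd E H eps He; destruct (H eps He) as [d' [Hd' Hy]].
  exists (Rmin d d'); split; [now apply Rmin_pos|].
  intros y Hyd. rewrite <- (E y), <- (E x).
  - apply Hy; eapply Rlt_le_trans; [apply Hyd|apply Rmin_r].
  - replace (iota x - iota x)%C with (RtoC 0) by ring; rewrite Cmod_0; auto.
  - eapply Rlt_le_trans; [apply Hyd|apply Rmin_l].
Qed.

Lemma der_ext (f g : X -> C) x l : (forall y, f y = g y) -> der iota f x l -> der iota g x l.
Proof. intros E; apply der_ext_loc with (d := 1); auto; lra. Qed.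

Lemma der_const (k : C) x : der iota (fun _ => k) x (RtoC 0).
Proof.
  intros eps He; exists 1; split; [lra|]; intros y _.
  replace (k - k - 0 * (iota y - iota x))%C with (RtoC 0) by ring.
  rewrite Cmod_0; apply Rmult_le_pos; [lra|apply Cmod_ge_0].
Qed.

Lemma der_id x : der iota iota x (RtoC 1).
Proof.
  intros eps He; exists 1; split; [lra|]; intros y _.
  replace (iota y - iota x - 1 * (iota y - iota x))%C with (RtoC 0) by ring.
  rewrite Cmod_0; apply Rmult_le_pos; [lra|apply Cmod_ge_0].
Qed.

Lemma der_plus (f g : X -> C) x l m : der iota f x l -> der iota g x m ->
  der iota (fun y => f y + g y)%C x (l + m)%C.
Proof.
  intros Hf Hg eps He.
  destruct (Hf (eps / 2)) as [d1 [Hd1 H1]]; [lra|].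
  destruct (Hg (eps / 2)) as [d2 [Hd2 H2]]; [lra|].
  exists (Rmin d1 d2); split; [now apply Rmin_pos|]; intros y Hy.
  replace (f y + g y - (f x + g x) - (l + m) * (iota y - iota x))%C with
    ((f y - f x - l * (iota y - iota x)) + (g y - g x - m * (iota y - iota x)))%C by ring.
  replace (eps * Cmod (iota y - iota x)) with
    (eps / 2 * Cmod (iota y - iota x) + eps / 2 * Cmod (iota y - iota x)) by field.
  apply Cmod_le_plus.
  - now apply H1; apply Rlt_Rmin in Hy.
  - now apply H2; apply Rlt_Rmin in Hy.
Qed.

Lemma der_mult (f g : X -> C) x l m : der iota f x l -> der iota g x m ->
  der iota (fun y => f y * g y)%C x (l * g x + f x * m)%C.
Proof.
  intros Hf Hg eps He.
  (* The added 1 keeps the three bounds positive, so that [eps] can be divided by them. *)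
  set (A := Cmod (g x) + 1). set (B := Cmod (f x) + 1). set (L := Cmod l + 1).
  assert (PA : 0 < A) by (generalize (Cmod_ge_0 (g x)); unfold A; lra).
  assert (PB : 0 < B) by (generalize (Cmod_ge_0 (f x)); unfold B; lra).
  assert (PL : 0 < L) by (generalize (Cmod_ge_0 l); unfold L; lra).
  destruct (Hf (eps / (3 * A))) as [d1 [Hd1 H1]]; [apply Rdiv_lt_0_compat; lra|].
  destruct (Hg (eps / (3 * B))) as [d2 [Hd2 H2]]; [apply Rdiv_lt_0_compat; lra|].
  destruct (der_lip f x l Hf) as [d3 [Hd3 H3]].
  destruct (der_cont g x m Hg (eps / (3 * L))) as [d4 [Hd4 H4]]; [apply Rdiv_lt_0_compat; lra|].
  exists (Rmin (Rmin d1 d2) (Rmin d3 d4)); split; [repeat apply Rmin_pos; auto|].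
  intros y Hy.
  apply Rlt_Rmin in Hy as [[Hy1 Hy2]%Rlt_Rmin [Hy3 Hy4]%Rlt_Rmin].
  specialize (H1 y Hy1). specialize (H2 y Hy2). specialize (H3 y Hy3). specialize (H4 y Hy4).
  fold L in H3.
  replace (f y * g y - f x * g x - (l * g x + f x * m) * (iota y - iota x))%C with
   (g x * (f y - f x - l * (iota y - iota x)) + f x * (g y - g x - m * (iota y - iota x))
     + (f y - f x) * (g y - g x))%C by ring.
  set (h := Cmod (iota y - iota x)) in *.
  assert (Ph : 0 <= h) by apply Cmod_ge_0.
  replace (eps * h) with (A * (eps / (3 * A) * h) + B * (eps / (3 * B) * h) + L * h * (eps / (3 * L)))
    by (field; lra).
  apply Cmod_le_plus; [apply Cmod_le_plus|]; rewrite Cmod_mult; apply Rmult_le_compat;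
    try apply Cmod_ge_0; auto; try (unfold A, B; lra).
Qed.

Lemma der_scal (k : C) (f : X -> C) x l : der iota f x l -> der iota (fun y => k * f y)%C x (k * l)%C.
Proof.
  intros H; apply der_eq with (0 * f x + k * l)%C; [ring|].
  apply (der_mult (fun _ => k)); [apply der_const|auto].
Qed.

Lemma der_opp (f : X -> C) x l : der iota f x l -> der iota (fun y => - f y)%C x (- l)%C.
Proof.
  intros H; apply der_eq with ((- (1)) * l)%C; [ring|].
  apply der_ext with (f := fun y => (- (1) * f y)%C); [intros; ring|].
  now apply der_scal.
Qed.

Lemma der_minus (f g : X -> C) x l m : der iota f x l -> der iota g x m ->
  der iota (fun y => f y - g y)%C x (l - m)%C.
Proof. intros; apply der_plus; auto; now apply der_opp. Qed.

Lemma der_inv (f : X -> C) x l : f x <> RtoC 0 -> der iota f x l ->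
  der iota (fun y => / f y)%C x (- l / (f x * f x))%C.
Proof.
  intros Hnz Hf eps He.
  set (a := Cmod (f x)).
  assert (Ha : 0 < a) by now apply Cmod_gt_0.
  destruct (der_cont f x l Hf (a / 2)) as [d1 [Hd1 H1]]; [lra|].
  destruct (Hf (eps * (a * a) / 4)) as [d2 [Hd2 H2]]; [assert (0 < a * a) by nra; nra|].
  set (L := Cmod l + 1).
  assert (PL : 0 < L) by (generalize (Cmod_ge_0 l); unfold L; lra).
  destruct (der_cont f x l Hf (eps * (a * a * a) / (4 * L))) as [d3 [Hd3 H3]].
  { apply Rdiv_lt_0_compat; [|lra]. repeat apply Rmult_lt_0_compat; auto. }
  exists (Rmin d1 (Rmin d2 d3)); split; [repeat apply Rmin_pos; auto|].
  intros y Hy.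
  apply Rlt_Rmin in Hy as [Hy1 [Hy2 Hy3]%Rlt_Rmin].
  specialize (H1 y Hy1). specialize (H2 y Hy2). specialize (H3 y Hy3).
  set (h := Cmod (iota y - iota x)) in *.
  assert (Ph : 0 <= h) by apply Cmod_ge_0.
  assert (Hb : a / 2 <= Cmod (f y)).
  { generalize (Cmod_sub_ge (f x) (f y)); rewrite Cmod_minus_sym; fold a; lra. }
  assert (Hynz : f y <> RtoC 0) by (apply Cmod_gt_0; lra).
  replace (/ f y - / f x - - l / (f x * f x) * (iota y - iota x))%C with
   ((- f x * (f y - f x - l * (iota y - iota x)) + l * (iota y - iota x) * (f y - f x)) / (f y * f x * f x))%C.
  2:{ field; auto. }
  rewrite Cmod_div by (repeat apply Cmult_neq_0; auto).
  rewrite !Cmod_mult. fold a.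
  assert (Hden : a / 2 * a * a <= Cmod (f y) * a * a).
  { apply Rmult_le_compat_r; [lra|]. apply Rmult_le_compat_r; lra. }
  assert (Hpos : 0 < a / 2 * a * a) by (repeat apply Rmult_lt_0_compat; lra).
  apply Rmult_le_reg_r with (Cmod (f y) * a * a); [lra|].
  unfold Rdiv; rewrite Rmult_assoc, Rinv_l, Rmult_1_r by lra.
  apply Rle_trans with (eps * h * (a / 2 * a * a)).
  2:{ apply Rmult_le_compat_l; auto. apply Rmult_le_pos; lra. }
  replace (eps * h * (a / 2 * a * a)) with
    (a * (eps * (a * a) / 4 * h) + L * h * (eps * (a * a * a) / (4 * L))) by (field; lra).
  apply Cmod_le_plus; rewrite !Cmod_mult.
  - rewrite Cmod_opp; fold a. apply Rmult_le_compat_l; [lra|auto].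
  - apply Rmult_le_compat; try apply Rmult_le_pos; try apply Cmod_ge_0; try lra.
    fold h; apply Rmult_le_compat_r; auto; unfold L; lra.
Qed.

Lemma der_div (f g : X -> C) x l m : g x <> RtoC 0 -> der iota f x l -> der iota g x m ->
  der iota (fun y => f y / g y)%C x ((l * g x - f x * m) / (g x * g x))%C.
Proof.
  intros Hnz Hf Hg.
  apply der_eq with (l * (/ g x) + f x * (- m / (g x * g x)))%C; [field; auto|].
  apply der_mult; auto. now apply der_inv.
Qed.

(** With [iota] the identity this is the complex chain rule; with [iota := RtoC] it differentiates a
    holomorphic function along a curve. *)
Lemma der_comp (gam : X -> C) (f : C -> C) x l m :
  der (fun z => z) f (gam x) l -> der iota gam x m -> der iota (fun y => f (gam y)) x (l * m)%C.
Proof.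
  intros Hf Hg eps He.
  set (L := Cmod l + 1). set (M := Cmod m + 1).
  assert (PL : 0 < L) by (generalize (Cmod_ge_0 l); unfold L; lra).
  assert (PM : 0 < M) by (generalize (Cmod_ge_0 m); unfold M; lra).
  destruct (Hf (eps / (2 * M))) as [d1 [Hd1 H1]]; [apply Rdiv_lt_0_compat; lra|].
  destruct (Hg (eps / (2 * L))) as [d2 [Hd2 H2]]; [apply Rdiv_lt_0_compat; lra|].
  destruct (der_lip gam x m Hg) as [d3 [Hd3 H3]].
  destruct (der_cont gam x m Hg d1 Hd1) as [d4 [Hd4 H4]].
  exists (Rmin d2 (Rmin d3 d4)); split; [repeat apply Rmin_pos; auto|].
  intros y Hy.
  apply Rlt_Rmin in Hy as [Hy2 [Hy3 Hy4]%Rlt_Rmin].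
  specialize (H2 y Hy2). specialize (H3 y Hy3). specialize (H4 y Hy4). specialize (H1 (gam y) H4).
  cbv beta in H1. fold M in H3.
  set (h := Cmod (iota y - iota x)) in *.
  assert (Ph : 0 <= h) by apply Cmod_ge_0.
  replace (f (gam y) - f (gam x) - l * m * (iota y - iota x))%C with
   ((f (gam y) - f (gam x) - l * (gam y - gam x)) + l * (gam y - gam x - m * (iota y - iota x)))%C by ring.
  replace (eps * h) with (eps / (2 * M) * (M * h) + L * (eps / (2 * L) * h)) by (field; lra).
  apply Cmod_le_plus.
  - eapply Rle_trans; [apply H1|]. apply Rmult_le_compat_l; auto.
    apply Rlt_le, Rdiv_lt_0_compat; lra.
  - rewrite Cmod_mult; apply Rmult_le_compat; try apply Cmod_ge_0; auto. unfold L; lra.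
Qed.

Lemma der_pow (f : X -> C) x l n : der iota f x l ->
  der iota (fun y => f y ^ n)%C x (RtoC (INR n) * f x ^ pred n * l)%C.
Proof.
  intros H; induction n as [|n IH].
  - apply der_eq with (RtoC 0); [simpl; ring|]. apply (der_const (RtoC 1)).
  - eapply der_eq; [|apply (der_mult f (fun y => f y ^ n)%C); [apply H|apply IH]].
    destruct n; [simpl; ring|].
    rewrite (S_INR (S n)), RtoC_plus. simpl pred. simpl Cpow. ring.
Qed.

End Der.

Definition cder : (C -> C) -> C -> C -> Prop := der (fun z => z).
Definition rder : (R -> C) -> R -> C -> Prop := der RtoC.

Lemma Cmod_RtoC_minus (x y : R) : Cmod (RtoC x - RtoC y)%C = Rabs (x - y).
Proof. now rewrite <- RtoC_minus, Cmod_R. Qed.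

Lemma der_unique {X} (iota f : X -> C) x l m :
  (forall d, 0 < d -> exists y, iota y <> iota x /\ Cmod (iota y - iota x) < d) ->
  der iota f x l -> der iota f x m -> l = m.
Proof.
  intros Hacc Hl Hm. apply Ceq_minus, Cmod_eq_0, Rle_antisym; [|apply Cmod_ge_0].
  apply Rnot_lt_le; intros Hpos.
  set (e := Cmod (l - m)) in *.
  destruct (Hl (e / 4)) as [d1 [Hd1 H1]]; [lra|].
  destruct (Hm (e / 4)) as [d2 [Hd2 H2]]; [lra|].
  destruct (Hacc (Rmin d1 d2)) as [y [Hy Hyd]]; [now apply Rmin_pos|].
  apply Rlt_Rmin in Hyd as [Hy1 Hy2]. specialize (H1 y Hy1). specialize (H2 y Hy2).
  assert (Hh : 0 < Cmod (iota y - iota x)).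
  { apply Cmod_gt_0; intros E; apply Hy; now apply Ceq_minus. }
  assert (e * Cmod (iota y - iota x) <= (e / 4 + e / 4) * Cmod (iota y - iota x)).
  { unfold e at 1; rewrite <- Cmod_mult.
    replace ((l - m) * (iota y - iota x))%C with
     ((f y - f x - m * (iota y - iota x)) + - (f y - f x - l * (iota y - iota x)))%C by ring.
    rewrite Rmult_plus_distr_r. apply Cmod_le_plus; auto. now rewrite Cmod_opp. }
  nra.
Qed.

Lemma rder_unique f x l m : rder f x l -> rder f x m -> l = m.
Proof.
  apply der_unique; intros d Hd; exists (x + d / 2); split.
  - intros E; apply RtoC_inj in E; lra.
  - rewrite Cmod_RtoC_minus, Rabs_right; lra.
Qed.

Lemma cder_unique f x l m : cder f x l -> cder f x m -> l = m.
Proof.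
  apply der_unique; intros d Hd; exists (x + RtoC (d / 2))%C; split.
  - intros E; apply Ceq_minus in E; replace (x + RtoC (d / 2) - x)%C with (RtoC (d/2)) in E by ring.
    apply RtoC_inj in E; lra.
  - replace (x + RtoC (d / 2) - x)%C with (RtoC (d/2)) by ring.
    rewrite Cmod_R, Rabs_right; lra.
Qed.

(** The balls of [C_UniformSpace] are squares, those of [Cmod] are discs; the radii differ by the
    factor sqrt 2, which halving absorbs. *)
Lemma C_locally_Cmod (z : C) (P : C -> Prop) :
  locally (T := C_UniformSpace) z P <-> exists d, 0 < d /\ forall w, Cmod (w - z)%C < d -> P w.
Proof.
  split.
  - intros [d H]; exists d; split; [apply cond_pos|]; intros w Hw; apply H.
    now apply C_NormedModule_mixin_compat1.
  - intros [d [Hd H]].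
    assert (Hd2 : 0 < d / 2) by lra. exists (mkposreal _ Hd2); intros w Hw; apply H.
    eapply Rlt_le_trans; [apply (C_NormedModule_mixin_compat2 z w _ Hw)|]. simpl.
    assert (sqrt 2 < 2). { rewrite <- (sqrt_square 2) at 2 by lra. apply sqrt_lt_1; lra. }
    nra.
Qed.

(** The second uniform structure on [C], with round balls: [is_derive] over [C_AbsRing] uses this
    one on its domain. *)
Lemma C_locally_abs (z : C) (P : C -> Prop) :
  locally (T := AbsRing_UniformSpace C_AbsRing) z P <->
  exists d, 0 < d /\ forall w, Cmod (w - z)%C < d -> P w.
Proof.
  split.
  - intros [d H]; exists d; split; [apply cond_pos|]; intros w Hw; now apply H.
  - intros [d [Hd H]]; exists (mkposreal d Hd); intros w Hw; now apply H.
Qed.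

Lemma cder_is_derive f z l :
  cder f z l <-> is_derive (K := C_AbsRing) (V := C_NormedModule) f z l.
Proof.
  split.
  - intros H; split; [apply is_linear_scal_l|].
    intros x Hx.
    assert (x = z).
    { symmetry; exact (is_filter_lim_locally_unique (K := C_AbsRing) (V := AbsRing_NormedModule C_AbsRing) z x Hx). }
    subst x. intros eps. apply C_locally_abs.
    destruct (H eps (cond_pos eps)) as [d [Hd Hy]]; exists d; split; auto.
    intros w Hw. specialize (Hy w Hw). cbv beta in Hy.
    change (Cmod (f w - f z - (w - z) * l)%C <= eps * Cmod (w - z)%C).
    now rewrite (Cmult_comm (w - z) l).
  - intros [_ H] eps He.
    specialize (H z (fun P H => H) (mkposreal eps He)).
    apply C_locally_abs in H. destruct H as [d [Hd Hy]]; exists d; split; auto.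
    intros w Hw. specialize (Hy w Hw).
    change (Cmod (f w - f z - (w - z) * l)%C <= eps * Cmod (w - z)%C) in Hy.
    now rewrite (Cmult_comm (w - z) l) in Hy.
Qed.

Lemma rder_is_derive f x l :
  rder f x l <-> is_derive (V := C_R_NormedModule) f x l.
Proof.
  assert (E : forall y, Cmod (f y - f x - l * (RtoC y - RtoC x))%C =
     norm (V := C_R_NormedModule) (minus (minus (f y) (f x)) (scal (minus y x) l))).
  { intros y. rewrite scal_R_Cmult.
    change (minus y x) with (y - x). rewrite RtoC_minus.
    rewrite (Cmult_comm l). unfold norm; simpl.
    unfold Cmod, prod_norm, norm; simpl. unfold abs; simpl. f_equal. f_equal;
    rewrite !Rmult_1_r; apply Rsqr_abs. }
  split.
  - intros H; split; [apply is_linear_scal_l|].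
    intros y Hy.
    assert (y = x).
    { symmetry; exact (is_filter_lim_locally_unique (V := AbsRing_NormedModule R_AbsRing) x y Hy). }
    subst y. intros eps.
    destruct (H eps (cond_pos eps)) as [d [Hd Hyy]]; exists (mkposreal d Hd).
    intros w Hw. eapply Rle_trans; [right; symmetry; apply E|].
    specialize (Hyy w). rewrite Cmod_RtoC_minus in Hyy. now apply Hyy.
  - intros [_ H] eps He.
    specialize (H x (fun P H => H) (mkposreal eps He)).
    destruct H as [d Hy]; exists d; split; [apply cond_pos|].
    intros w Hw. rewrite Cmod_RtoC_minus in *. specialize (Hy w Hw).
    eapply Rle_trans; [right; apply E|]. exact Hy.
Qed.

Lemma C_eta_re_im (z : C) : z = (Re z, Im z).
Proof. now destruct z. Qed.

Lemma rder_parts f x l :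
  rder f x l <-> is_derive (fun y => Re (f y)) x (Re l) /\ is_derive (fun y => Im (f y)) x (Im l).
Proof.
  split.
  - intros H. split.
    + split; [apply is_linear_scal_l|]. intros y Hy.
      assert (y = x).
      { symmetry; exact (is_filter_lim_locally_unique (V := AbsRing_NormedModule R_AbsRing) x y Hy). }
      subst y. intros eps.
      destruct (H eps (cond_pos eps)) as [d [Hd Hyy]]; exists (mkposreal d Hd).
      intros w Hw. specialize (Hyy w). rewrite Cmod_RtoC_minus in Hyy. specialize (Hyy Hw).
      eapply Rle_trans; [|apply Hyy]. eapply Rle_trans; [|apply re_le_Cmod].
      right. unfold norm; simpl; unfold abs; simpl. f_equal.
      unfold minus, plus, opp, scal, mult; simpl. unfold mult; simpl. unfold Re; simpl. ring.
    + split; [apply is_linear_scal_l|]. intros y Hy.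
      assert (y = x).
      { symmetry; exact (is_filter_lim_locally_unique (V := AbsRing_NormedModule R_AbsRing) x y Hy). }
      subst y. intros eps.
      destruct (H eps (cond_pos eps)) as [d [Hd Hyy]]; exists (mkposreal d Hd).
      intros w Hw. specialize (Hyy w). rewrite Cmod_RtoC_minus in Hyy. specialize (Hyy Hw).
      eapply Rle_trans; [|apply Hyy].
      eapply Rle_trans; [|eapply Rle_trans; [apply Rmax_r|apply Rmax_Cmod]].
      right. unfold norm; simpl; unfold abs; simpl. f_equal.
      unfold minus, plus, opp, scal, mult; simpl. unfold mult; simpl. unfold Im; simpl. ring.
  - intros [[_ H1] [_ H2]] eps He.
    assert (He2 : 0 < eps / 2) by lra.
    specialize (H1 x (fun P H => H) (mkposreal _ He2)).
    specialize (H2 x (fun P H => H) (mkposreal _ He2)).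
    destruct (filter_and _ _ H1 H2) as [d Hd]; exists d; split; [apply cond_pos|].
    intros y Hy. rewrite Cmod_RtoC_minus in *.
    destruct (Hd y Hy) as [Ha Hb].
    change (norm (minus y x)) with (Rabs (y - x)) in Ha, Hb. simpl in Ha, Hb.
    set (u := (f y - f x - l * (RtoC y - RtoC x))%C).
    assert (Ea : Rabs (Re u) <= eps / 2 * Rabs (y - x)).
    { eapply Rle_trans; [|apply Ha]. right. unfold norm; simpl; unfold abs; simpl. f_equal.
      unfold u, minus, plus, opp, scal, mult; simpl. unfold mult; simpl. unfold Re; simpl. ring. }
    assert (Eb : Rabs (Im u) <= eps / 2 * Rabs (y - x)).
    { eapply Rle_trans; [|apply Hb]. right. unfold norm; simpl; unfold abs; simpl. f_equal.
      unfold u, minus, plus, opp, scal, mult; simpl. unfold mult; simpl. unfold Im; simpl. ring. }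
    replace u with (RtoC (Re u) + Ci * RtoC (Im u))%C.
    2:{ apply injective_projections; simpl; unfold Im, Re; simpl; ring. }
    replace (eps * Rabs (y - x)) with (eps / 2 * Rabs (y - x) + eps / 2 * Rabs (y - x)) by field.
    apply Cmod_le_plus; [now rewrite Cmod_R|].
    now rewrite Cmod_mult, Cmod_Ci, Rmult_1_l, Cmod_R.
Qed.

Lemma rder_rD f x l : rder f x l -> rD f x = l.
Proof.
  intros H; apply rder_parts in H; destruct H as [H1 H2].
  apply injective_projections; apply is_derive_unique; assumption.
Qed.

Lemma rder_conj f x l : rder f x l -> rder (fun y => Cconj (f y)) x (Cconj l).
Proof.
  intros H; apply rder_parts in H; destruct H as [H1 H2]; apply rder_parts; split.
  - exact H1.
  - simpl. now apply (is_derive_opp (fun y => snd (f y))).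
Qed.

Lemma rder_Re f x l : rder f x l -> rder (fun y => RtoC (Re (f y))) x (RtoC (Re l)).
Proof.
  intros H; apply rder_parts in H; destruct H as [H1 H2]; apply rder_parts; split.
  - exact H1.
  - simpl. apply (is_derive_const 0).
Qed.

Lemma rder_RtoC (f : R -> R) x l : rder (fun y => RtoC (f y)) x (RtoC l) <-> is_derive f x l.
Proof.
  split.
  - intros H; apply rder_parts in H; exact (proj1 H).
  - intros H; apply rder_parts; split; [exact H|apply (is_derive_const 0)].
Qed.

(** Schwarz reflection: the antilinearity of the inner conjugation is undone by the outer one. *)
Lemma cder_conj_refl f z l : cder f (Cconj z) l -> cder (fun w => Cconj (f (Cconj w))) z (Cconj l).
Proof.
  intros H eps He; destruct (H eps He) as [d [Hd Hy]]; exists d; split; auto.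
  intros w Hw. specialize (Hy (Cconj w)). cbv beta in *.
  rewrite <- Cminus_conj, Cmod_conj in Hy. specialize (Hy Hw).
  replace (Cconj (f (Cconj w)) - Cconj (f (Cconj z)) - Cconj l * (w - z))%C
    with (Cconj (f (Cconj w) - f (Cconj z) - l * Cconj (w - z)))%C.
  - now rewrite Cmod_conj.
  - now rewrite !Cminus_conj, Cmult_conj, !Cminus_conj, !Cconj_conj.
Qed.

(* [A] and [B] are the Wirtinger derivatives of [f], read off its two partial derivatives. *)
Definition wirt (f : C -> C) (z A B : C) : Prop :=
  rder (fun s => f (s, Im z)) (Re z) (A + B)%C /\
  rder (fun t => f (Re z, t)) (Im z) (Ci * (A - B))%C.

Lemma Ci2 : (Ci * Ci = - (1))%C.
Proof. apply injective_projections; simpl; ring. Qed.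

Lemma rder_horiz (y x : R) : rder (fun s => (s, y) : C) x (RtoC 1).
Proof. apply rder_parts; split; simpl; [exact (is_derive_id (K := R_AbsRing) x)|exact (is_derive_const (V := R_NormedModule) y x)]. Qed.

Lemma rder_vert (x y : R) : rder (fun t => (x, t) : C) y Ci.
Proof. apply rder_parts; split; simpl; [exact (is_derive_const (V := R_NormedModule) x y)|exact (is_derive_id (K := R_AbsRing) y)]. Qed.

Lemma wirt_eq f z A B A' B' : A = A' -> B = B' -> wirt f z A B -> wirt f z A' B'.
Proof. now intros -> ->. Qed.

Lemma wirt_holo f z l : cder f z l -> wirt f z l (RtoC 0).
Proof.
  intros H; destruct z as [x y]; split; simpl.
  - eapply der_eq; [|apply (der_comp _ (fun s => (s, y) : C) f); [exact H|apply rder_horiz]]. ring.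
  - eapply der_eq; [|apply (der_comp _ (fun t => (x, t) : C) f); [exact H|apply rder_vert]]. ring.
Qed.

Lemma wirt_conj f z A B : wirt f z A B -> wirt (fun w => Cconj (f w)) z (Cconj B) (Cconj A).
Proof.
  intros [H1 H2]; split.
  - eapply der_eq; [|apply rder_conj, H1]. rewrite Cplus_conj; ring.
  - eapply der_eq; [|apply rder_conj, H2]. rewrite Cmult_conj, Cminus_conj.
    replace (Cconj Ci) with (- Ci)%C; [ring|]. apply injective_projections; simpl; ring.
Qed.

Lemma wirt_const k z : wirt (fun _ => k) z (RtoC 0) (RtoC 0).
Proof. split; (eapply der_eq; [|apply der_const]); ring. Qed.

Lemma wirt_plus f g z A B A' B' : wirt f z A B -> wirt g z A' B' ->
  wirt (fun w => f w + g w)%C z (A + A')%C (B + B')%C.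
Proof.
  intros [H1 H2] [H3 H4]; split.
  - eapply der_eq; [|apply der_plus; [apply H1|apply H3]]; ring.
  - eapply der_eq; [|apply der_plus; [apply H2|apply H4]]; ring.
Qed.

Lemma wirt_mult f g z A B A' B' : wirt f z A B -> wirt g z A' B' ->
  wirt (fun w => f w * g w)%C z (A * g z + f z * A')%C (B * g z + f z * B')%C.
Proof.
  destruct z as [x y]; intros [H1 H2] [H3 H4]; split.
  - eapply der_eq; [|apply (der_mult RtoC (fun s => f (s, y)) (fun s => g (s, y))); [apply H1|apply H3]]; simpl; ring.
  - eapply der_eq; [|apply (der_mult RtoC (fun t => f (x, t)) (fun t => g (x, t))); [apply H2|apply H4]]; simpl; ring.
Qed.

Lemma wirt_scal k f z A B : wirt f z A B -> wirt (fun w => k * f w)%C z (k * A)%C (k * B)%C.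
Proof.
  intros H; eapply wirt_eq; [| |apply (wirt_mult (fun _ => k) f); [apply wirt_const|exact H]]; cbv beta; ring.
Qed.

Lemma wirt_minus f g z A B A' B' : wirt f z A B -> wirt g z A' B' ->
  wirt (fun w => f w - g w)%C z (A - A')%C (B - B')%C.
Proof.
  intros [H1 H2] [H3 H4]; split.
  - eapply der_eq; [|apply der_minus; [apply H1|apply H3]]; ring.
  - eapply der_eq; [|apply der_minus; [apply H2|apply H4]]; ring.
Qed.

Lemma wirt_inv f z A B : f z <> RtoC 0 -> wirt f z A B ->
  wirt (fun w => / f w)%C z (- A / (f z * f z))%C (- B / (f z * f z))%C.
Proof.
  destruct z as [x y]; intros Hnz [H1 H2]; split.
  - eapply der_eq; [|apply (der_inv RtoC (fun s => f (s, y))); [exact Hnz|apply H1]]; simpl; field; auto.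
  - eapply der_eq; [|apply (der_inv RtoC (fun t => f (x, t))); [exact Hnz|apply H2]]; simpl; field; auto.
Qed.

Lemma wirt_div f g z A B A' B' : g z <> RtoC 0 -> wirt f z A B -> wirt g z A' B' ->
  wirt (fun w => f w / g w)%C z ((A * g z - f z * A') / (g z * g z))%C
    ((B * g z - f z * B') / (g z * g z))%C.
Proof.
  intros Hnz Hf Hg; eapply wirt_eq; [| |apply (wirt_mult f (fun w => / g w)%C); [exact Hf|apply wirt_inv; [exact Hnz|exact Hg]]]; cbv beta;
  field; auto.
Qed.

Lemma Cmod_horiz (s x y : R) : Cmod ((s, y) - (x, y))%C = Rabs (s - x).
Proof.
  rewrite <- Cmod_RtoC_minus. f_equal. apply injective_projections; simpl; ring.
Qed.
Lemma Cmod_vert (t x y : R) : Cmod ((x, t) - (x, y))%C = Rabs (t - y).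
Proof.
  rewrite <- (Rmult_1_l (Rabs _)), <- Cmod_Ci, <- Cmod_RtoC_minus, <- Cmod_mult. f_equal.
  apply injective_projections; simpl; ring.
Qed.

Lemma wirt_ext_loc f g z A B d : 0 < d -> (forall w, Cmod (w - z)%C < d -> f w = g w) ->
  wirt f z A B -> wirt g z A B.
Proof.
  intros Hd E [H1 H2]; rewrite (C_eta_re_im z) in E; split;
  (eapply der_ext_loc; [exact Hd| |eassumption]); intros y Hy; apply E;
  rewrite Cmod_RtoC_minus in Hy; [now rewrite Cmod_horiz|now rewrite Cmod_vert].
Qed.

Lemma wirt_cps f z A B : wirt f z A B -> cps f z = (A + B)%C.
Proof. intros [H _]; exact (rder_rD _ _ _ H). Qed.
Lemma wirt_cpt f z A B : wirt f z A B -> cpt f z = (Ci * (A - B))%C.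
Proof. intros [_ H]; exact (rder_rD _ _ _ H). Qed.

Lemma RtoC_neq (x y : R) : x <> y -> RtoC x <> RtoC y.
Proof. intros H E; now apply H, RtoC_inj. Qed.

Lemma C2_nz : RtoC 2 <> RtoC 0.
Proof. apply RtoC_neq; lra. Qed.

Lemma wirt_dz f z A B : wirt f z A B -> dz f z = A.
Proof.
  intros H; unfold dz. rewrite (wirt_cps _ _ _ _ H), (wirt_cpt _ _ _ _ H).
  rewrite Cmult_assoc, Ci2. field.
Qed.
Lemma wirt_dzbar f z A B : wirt f z A B -> dzbar f z = B.
Proof.
  intros H; unfold dzbar. rewrite (wirt_cps _ _ _ _ H), (wirt_cpt _ _ _ _ H).
  rewrite Cmult_assoc, Ci2. field.
Qed.

(** * Continuity, the mean value inequality and the Cauchy-Riemann equations *)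

Section Continuity.
Context {X : Type} (dist : X -> X -> R).

Definition contat (f : X -> C) (t : X) : Prop :=
  forall eps, 0 < eps -> exists d, 0 < d /\ forall u, dist u t < d -> Cmod (f u - f t)%C < eps.

Lemma contat_const k t : contat (fun _ => k) t.
Proof.
  intros eps He; exists 1; split; [lra|]; intros; replace (k - k)%C with (RtoC 0) by ring.
  now rewrite Cmod_0.
Qed.

Lemma contat_minus f g t : contat f t -> contat g t -> contat (fun u => f u - g u)%C t.
Proof.
  intros Hf Hg eps He.
  destruct (Hf (eps / 2)) as [d [Hd H1]]; [lra|]. destruct (Hg (eps / 2)) as [e [Hee H2]]; [lra|].
  exists (Rmin d e); split; [now apply Rmin_pos|]; intros u Hu.
  apply Rlt_Rmin in Hu as [Hu1 Hu2]. specialize (H1 u Hu1). specialize (H2 u Hu2).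
  replace (f u - g u - (f t - g t))%C with ((f u - f t) + - (g u - g t))%C by ring.
  eapply Rle_lt_trans; [apply Cmod_triangle|]. rewrite Cmod_opp; lra.
Qed.

Lemma contat_plus f g t : contat f t -> contat g t -> contat (fun u => f u + g u)%C t.
Proof.
  intros Hf Hg eps He.
  destruct (Hf (eps / 2)) as [d [Hd H1]]; [lra|]. destruct (Hg (eps / 2)) as [e [Hee H2]]; [lra|].
  exists (Rmin d e); split; [now apply Rmin_pos|]; intros u Hu.
  apply Rlt_Rmin in Hu as [Hu1 Hu2]. specialize (H1 u Hu1). specialize (H2 u Hu2).
  replace (f u + g u - (f t + g t))%C with ((f u - f t) + (g u - g t))%C by ring.
  eapply Rle_lt_trans; [apply Cmod_triangle|]. lra.
Qed.

Lemma contat_mult f g t : contat f t -> contat g t -> contat (fun u => f u * g u)%C t.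
Proof.
  intros Hf Hg eps He.
  set (A := Cmod (g t) + 1). set (B := Cmod (f t) + 1).
  assert (PA : 0 < A) by (generalize (Cmod_ge_0 (g t)); unfold A; lra).
  assert (PB : 0 < B) by (generalize (Cmod_ge_0 (f t)); unfold B; lra).
  destruct (Hf (eps / (2 * A))) as [d [Hd H1]]; [apply Rdiv_lt_0_compat; lra|].
  destruct (Hg (Rmin 1 (eps / (2 * B)))) as [e [Hee H2]]; [apply Rmin_pos; [lra|apply Rdiv_lt_0_compat; lra]|].
  exists (Rmin d e); split; [now apply Rmin_pos|]; intros u Hu.
  apply Rlt_Rmin in Hu as [Hu1 Hu2]. specialize (H1 u Hu1). specialize (H2 u Hu2).
  apply Rlt_Rmin in H2 as [H3 H4].
  replace (f u * g u - f t * g t)%C with ((f u - f t) * g u + f t * (g u - g t))%C by ring.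
  assert (Hgu : Cmod (g u) <= A).
  { replace (g u) with ((g u - g t) + g t)%C by ring. unfold A; rewrite Rplus_comm.
    apply Cmod_le_plus; lra. }
  eapply Rle_lt_trans; [apply Cmod_triangle|]. rewrite !Cmod_mult.
  replace eps with (eps / (2 * A) * A + B * (eps / (2 * B))) by (field; lra).
  apply Rplus_lt_le_compat.
  - apply Rle_lt_trans with (Cmod (f u - f t)%C * A).
    + apply Rmult_le_compat_l; auto; apply Cmod_ge_0.
    + now apply Rmult_lt_compat_r.
  - apply Rmult_le_compat; try apply Cmod_ge_0; [unfold B; lra|lra].
Qed.

Lemma contat_inv f t : f t <> RtoC 0 -> contat f t -> contat (fun u => / f u)%C t.
Proof.
  intros Hnz Hf eps He.
  assert (Ha := proj1 (Cmod_gt_0 _) Hnz). set (a := Cmod (f t)) in *.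
  destruct (Hf (Rmin (a / 2) (eps * (a * a / 2)))) as [d [Hd H1]].
  { apply Rmin_pos; [lra|]. apply Rmult_lt_0_compat; auto. apply Rdiv_lt_0_compat; nra. }
  exists d; split; auto; intros u Hu; specialize (H1 u Hu).
  apply Rlt_Rmin in H1 as [H3 H4].
  assert (Hb : a / 2 <= Cmod (f u)).
  { generalize (Cmod_sub_ge (f t) (f u)); rewrite Cmod_minus_sym; fold a; lra. }
  assert (Hunz : f u <> RtoC 0) by (apply Cmod_gt_0; lra).
  replace (/ f u - / f t)%C with (- (f u - f t) / (f u * f t))%C by (field; auto).
  rewrite Cmod_div by (now apply Cmult_neq_0). rewrite Cmod_opp, Cmod_mult. fold a.
  assert (Hp : a / 2 * a <= Cmod (f u) * a) by (apply Rmult_le_compat_r; lra).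
  apply Rmult_lt_reg_r with (Cmod (f u) * a); [nra|].
  unfold Rdiv at 1; rewrite Rmult_assoc, Rinv_l, Rmult_1_r by nra.
  eapply Rlt_le_trans; [apply H4|]. apply Rmult_le_compat_l; lra.
Qed.
End Continuity.

Definition ccont : (C -> C) -> C -> Prop := contat (fun w z => Cmod (w - z)%C).
Definition rcont : (R -> C) -> R -> Prop := contat (fun u t => Rabs (u - t)).

Lemma ccont_const k z : ccont (fun _ => k) z.
Proof. apply contat_const. Qed.
Lemma ccont_plus f g z : ccont f z -> ccont g z -> ccont (fun u => f u + g u)%C z.
Proof. apply contat_plus. Qed.
Lemma ccont_minus f g z : ccont f z -> ccont g z -> ccont (fun u => f u - g u)%C z.
Proof. apply contat_minus. Qed.
Lemma ccont_mult f g z : ccont f z -> ccont g z -> ccont (fun u => f u * g u)%C z.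
Proof. apply contat_mult. Qed.
Lemma ccont_inv f z : f z <> RtoC 0 -> ccont f z -> ccont (fun u => / f u)%C z.
Proof. apply contat_inv. Qed.
Lemma rcont_const k t : rcont (fun _ => k) t.
Proof. apply contat_const. Qed.
Lemma rcont_minus f g t : rcont f t -> rcont g t -> rcont (fun u => f u - g u)%C t.
Proof. apply contat_minus. Qed.
Lemma rcont_mult f g t : rcont f t -> rcont g t -> rcont (fun u => f u * g u)%C t.
Proof. apply contat_mult. Qed.
Lemma rcont_inv f t : f t <> RtoC 0 -> rcont f t -> rcont (fun u => / f u)%C t.
Proof. apply contat_inv. Qed.

Lemma cder_ccont f z l : cder f z l -> ccont f z.
Proof. intros H eps He; exact (der_cont (fun z => z) f z l H eps He). Qed.

Lemma Cmod_re_im (z : C) : Cmod z <= Rabs (Re z) + Rabs (Im z).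
Proof.
  rewrite (C_eta_re_im z) at 1.
  replace ((Re z, Im z) : C) with (RtoC (Re z) + Ci * RtoC (Im z))%C.
  - apply Cmod_le_plus; [|rewrite Cmod_mult, Cmod_Ci, Rmult_1_l]; rewrite Cmod_R; lra.
  - apply injective_projections; simpl; ring.
Qed.

Lemma im_le_Cmod (z : C) : Rabs (Im z) <= Cmod z.
Proof. eapply Rle_trans; [apply Rmax_r|apply Rmax_Cmod]. Qed.

Lemma Cmod_mono (a b a' b' : R) : Rabs a <= Rabs a' -> Rabs b <= Rabs b' -> Cmod (a, b) <= Cmod (a', b').
Proof.
  intros H1 H2; unfold Cmod; simpl fst; simpl snd. apply sqrt_le_1_alt.
  rewrite <- (pow2_abs a), <- (pow2_abs b), <- (pow2_abs a'), <- (pow2_abs b').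
  apply Rplus_le_compat; apply pow_incr; split; auto; apply Rabs_pos.
Qed.

(** The mean value theorem fails for complex values, so it is applied to the real and imaginary
    parts of [f - k * id]; adding the two estimates gives the factor 2. *)
Lemma rder_mvt (f f' : R -> C) (x y : R) (k : C) (M : R) :
  (forall t, Rabs (t - x) <= Rabs (y - x) -> rder f t (f' t) /\ Cmod (f' t - k)%C <= M) ->
  Cmod (f y - f x - k * (RtoC y - RtoC x))%C <= 2 * M * Rabs (y - x).
Proof.
  intros H. set (g := fun t => (f t - k * RtoC t)%C).
  assert (Hg : forall t, Rabs (t - x) <= Rabs (y - x) -> rder g t (f' t - k)%C).
  { intros t Ht; destruct (H t Ht) as [H1 _]. eapply der_eq; [|apply der_minus; [exact H1|]].
    2:{ apply der_scal, der_id. } ring. }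
  replace (f y - f x - k * (RtoC y - RtoC x))%C with (g y - g x)%C by (unfold g; ring).
  eapply Rle_trans; [apply Cmod_re_im|].
  replace (2 * M * Rabs (y - x)) with (M * Rabs (y - x) + M * Rabs (y - x)) by ring.
  apply Rplus_le_compat.
  - replace (Re (g y - g x)%C) with (Re (g y) - Re (g x)) by reflexivity.
    apply (bounded_variation (fun t => Re (g t)) (fun t => Re (f' t - k)%C)).
    intros t Ht; split; [exact (proj1 (proj1 (rder_parts _ _ _) (Hg t Ht)))|].
    eapply Rle_trans; [apply re_le_Cmod|apply (H t Ht)].
  - replace (Im (g y - g x)%C) with (Im (g y) - Im (g x)) by reflexivity.
    apply (bounded_variation (fun t => Im (g t)) (fun t => Im (f' t - k)%C)).
    intros t Ht; split; [exact (proj2 (proj1 (rder_parts _ _ _) (Hg t Ht)))|].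
    eapply Rle_trans; [apply im_le_Cmod|apply (H t Ht)].
Qed.

Definition partials (f : C -> C) (z A B : C) : Prop :=
  rder (fun s => f (s, Im z)) (Re z) A /\ rder (fun t => f (Re z, t)) (Im z) B.

Definition frechet (f : C -> C) (z A B : C) : Prop :=
  forall eps, 0 < eps -> exists d, 0 < d /\ forall w, Cmod (w - z)%C < d ->
    Cmod (f w - f z - A * RtoC (Re (w - z)%C) - B * RtoC (Im (w - z)%C))%C <= eps * Cmod (w - z)%C.

(** The increment is split at the corner (x, t), and [rder_mvt] treats the vertical and the
    horizontal leg. Each leg costs 2 * (eps/4), which is why the partial derivatives are controlled
    up to [eps / 4]. *)
Lemma C1_frechet (f fs ft : C -> C) z d : 0 < d ->
  (forall w, Cmod (w - z)%C < d -> partials f w (fs w) (ft w)) ->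
  ccont fs z -> ccont ft z -> frechet f z (fs z) (ft z).
Proof.
  intros Hd Hp Hs Ht eps He.
  destruct (Hs (eps / 4)) as [d1 [Hd1 H1]]; [lra|].
  destruct (Ht (eps / 4)) as [d2 [Hd2 H2]]; [lra|].
  exists (Rmin d (Rmin d1 d2)); split; [repeat apply Rmin_pos; auto|].
  intros w Hw.
  apply Rlt_Rmin in Hw as [Hw0 [Hw1 Hw2]%Rlt_Rmin].
  destruct z as [x y], w as [s t].
  change (Re ((s, t) - (x, y))%C) with (s - x). change (Im ((s, t) - (x, y))%C) with (t - y).
  assert (Hm : forall s' t', Rabs (s' - x) <= Rabs (s - x) -> Rabs (t' - y) <= Rabs (t - y) ->
     Cmod ((s', t') - (x, y))%C <= Cmod ((s, t) - (x, y))%C).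
  { intros s' t' Hs' Ht'. apply (Cmod_mono (s' - x) (t' - y) (s - x) (t - y)); auto. }
  rewrite !RtoC_minus.
  replace (f (s, t) - f (x, y) - fs (x, y) * (RtoC s - RtoC x) - ft (x, y) * (RtoC t - RtoC y))%C with
   ((f (s, t) - f (x, t) - fs (x, y) * (RtoC s - RtoC x)) +
    (f (x, t) - f (x, y) - ft (x, y) * (RtoC t - RtoC y)))%C by ring.
  assert (Hx : Rabs (x - x) <= Rabs (s - x)).
  { rewrite Rminus_diag, Rabs_R0; apply Rabs_pos. }
  apply Rle_trans with (2 * (eps / 4) * Rabs (s - x) + 2 * (eps / 4) * Rabs (t - y)).
  - apply Cmod_le_plus.
    + apply (rder_mvt (fun s' => f (s', t)) (fun s' => fs (s', t))). intros s' Hs'.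
      assert (Hc := Hm s' t Hs' (Rle_refl _)). split.
      * apply (Hp (s', t)). lra.
      * left; apply H1; lra.
    + apply (rder_mvt (fun t' => f (x, t')) (fun t' => ft (x, t'))). intros t' Ht'.
      assert (Hc := Hm x t' Hx Ht'). split.
      * apply (Hp (x, t')). lra.
      * left; apply H2; lra.
  - assert (Rabs (s - x) <= Cmod ((s, t) - (x, y))%C) by apply (re_le_Cmod ((s, t) - (x, y))%C).
    assert (Rabs (t - y) <= Cmod ((s, t) - (x, y))%C) by apply (im_le_Cmod ((s, t) - (x, y))%C).
    nra.
Qed.

Lemma frechet_ccont f z A B : frechet f z A B -> ccont f z.
Proof.
  intros H eps He.
  destruct (H 1 Rlt_0_1) as [d [Hd Hw]].
  set (K := Cmod A + Cmod B + 1).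
  assert (PK : 0 < K) by (generalize (Cmod_ge_0 A) (Cmod_ge_0 B); unfold K; lra).
  exists (Rmin d (eps / K)); split; [apply Rmin_pos; auto; now apply Rdiv_lt_0_compat|].
  intros w Hwd.
  apply Rlt_Rmin in Hwd as [Hw1 Hw2].
  specialize (Hw w Hw1).
  assert (Hle : Cmod (f w - f z)%C <= K * Cmod (w - z)%C).
  { replace (f w - f z)%C with (A * RtoC (Re (w - z)%C) + B * RtoC (Im (w - z)%C) +
      (f w - f z - A * RtoC (Re (w - z)%C) - B * RtoC (Im (w - z)%C)))%C by ring.
    unfold K; rewrite !Rmult_plus_distr_r.
    repeat apply Cmod_le_plus; auto; rewrite Cmod_mult, Cmod_R; apply Rmult_le_compat_l;
      try apply Cmod_ge_0; [apply re_le_Cmod|apply im_le_Cmod]. }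
  apply Rmult_lt_compat_l with (r := K) in Hw2; auto.
  replace (K * (eps / K)) with eps in Hw2 by (field; lra). lra.
Qed.

Lemma frechet_cder f z l : frechet f z l (Ci * l)%C -> cder f z l.
Proof.
  intros H eps He; destruct (H eps He) as [d [Hd Hw]]; exists d; split; auto.
  intros w Hwd; cbv beta in *; specialize (Hw w Hwd).
  replace (f w - f z - l * (w - z))%C with
    (f w - f z - l * RtoC (Re (w - z)%C) - Ci * l * RtoC (Im (w - z)%C))%C; auto.
  replace (w - z)%C with (RtoC (Re (w - z)%C) + Ci * RtoC (Im (w - z)%C))%C at 3; [ring|].
  rewrite (C_eta_re_im (w - z)) at 3. apply injective_projections; simpl; ring.
Qed.

Lemma cder_frechet f z l : cder f z l -> frechet f z l (Ci * l)%C.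
Proof.
  intros H eps He; destruct (H eps He) as [d [Hd Hw]]; exists d; split; auto.
  intros w Hwd; cbv beta in *; specialize (Hw w Hwd).
  replace (f w - f z - l * RtoC (Re (w - z)%C) - Ci * l * RtoC (Im (w - z)%C))%C with
    (f w - f z - l * (w - z))%C; auto.
  replace (w - z)%C with (RtoC (Re (w - z)%C) + Ci * RtoC (Im (w - z)%C))%C at 1; [ring|].
  rewrite (C_eta_re_im (w - z)) at 3. apply injective_projections; simpl; ring.
Qed.

(** The partial derivatives [q] and [Ci * q] are the Cauchy-Riemann equations; continuity of [q] at
    [z] makes the differential exist there. *)
Lemma C1_cder (f q : C -> C) z d : 0 < d ->
  (forall w, Cmod (w - z)%C < d -> partials f w (q w) (Ci * q w)%C) ->
  ccont q z -> cder f z (q z).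
Proof.
  intros Hd Hp Hq; apply frechet_cder.
  apply (C1_frechet f q (fun w => Ci * q w)%C z d); auto.
  intros eps He; destruct (Hq eps He) as [e [H1 H2]]; exists e; split; auto.
  intros w Hw. replace (Ci * q w - Ci * q z)%C with (Ci * (q w - q z))%C by ring.
  rewrite Cmod_mult, Cmod_Ci, Rmult_1_l. auto.
Qed.

(** * Goursat's theorem and potentials *)

Lemma rcont_continuous f t : rcont f t -> continuous (U := C_R_NormedModule) f t.
Proof.
  intros H P [e He].
  destruct (H e (cond_pos e)) as [d [Hd Hu]]. exists (mkposreal d Hd); intros u Huu.
  apply He, C_NormedModule_mixin_compat1. now apply Hu.
Qed.

Lemma rder_rcont f t l : rder f t l -> rcont f t.
Proof.
  intros H eps He; destruct (der_cont RtoC f t l H eps He) as [d [Hd Hy]].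
  exists d; split; auto; intros u Hu; apply Hy; now rewrite Cmod_RtoC_minus.
Qed.

Definition CInt (f : R -> C) (a b : R) : C := RInt (V := C_R_CompleteNormedModule) f a b.

Definition rcont_on (f : R -> C) (a b : R) : Prop := forall t, Rmin a b <= t <= Rmax a b -> rcont f t.

Lemma ex_CInt f a b : rcont_on f a b -> ex_RInt (V := C_R_CompleteNormedModule) f a b.
Proof.
  intros H; apply (ex_RInt_continuous (V := C_R_CompleteNormedModule)).
  intros z Hz; now apply rcont_continuous, H.
Qed.

Lemma is_CInt f a b : rcont_on f a b -> is_RInt (V := C_R_NormedModule) f a b (CInt f a b).
Proof. intros H; exact (RInt_correct (V := C_R_CompleteNormedModule) f a b (ex_CInt f a b H)). Qed.

Lemma CInt_Chasles f a b c : rcont_on f a b -> rcont_on f b c ->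
  (CInt f a b + CInt f b c)%C = CInt f a c.
Proof.
  intros H1 H2. exact (RInt_Chasles (V := C_R_CompleteNormedModule) f a b c (ex_CInt _ _ _ H1) (ex_CInt _ _ _ H2)).
Qed.

Lemma CInt_minus f g a b : rcont_on f a b -> rcont_on g a b ->
  CInt (fun t => f t - g t)%C a b = (CInt f a b - CInt g a b)%C.
Proof.
  intros H1 H2.
  exact (RInt_minus (V := C_R_CompleteNormedModule) f g a b (ex_CInt _ _ _ H1) (ex_CInt _ _ _ H2)).
Qed.

Lemma CInt_ext f g a b : (forall t, Rmin a b < t < Rmax a b -> f t = g t) -> CInt f a b = CInt g a b.
Proof. intros H; apply (RInt_ext (V := C_R_CompleteNormedModule)); exact H. Qed.

Lemma CInt_point f a : CInt f a a = RtoC 0.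
Proof. exact (RInt_point (V := C_R_CompleteNormedModule) a f). Qed.

Lemma CInt_const k a b : CInt (fun _ => k) a b = (RtoC (b - a) * k)%C.
Proof. etransitivity; [apply (RInt_const (V := C_R_CompleteNormedModule))|]. apply scal_R_Cmult. Qed.

Lemma CInt_opp_swap f a b : rcont_on f a b -> CInt f b a = (- CInt f a b)%C.
Proof.
  intros H. assert (H' : rcont_on f b a) by (intros t; rewrite Rmin_comm, Rmax_comm; apply H).
  assert (E := CInt_Chasles f a b a H H'). rewrite CInt_point in E.
  replace (CInt f b a) with (CInt f a b + CInt f b a - CInt f a b)%C by ring. rewrite E; ring.
Qed.

Lemma C_R_norm (z : C) : norm (V := C_R_NormedModule) z = Cmod z.
Proof.
  unfold norm; simpl. unfold Cmod, prod_norm, norm; simpl. unfold abs; simpl. f_equal. f_equal;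
    rewrite !Rmult_1_r; symmetry; apply Rsqr_abs.
Qed.

Lemma CInt_bound f a b M : rcont_on f a b -> (forall t, Rmin a b <= t <= Rmax a b -> Cmod (f t) <= M) ->
  Cmod (CInt f a b) <= Rabs (b - a) * M.
Proof.
  assert (Hle : forall a b, a <= b -> rcont_on f a b ->
     (forall t, Rmin a b <= t <= Rmax a b -> Cmod (f t) <= M) -> Cmod (CInt f a b) <= Rabs (b - a) * M).
  { clear a b; intros a b Hab Hc HM. rewrite Rabs_right by lra.
    rewrite Rmin_left, Rmax_right in HM by lra. rewrite <- C_R_norm.
    apply (norm_RInt_le_const (V := C_R_NormedModule) f a b); auto.
    - intros t Ht; rewrite C_R_norm; auto.
    - now apply is_CInt. }
  intros Hc HM. destruct (Rle_dec a b) as [H|H]; [now apply Hle|].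
  assert (Hc' : rcont_on f b a) by (intros t; rewrite Rmin_comm, Rmax_comm; apply Hc).
  rewrite (CInt_opp_swap f b a), Cmod_opp, Rabs_minus_sym by auto.
  apply Hle; [lra|auto|]. intros t; rewrite Rmin_comm, Rmax_comm; apply HM.
Qed.

Lemma CInt_FTC f f' a b : (forall t, Rmin a b <= t <= Rmax a b -> rder f t (f' t)) ->
  rcont_on f' a b -> CInt f' a b = (f b - f a)%C.
Proof.
  intros Hd Hc. apply (is_RInt_unique (V := C_R_CompleteNormedModule)).
  apply (is_RInt_derive (V := C_R_CompleteNormedModule) f f' a b).
  - intros t Ht; now apply rder_is_derive, Hd.
  - intros t Ht; now apply rcont_continuous, Hc.
Qed.

Lemma CInt_rder f a b d : 0 < d -> (forall t, Rmin a b - d < t < Rmax a b + d -> rcont f t) ->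
  rder (fun x => CInt f a x) b (f b).
Proof.
  intros Hd Hc. apply rder_is_derive.
  apply (is_derive_RInt (V := C_R_NormedModule) f (fun x => CInt f a x) a b).
  - exists (mkposreal d Hd); intros x Hx. apply is_CInt. intros t Ht; apply Hc.
    change (Rabs (x - b) < d) in Hx. revert Hx Ht; unfold Rabs, Rmin, Rmax.
    destruct (Rcase_abs (x - b)), (Rle_dec a x), (Rle_dec a b); lra.
  - apply rcont_continuous, Hc. unfold Rmin, Rmax; destruct (Rle_dec a b); lra.
Qed.

(** Squares rather than discs: a square that contains two opposite corners of an axis-parallel
    rectangle contains all of it, so paths along the axes stay inside. *)
Definition box (c : C) (r : R) (z : C) : Prop :=
  Rabs (Re z - Re c) < r /\ Rabs (Im z - Im c) < r.

Lemma box_between c r (x0 x1 y0 y1 s t : R) :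
  box c r (x0, y0) -> box c r (x1, y1) -> Rmin x0 x1 <= s <= Rmax x0 x1 ->
  Rmin y0 y1 <= t <= Rmax y0 y1 -> box c r (s, t).
Proof.
  unfold box; simpl; intros [H1 H2] [H3 H4] Hs Ht.
  apply Rabs_def2 in H1, H2, H3, H4. revert Hs Ht; unfold Rmin, Rmax.
  destruct (Rle_dec x0 x1), (Rle_dec y0 y1); intros; split; apply Rabs_def1; lra.
Qed.

Lemma box_Cmod c r z : 0 < r -> Cmod (z - c)%C < r -> box c r z.
Proof.
  intros Hr H; split; (eapply Rle_lt_trans; [|apply H]);
  [apply (re_le_Cmod (z - c)%C)|apply (im_le_Cmod (z - c)%C)].
Qed.

Lemma box_open c r z : box c r z -> exists d, 0 < d /\ forall w, Cmod (w - z)%C < d -> box c r w.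
Proof.
  intros [H1 H2].
  set (d1 := r - Rabs (Re z - Re c)). set (d2 := r - Rabs (Im z - Im c)).
  exists (Rmin d1 d2); split; [apply Rmin_pos; unfold d1, d2; lra|].
  intros w Hw.
  apply Rlt_Rmin in Hw as [Hw1 Hw2].
  assert (Rabs (Re w - Re z) <= Cmod (w - z)) by apply (re_le_Cmod (w - z)%C).
  assert (Rabs (Im w - Im z) <= Cmod (w - z)) by apply (im_le_Cmod (w - z)%C).
  unfold d1, d2 in *. split.
  - replace (Re w - Re c) with ((Re w - Re z) + (Re z - Re c)) by ring.
    eapply Rle_lt_trans; [apply Rabs_triang|]; lra.
  - replace (Im w - Im c) with ((Im w - Im z) + (Im z - Im c)) by ring.
    eapply Rle_lt_trans; [apply Rabs_triang|]; lra.
Qed.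

Lemma ccont_horiz f s y : ccont f (s, y) -> rcont (fun s => f (s, y)) s.
Proof.
  intros H eps He; destruct (H eps He) as [d [Hd Hw]]; exists d; split; auto.
  intros u Hu; apply Hw; now rewrite Cmod_horiz.
Qed.
Lemma ccont_vert f x t : ccont f (x, t) -> rcont (fun t => f (x, t)) t.
Proof.
  intros H eps He; destruct (H eps He) as [d [Hd Hw]]; exists d; split; auto.
  intros u Hu; apply Hw; now rewrite Cmod_vert.
Qed.

(* The integral of the 1-form [L ds + M dt] around a rectangle. *)
Definition rect_int (L M : C -> C) (x0 x1 y0 y1 : R) : C :=
  (CInt (fun s => L (s, y0) - L (s, y1)) x0 x1 + CInt (fun t => M (x1, t) - M (x0, t)) y0 y1)%C.

(** Closedness is the shared entry [Lt], the [t]-derivative of [L] and the [s]-derivative of [M].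
    Only differentiability at the point is asked, as in Goursat's theorem. *)
Definition closed_at (L M : C -> C) (z : C) : Prop :=
  exists Ls Lt Mt : C, frechet L z Ls Lt /\ frechet M z Lt Mt.

Section Rect.
Variables (c : C) (r : R) (L M : C -> C).
Hypothesis HL : forall z, box c r z -> ccont L z.
Hypothesis HM : forall z, box c r z -> ccont M z.

Lemma rcont_L x0 x1 y : box c r (x0, y) -> box c r (x1, y) -> rcont_on (fun s => L (s, y)) x0 x1.
Proof.
  intros H0 H1 s Hs; apply ccont_horiz, HL, (box_between c r x0 x1 y y); auto.
  unfold Rmin, Rmax; destruct (Rle_dec y y); lra.
Qed.
Lemma rcont_M x y0 y1 : box c r (x, y0) -> box c r (x, y1) -> rcont_on (fun t => M (x, t)) y0 y1.
Proof.
  intros H0 H1 s Hs; apply ccont_vert, HM, (box_between c r x x y0 y1); auto.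
  unfold Rmin, Rmax; destruct (Rle_dec x x); lra.
Qed.

Lemma rect_int_split_x x0 xm x1 y0 y1 :
  box c r (x0, y0) -> box c r (xm, y0) -> box c r (x1, y1) ->
  rect_int L M x0 x1 y0 y1 = (rect_int L M x0 xm y0 y1 + rect_int L M xm x1 y0 y1)%C.
Proof.
  intros B0 Bm B1. unfold rect_int.
  assert (B : box c r (x0, y1) /\ box c r (xm, y1) /\ box c r (x1, y0)) by (unfold box in *; simpl in *; tauto).
  destruct B as (B2 & B3 & B4).
  rewrite <- (CInt_Chasles _ x0 xm x1).
  2,3: intros t Ht; apply rcont_minus; (eapply rcont_L; [| |exact Ht]); assumption.
  rewrite !(CInt_minus (fun t => M (_, t)) (fun t => M (_, t))); try (apply rcont_M; assumption).
  ring.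
Qed.

Lemma rect_int_split_y x0 x1 y0 ym y1 :
  box c r (x0, y0) -> box c r (x0, ym) -> box c r (x1, y1) ->
  rect_int L M x0 x1 y0 y1 = (rect_int L M x0 x1 y0 ym + rect_int L M x0 x1 ym y1)%C.
Proof.
  intros B0 Bm B1. unfold rect_int.
  assert (B : box c r (x0, y1) /\ box c r (x1, ym) /\ box c r (x1, y0)) by (unfold box in *; simpl in *; tauto).
  destruct B as (B2 & B3 & B4).
  rewrite <- (CInt_Chasles _ y0 ym y1).
  2,3: intros t Ht; apply rcont_minus; (eapply rcont_M; [| |exact Ht]); assumption.
  rewrite !(CInt_minus (fun t => L (t, _)) (fun t => L (t, _))); try (apply rcont_L; assumption).
  ring.
Qed.

(** The linear Taylor part of a closed form integrates to zero around a rectangle, so only the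
    remainders count: they are small against the side lengths, and the path has length comparable to
    them. *)
Lemma rect_int_small z eps : 0 < eps -> closed_at L M z -> exists d, 0 < d /\
  forall x0 x1 y0 y1, box c r (x0, y0) -> box c r (x1, y1) ->
  x0 <= Re z <= x1 -> y0 <= Im z <= y1 -> x1 - x0 < d -> y1 - y0 < d ->
  Cmod (rect_int L M x0 x1 y0 y1) <= eps * ((x1 - x0) ^ 2 + (y1 - y0) ^ 2).
Proof.
  intros He (Ls & Lt & Mt & FL & FM).
  destruct (FL (eps / 4)) as [d1 [Hd1 H1]]; [lra|].
  destruct (FM (eps / 4)) as [d2 [Hd2 H2]]; [lra|].
  exists (Rmin d1 d2 / 2); split; [apply Rdiv_lt_0_compat; [now apply Rmin_pos|lra]|].
  intros x0 x1 y0 y1 B0 B1 Hx Hy Hdx Hdy.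
  destruct z as [u v]; change (Re (u, v)) with u in *; change (Im (u, v)) with v in *.
  set (p := x1 - x0) in *. set (q := y1 - y0) in *.
  assert (Hcl : forall s t, x0 <= s <= x1 -> y0 <= t <= y1 -> Cmod ((s, t) - (u, v))%C <= p + q).
  { intros s t Hs Ht. eapply Rle_trans; [apply Cmod_re_im|].
    change (Re ((s, t) - (u, v))%C) with (s - u). change (Im ((s, t) - (u, v))%C) with (t - v).
    apply Rplus_le_compat; apply Rabs_le; unfold p, q; lra. }
  assert (Hpq : p + q < Rmin d1 d2) by lra.
  assert (Rmin d1 d2 <= d1) by apply Rmin_l. assert (Rmin d1 d2 <= d2) by apply Rmin_r.
  assert (Hp : 0 <= p) by (unfold p; lra). assert (Hq : 0 <= q) by (unfold q; lra).
  assert (EL : forall s t, x0 <= s <= x1 -> y0 <= t <= y1 ->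
    Cmod (L (s, t) - L (u, v) - Ls * RtoC (s - u) - Lt * RtoC (t - v))%C <= eps / 4 * (p + q)).
  { intros s t Hs Ht. eapply Rle_trans; [apply (H1 (s, t))|].
    - eapply Rle_lt_trans; [now apply Hcl|lra].
    - apply Rmult_le_compat_l; [lra|auto]. }
  assert (EM : forall s t, x0 <= s <= x1 -> y0 <= t <= y1 ->
    Cmod (M (s, t) - M (u, v) - Lt * RtoC (s - u) - Mt * RtoC (t - v))%C <= eps / 4 * (p + q)).
  { intros s t Hs Ht. eapply Rle_trans; [apply (H2 (s, t))|].
    - eapply Rle_lt_trans; [now apply Hcl|lra].
    - apply Rmult_le_compat_l; [lra|auto]. }
  assert (B : box c r (x0, y1) /\ box c r (x1, y0)) by (unfold box in *; simpl in *; tauto).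
  destruct B as [B2 B3].
  unfold rect_int.
  (* The linear parts of the two differences are the constants [- Lt * q] and [Lt * p]; integrated
     over sides of length [p] and [q] they cancel. *)
  replace (CInt (fun s => L (s, y0) - L (s, y1)) x0 x1 + CInt (fun t => M (x1, t) - M (x0, t)) y0 y1)%C with
   (CInt (fun s => (L (s, y0) - L (s, y1)) - (- Lt * RtoC q)) x0 x1
     + CInt (fun t => (M (x1, t) - M (x0, t)) - Lt * RtoC p) y0 y1)%C.
  2:{ rewrite (CInt_minus (fun s => L (s, y0) - L (s, y1))%C (fun _ => (- Lt * RtoC q)%C)).
      2: intros t Ht; apply rcont_minus; (eapply rcont_L; [| |exact Ht]); assumption.
      2: intros t Ht; apply rcont_const.
      rewrite (CInt_minus (fun t => M (x1, t) - M (x0, t))%C (fun _ => (Lt * RtoC p)%C)).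
      2: intros t Ht; apply rcont_minus; (eapply rcont_M; [| |exact Ht]); assumption.
      2: intros t Ht; apply rcont_const.
      rewrite !CInt_const. fold p q. ring. }
  apply Rle_trans with (p * (eps / 2 * (p + q)) + q * (eps / 2 * (p + q))).
  - assert (Ep : p = Rabs (x1 - x0)) by (rewrite Rabs_right; [reflexivity|unfold p in Hp; lra]).
    assert (Eq : q = Rabs (y1 - y0)) by (rewrite Rabs_right; [reflexivity|unfold q in Hq; lra]).
    apply Cmod_le_plus; [rewrite Ep at 1|rewrite Eq at 1]; apply CInt_bound.
    + intros t Ht; apply rcont_minus; [|apply rcont_const].
      apply rcont_minus; (eapply rcont_L; [| |exact Ht]); assumption.
    + intros s Hs. rewrite Rmin_left, Rmax_right in Hs by lra.
      replace (L (s, y0) - L (s, y1) - - Lt * RtoC q)%C with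
       ((L (s, y0) - L (u, v) - Ls * RtoC (s - u) - Lt * RtoC (y0 - v)) +
        - (L (s, y1) - L (u, v) - Ls * RtoC (s - u) - Lt * RtoC (y1 - v)))%C.
      2:{ unfold q; rewrite !RtoC_minus; ring. }
      replace (eps / 2 * (p + q)) with (eps / 4 * (p + q) + eps / 4 * (p + q)) by field.
      apply Cmod_le_plus; [|rewrite Cmod_opp]; apply EL; lra.
    + intros t Ht; apply rcont_minus; [|apply rcont_const].
      apply rcont_minus; (eapply rcont_M; [| |exact Ht]); assumption.
    + intros s Hs. rewrite Rmin_left, Rmax_right in Hs by lra.
      replace (M (x1, s) - M (x0, s) - Lt * RtoC p)%C with
       ((M (x1, s) - M (u, v) - Lt * RtoC (x1 - u) - Mt * RtoC (s - v)) +
        - (M (x0, s) - M (u, v) - Lt * RtoC (x0 - u) - Mt * RtoC (s - v)))%C.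
      2:{ unfold p; rewrite !RtoC_minus; ring. }
      replace (eps / 2 * (p + q)) with (eps / 4 * (p + q) + eps / 4 * (p + q)) by field.
      apply Cmod_le_plus; [|rewrite Cmod_opp]; apply EM; lra.
  (* The estimate so far is eps/2 * (p + q)^2, and (p + q)^2 = 2 (p^2 + q^2) - (p - q)^2. *)
  - assert (0 <= eps * (p - q) ^ 2) by (apply Rmult_le_pos; [lra|apply pow2_ge_0]). nra.
Qed.

(** Left ends increase and right ends decrease, so every left end is below every right end; the
    supremum of the left ends lies in all the intervals. *)
Lemma nested_limit (x : nat -> R) (p : R) : 0 <= p ->
  (forall n, x n <= x (S n)) -> (forall n, x (S n) + p / 2 ^ S n <= x n + p / 2 ^ n) ->
  exists u, forall n, x n <= u <= x n + p / 2 ^ n.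
Proof.
  intros Hp Hinc Hdec.
  assert (Hpos : forall n, 0 <= p / 2 ^ n).
  { intros n; apply Rmult_le_pos; auto. left; apply Rinv_0_lt_compat, pow_lt; lra. }
  assert (Hi : forall k n, x n <= x (n + k)%nat).
  { induction k; intros n; [rewrite Nat.add_0_r; lra|].
    rewrite Nat.add_succ_r; eapply Rle_trans; [apply IHk|apply Hinc]. }
  assert (Hd : forall k n, x (n + k)%nat + p / 2 ^ (n + k) <= x n + p / 2 ^ n).
  { induction k; intros n; [rewrite Nat.add_0_r; lra|].
    rewrite Nat.add_succ_r; eapply Rle_trans; [apply Hdec|apply IHk]. }
  assert (Hub : forall n m, x m <= x n + p / 2 ^ n).
  { intros n m. eapply Rle_trans; [|apply (Hd m n)].
    rewrite Nat.add_comm. specialize (Hi n m); specialize (Hpos (m + n)%nat); lra. }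
  destruct (completeness (fun y => exists n, y = x n)) as [u [Hu1 Hu2]].
  - exists (x 0%nat + p / 2 ^ 0). intros y [n ->]; apply Hub.
  - now exists (x 0%nat), 0%nat.
  - exists u; intros n; split; [apply Hu1; now exists n|].
    apply Hu2; intros y [m ->]; apply Hub.
Qed.

(** Repeated bisection: a rectangle violating the bound has a quarter that violates it, and the
    limit point of these quarters contradicts [rect_int_small]. *)
Lemma goursat x0 x1 y0 y1 : x0 <= x1 -> y0 <= y1 -> box c r (x0, y0) -> box c r (x1, y1) ->
  (forall s t, x0 <= s <= x1 -> y0 <= t <= y1 -> closed_at L M (s, t)) ->
  rect_int L M x0 x1 y0 y1 = RtoC 0.
Proof.
  intros Hx Hy B0 B1 Hcl.
  set (p := x1 - x0). set (q := y1 - y0).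
  assert (Hp : 0 <= p) by (unfold p; lra). assert (Hq : 0 <= q) by (unfold q; lra).
  apply Cmod_eq_0, Rle_antisym; [|apply Cmod_ge_0].
  apply le_epsilon; intros eps0 Heps0; rewrite Rplus_0_l.
  (* The added 1 covers a rectangle degenerate to a point. *)
  set (eps := eps0 / (p ^ 2 + q ^ 2 + 1)).
  assert (Hpq : 0 < p ^ 2 + q ^ 2 + 1) by nra.
  assert (He : 0 < eps) by now apply Rdiv_lt_0_compat.
  apply Rle_trans with (eps * (p ^ 2 + q ^ 2)).
  2:{ apply Rle_trans with (eps * (p ^ 2 + q ^ 2 + 1)); [nra|]. unfold eps; right; field; lra. }
  apply Rnot_lt_le; intros Hbad.
  set (ok := fun (n : nat) (z : R * R) => x0 <= fst z /\ fst z + p / 2 ^ n <= x1 /\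
                          y0 <= snd z /\ snd z + q / 2 ^ n <= y1).
  (* The bound by squared side lengths drops by exactly 4 under bisection, so four quarters within
     their bounds would put the whole within its own. *)
  set (bad := fun (n : nat) (z : R * R) => ok n z /\
    eps * ((p / 2 ^ n) ^ 2 + (q / 2 ^ n) ^ 2) <
     Cmod (rect_int L M (fst z) (fst z + p / 2 ^ n) (snd z) (snd z + q / 2 ^ n))).
  assert (Hstep : forall n z, bad n z -> exists z', bad (S n) z' /\
     fst z <= fst z' /\ fst z' + p / 2 ^ S n <= fst z + p / 2 ^ n /\
     snd z <= snd z' /\ snd z' + q / 2 ^ S n <= snd z + q / 2 ^ n).
  { intros n [x y] [(O1 & O2 & O3 & O4) Hb]; simpl fst in *; simpl snd in *.
    set (p' := p / 2 ^ S n). set (q' := q / 2 ^ S n).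
    assert (H2n : 0 < 2 ^ n) by (apply pow_lt; lra).
    assert (Ep : p / 2 ^ n = p' + p') by (unfold p'; simpl; field; lra).
    assert (Eq : q / 2 ^ n = q' + q') by (unfold q'; simpl; field; lra).
    rewrite Ep, Eq in *.
    assert (Hp' : 0 <= p') by (unfold p'; apply Rmult_le_pos; [auto|left; apply Rinv_0_lt_compat, pow_lt; lra]).
    assert (Hq' : 0 <= q') by (unfold q'; apply Rmult_le_pos; [auto|left; apply Rinv_0_lt_compat, pow_lt; lra]).
    assert (HB : forall s t, x0 <= s <= x1 -> y0 <= t <= y1 -> box c r (s, t)).
    { intros s t Hs Ht; apply (box_between c r x0 x1 y0 y1); auto; rewrite Rmin_left, Rmax_right; lra. }
    rewrite (rect_int_split_x x (x + p') (x + (p' + p')) y (y + (q' + q'))) in Hb by (apply HB; lra).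
    rewrite (rect_int_split_y x (x + p') y (y + q') (y + (q' + q'))) in Hb by (apply HB; lra).
    rewrite (rect_int_split_y (x + p') (x + (p' + p')) y (y + q') (y + (q' + q'))) in Hb by (apply HB; lra).
    replace (x + (p' + p')) with (x + p' + p') in * by ring.
    replace (y + (q' + q')) with (y + q' + q') in * by ring.
    set (bnd := eps * (p' ^ 2 + q' ^ 2)).
    assert (D : bnd < Cmod (rect_int L M x (x + p') y (y + q')) \/
                bnd < Cmod (rect_int L M x (x + p') (y + q') (y + q' + q')) \/
                bnd < Cmod (rect_int L M (x + p') (x + p' + p') y (y + q')) \/
                bnd < Cmod (rect_int L M (x + p') (x + p' + p') (y + q') (y + q' + q'))).
    { apply Classical_Prop.NNPP; intros Hno.
      assert (N1 : Cmod (rect_int L M x (x + p') y (y + q')) <= bnd) by (apply Rnot_lt_le; tauto).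
      assert (N2 : Cmod (rect_int L M x (x + p') (y + q') (y + q' + q')) <= bnd) by (apply Rnot_lt_le; tauto).
      assert (N3 : Cmod (rect_int L M (x + p') (x + p' + p') y (y + q')) <= bnd) by (apply Rnot_lt_le; tauto).
      assert (N4 : Cmod (rect_int L M (x + p') (x + p' + p') (y + q') (y + q' + q')) <= bnd) by (apply Rnot_lt_le; tauto).
      assert (N := Cmod_le_plus _ _ _ _ (Cmod_le_plus _ _ _ _ N1 N2) (Cmod_le_plus _ _ _ _ N3 N4)).
      replace (eps * ((p' + p') ^ 2 + (q' + q') ^ 2)) with (bnd + bnd + (bnd + bnd)) in Hb by (unfold bnd; ring).
      lra. }
    unfold bad, ok. fold p' q'. fold bnd.
    destruct D as [D|[D|[D|D]]];
    [exists (x, y)|exists (x, y + q')|exists (x + p', y)|exists (x + p', y + q')]; simpl fst; simpl snd;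
    repeat split; try lra; auto. }
  (* The stage number travels with the corner, because the property by which the next corner is
     chosen depends on the stage. *)
  set (F := fun (nz : nat * (R * R)) => (S (fst nz), epsilon (inhabits (0, 0)) (fun z' => bad (S (fst nz)) z' /\
     fst (snd nz) <= fst z' /\ fst z' + p / 2 ^ S (fst nz) <= fst (snd nz) + p / 2 ^ fst nz /\
     snd (snd nz) <= snd z' /\ snd z' + q / 2 ^ S (fst nz) <= snd (snd nz) + q / 2 ^ fst nz))).
  set (sq := fun n => Nat.iter n F (0%nat, (x0, y0))).
  assert (Hfst : forall n, fst (sq n) = n).
  { induction n; simpl; auto. }
  assert (Hsq : forall n, bad n (snd (sq n)) /\ 
     fst (snd (sq n)) <= fst (snd (sq (S n))) /\ 
     fst (snd (sq (S n))) + p / 2 ^ S n <= fst (snd (sq n)) + p / 2 ^ n /\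
     snd (snd (sq n)) <= snd (snd (sq (S n))) /\ 
     snd (snd (sq (S n))) + q / 2 ^ S n <= snd (snd (sq n)) + q / 2 ^ n).
  { assert (Hb : forall n, bad n (snd (sq n)) -> bad (S n) (snd (sq (S n))) /\
     fst (snd (sq n)) <= fst (snd (sq (S n))) /\ 
     fst (snd (sq (S n))) + p / 2 ^ S n <= fst (snd (sq n)) + p / 2 ^ n /\
     snd (snd (sq n)) <= snd (snd (sq (S n))) /\ 
     snd (snd (sq (S n))) + q / 2 ^ S n <= snd (snd (sq n)) + q / 2 ^ n).
    { intros n Hn. change (snd (sq (S n))) with (snd (F (sq n))). unfold F.
      cbv beta iota delta [snd]. fold (snd (sq n)). rewrite Hfst.
      apply epsilon_spec. now apply Hstep. }
    assert (Hall : forall n, bad n (snd (sq n))).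
    { induction n; [|now apply Hb]. simpl. unfold bad, ok; simpl.
      replace (p / 1) with p by field. replace (q / 1) with q by field.
      replace (x0 + p) with x1 by (unfold p; ring). replace (y0 + q) with y1 by (unfold q; ring).
      repeat split; try lra. }
    intros n; split; [apply Hall|now apply Hb]. }
  destruct (nested_limit (fun n => fst (snd (sq n))) p Hp) as [u Hu];
    [intros n; apply (Hsq n)|intros n; apply (Hsq n)|].
  destruct (nested_limit (fun n => snd (snd (sq n))) q Hq) as [v Hv];
    [intros n; apply (Hsq n)|intros n; apply (Hsq n)|].
  assert (Hu0 : x0 <= u <= x1).
  { specialize (Hu 0%nat); simpl in Hu. replace (p / 1) with p in Hu by field. unfold p in Hu; lra. }
  assert (Hv0 : y0 <= v <= y1).
  { specialize (Hv 0%nat); simpl in Hv. replace (q / 1) with q in Hv by field. unfold q in Hv; lra. }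
  destruct (rect_int_small (u, v) eps He (Hcl u v Hu0 Hv0)) as [d [Hd Hsm]].
  assert (Hn : exists n, (p + q + 1) / 2 ^ n < d).
  { destruct (pow_lt_1_zero (/ 2)) with (y := d / (p + q + 1)) as [n Hn].
    - rewrite Rabs_right; lra.
    - apply Rdiv_lt_0_compat; lra.
    - exists n. specialize (Hn n (Nat.le_refl n)).
      rewrite Rabs_right in Hn by (left; apply pow_lt; lra).
      rewrite pow_inv in Hn.
      apply Rmult_lt_compat_l with (r := p + q + 1) in Hn; [|lra].
      replace ((p + q + 1) * (d / (p + q + 1))) with d in Hn by (field; lra). exact Hn. }
  destruct Hn as [n Hn].
  destruct (Hsq n) as [[(O1 & O2 & O3 & O4) Hb] _].
  specialize (Hu n); specialize (Hv n); cbv beta in Hu, Hv.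
  set (z := snd (sq n)) in *.
  assert (H2n : 0 < / 2 ^ n) by (apply Rinv_0_lt_compat, pow_lt; lra).
  assert (Hpn : p / 2 ^ n < d) by (unfold Rdiv in *; nra).
  assert (Hqn : q / 2 ^ n < d) by (unfold Rdiv in *; nra).
  assert (HB : forall s t, x0 <= s <= x1 -> y0 <= t <= y1 -> box c r (s, t)).
  { intros s t Hs Ht; apply (box_between c r x0 x1 y0 y1); auto; rewrite Rmin_left, Rmax_right; lra. }
  assert (Habs := Hsm (fst z) (fst z + p / 2 ^ n) (snd z) (snd z + q / 2 ^ n)).
  simpl Re in Habs; simpl Im in Habs.
  replace (fst z + p / 2 ^ n - fst z) with (p / 2 ^ n) in Habs by ring.
  replace (snd z + q / 2 ^ n - snd z) with (q / 2 ^ n) in Habs by ring.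
  specialize (Habs ltac:(apply HB; lra) ltac:(apply HB; lra) ltac:(lra) ltac:(lra) Hpn Hqn).
  lra.
Qed.
End Rect.

Section Exact.
Variables (c : C) (r : R) (L M : C -> C).
Hypothesis HL : forall z, box c r z -> ccont L z.
Hypothesis HM : forall z, box c r z -> ccont M z.

Lemma rect_int_x_same x y0 y1 : rect_int L M x x y0 y1 = RtoC 0.
Proof.
  unfold rect_int. rewrite CInt_point.
  rewrite (CInt_ext _ (fun _ => RtoC 0)) by (intros; ring). rewrite CInt_const. ring.
Qed.

Lemma rect_int_y_same x0 x1 y : rect_int L M x0 x1 y y = RtoC 0.
Proof.
  unfold rect_int. rewrite CInt_point.
  rewrite (CInt_ext _ (fun _ => RtoC 0)) by (intros; ring). rewrite CInt_const. ring.
Qed.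

(** The degenerate rectangle from [x0] to [x0], of integral 0, is split at [x1]. *)
Lemma rect_int_x_swap x0 x1 y0 y1 : box c r (x0, y0) -> box c r (x1, y1) ->
  rect_int L M x1 x0 y0 y1 = (- rect_int L M x0 x1 y0 y1)%C.
Proof.
  intros B0 B1.
  assert (B : box c r (x0, y1) /\ box c r (x1, y0)) by (unfold box in *; simpl in *; tauto).
  assert (E := rect_int_split_x c r L M HL HM x0 x1 x0 y0 y1 B0 (proj2 B) (proj1 B)).
  rewrite rect_int_x_same in E.
  replace (rect_int L M x1 x0 y0 y1) with
   (rect_int L M x0 x1 y0 y1 + rect_int L M x1 x0 y0 y1 - rect_int L M x0 x1 y0 y1)%C by ring.
  rewrite <- E; ring.
Qed.

Lemma rect_int_y_swap x0 x1 y0 y1 : box c r (x0, y0) -> box c r (x1, y1) ->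
  rect_int L M x0 x1 y1 y0 = (- rect_int L M x0 x1 y0 y1)%C.
Proof.
  intros B0 B1.
  assert (B : box c r (x0, y1) /\ box c r (x1, y0)) by (unfold box in *; simpl in *; tauto).
  assert (E := rect_int_split_y c r L M HL HM x0 x1 y0 y1 y0 B0 (proj1 B) (proj2 B)).
  rewrite rect_int_y_same in E.
  replace (rect_int L M x0 x1 y1 y0) with
   (rect_int L M x0 x1 y0 y1 + rect_int L M x0 x1 y1 y0 - rect_int L M x0 x1 y0 y1)%C by ring.
  rewrite <- E; ring.
Qed.

Lemma goursat_any x0 x1 y0 y1 : box c r (x0, y0) -> box c r (x1, y1) ->
  (forall s t, Rmin x0 x1 <= s <= Rmax x0 x1 -> Rmin y0 y1 <= t <= Rmax y0 y1 -> closed_at L M (s, t)) ->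
  rect_int L M x0 x1 y0 y1 = RtoC 0.
Proof.
  intros B0 B1.
  assert (B : box c r (x0, y1) /\ box c r (x1, y0)) by (unfold box in *; simpl in *; tauto).
  destruct B as [B2 B3].
  unfold Rmin, Rmax; destruct (Rle_dec x0 x1), (Rle_dec y0 y1); intros Hc.
  - apply (goursat c r); auto.
  - rewrite (rect_int_y_swap x0 x1 y1 y0), (goursat c r); auto; try lra. ring.
  - rewrite (rect_int_x_swap x1 x0 y0 y1), (goursat c r); auto; try lra. ring.
  - rewrite (rect_int_x_swap x1 x0 y0 y1), (rect_int_y_swap x1 x0 y1 y0), (goursat c r); auto; try lra. ring.
Qed.

(** Closedness may fail at [p] itself. Goursat's theorem removes everything except a rectangle at
    the corner [p] scaled by [lam]; there [L] and [M] are bounded by continuity, so its integral is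
    O(lam). *)
Lemma rect_int_corner p : box c r p -> (forall z, box c r z -> z <> p -> closed_at L M z) ->
  forall x1 y1, box c r (x1, y1) -> rect_int L M (Re p) x1 (Im p) y1 = RtoC 0.
Proof.
  intros Hp Hcl x1 y1 B1. destruct p as [x0 y0]. change (Re (x0, y0)) with x0. change (Im (x0, y0)) with y0.
  destruct (Req_dec x1 x0) as [->|Hx]; [apply rect_int_x_same|].
  destruct (Req_dec y1 y0) as [->|Hy]; [apply rect_int_y_same|].
  (* The two rectangles cut off do not contain [p]: one stays away from [y0], the other from
     [x0]. *)
  assert (Hlam : forall lam, 0 < lam <= 1 ->
    box c r (x0 + lam * (x1 - x0), y0 + lam * (y1 - y0)) /\
    rect_int L M x0 x1 y0 y1 = rect_int L M x0 (x0 + lam * (x1 - x0)) y0 (y0 + lam * (y1 - y0))).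
  { intros lam Hl.
    set (xm := x0 + lam * (x1 - x0)). set (ym := y0 + lam * (y1 - y0)).
    assert (Hxm : Rmin x0 x1 <= xm <= Rmax x0 x1).
    { unfold xm, Rmin, Rmax; destruct (Rle_dec x0 x1); nra. }
    assert (Hym : Rmin y0 y1 <= ym <= Rmax y0 y1).
    { unfold ym, Rmin, Rmax; destruct (Rle_dec y0 y1); nra. }
    assert (Bm : box c r (xm, ym)) by (apply (box_between c r x0 x1 y0 y1); auto).
    split; auto.
    assert (Bs : box c r (xm, y0) /\ box c r (x0, ym) /\ box c r (xm, y1) /\ box c r (x1, ym))
      by (unfold box in *; simpl in *; tauto).
    destruct Bs as (B2 & B3 & B4 & B5).
    rewrite (rect_int_split_x c r L M HL HM x0 xm x1) by assumption.
    rewrite (rect_int_split_y c r L M HL HM x0 xm y0 ym y1) by assumption.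
    assert (Hlx : 0 < Rabs (x1 - x0)) by (apply Rabs_pos_lt; lra).
    assert (Hly : 0 < Rabs (y1 - y0)) by (apply Rabs_pos_lt; lra).
    rewrite (goursat_any x0 xm ym y1), (goursat_any xm x1 y0 y1); auto; [ring| |].
    - intros s t Hs Ht. apply Hcl.
      + apply (box_between c r xm x1 y0 y1); auto.
      + intros E; injection E; intros; subst s t.
        revert Hs; unfold xm, Rmin, Rmax. destruct (Rle_dec (x0 + lam * (x1 - x0)) x1); nra.
    - intros s t Hs Ht. apply Hcl.
      + apply (box_between c r x0 xm ym y1); auto.
      + intros E; injection E; intros; subst s t.
        revert Ht; unfold ym, Rmin, Rmax. destruct (Rle_dec (y0 + lam * (y1 - y0)) y1); nra. }
  destruct (HL (x0, y0) Hp 1 Rlt_0_1) as [d1 [Hd1 H1]].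
  destruct (HM (x0, y0) Hp 1 Rlt_0_1) as [d2 [Hd2 H2]].
  set (K := Cmod (L (x0, y0)) + Cmod (M (x0, y0)) + 1).
  assert (HK : 1 <= K) by (generalize (Cmod_ge_0 (L (x0, y0))) (Cmod_ge_0 (M (x0, y0))); unfold K; lra).
  set (S := Rabs (x1 - x0) + Rabs (y1 - y0)).
  assert (HS : 0 < S) by (generalize (Rabs_pos_lt (x1 - x0)) (Rabs_pos (y1 - y0)); unfold S; lra).
  apply Cmod_eq_0, Rle_antisym; [|apply Cmod_ge_0].
  apply le_epsilon; intros eps He; rewrite Rplus_0_l.
  (* The first pair makes [lam] at most 1 and the integral, at most [lam * 2 * K * S], at most
     [eps]; the second pair keeps the small rectangle where [L] and [M] are within 1 of their values
     at the corner. *)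
  set (lam := Rmin (Rmin 1 (eps / (2 * K * S))) (Rmin (d1 / (2 * S)) (d2 / (2 * S)))).
  assert (HlK : 0 < 2 * K * S) by (apply Rmult_lt_0_compat; lra).
  assert (Hl0 : 0 < lam) by (unfold lam; repeat apply Rmin_pos; try apply Rdiv_lt_0_compat; lra).
  assert (Hl1 : lam <= 1) by (unfold lam; eapply Rle_trans; [apply Rmin_l|apply Rmin_l]).
  assert (Hl2 : lam * (2 * K * S) <= eps).
  { apply Rmult_le_reg_r with (/ (2 * K * S)); [now apply Rinv_0_lt_compat|].
    rewrite Rmult_assoc, Rinv_r, Rmult_1_r by lra.
    unfold lam; eapply Rle_trans; [apply Rmin_l|apply Rmin_r]. }
  assert (Hl3 : lam * S < d1).
  { apply Rle_lt_trans with (d1 / (2 * S) * S); [|replace (d1 / (2 * S) * S) with (d1 / 2) by (field; lra); lra].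
    apply Rmult_le_compat_r; [lra|]. unfold lam; eapply Rle_trans; [apply Rmin_r|apply Rmin_l]. }
  assert (Hl4 : lam * S < d2).
  { apply Rle_lt_trans with (d2 / (2 * S) * S); [|replace (d2 / (2 * S) * S) with (d2 / 2) by (field; lra); lra].
    apply Rmult_le_compat_r; [lra|]. unfold lam; eapply Rle_trans; [apply Rmin_r|apply Rmin_r]. }
  destruct (Hlam lam (conj Hl0 Hl1)) as [Bm ->].
  set (xm := x0 + lam * (x1 - x0)) in *. set (ym := y0 + lam * (y1 - y0)) in *.
  assert (Bs : box c r (xm, y0) /\ box c r (x0, ym)) by (unfold box in *; simpl in *; tauto).
  destruct Bs as (B2 & B3).
  assert (Ex : Rabs (xm - x0) = lam * Rabs (x1 - x0)).
  { unfold xm. replace (x0 + lam * (x1 - x0) - x0) with (lam * (x1 - x0)) by ring.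
    rewrite Rabs_mult, (Rabs_right lam); lra. }
  assert (Ey : Rabs (ym - y0) = lam * Rabs (y1 - y0)).
  { unfold ym. replace (y0 + lam * (y1 - y0) - y0) with (lam * (y1 - y0)) by ring.
    rewrite Rabs_mult, (Rabs_right lam); lra. }
  assert (Hcl2 : forall s t, Rmin x0 xm <= s <= Rmax x0 xm -> Rmin y0 ym <= t <= Rmax y0 ym ->
     Cmod ((s, t) - (x0, y0))%C <= lam * S).
  { intros s t Hs Ht. eapply Rle_trans; [apply Cmod_re_im|].
    change (Re ((s, t) - (x0, y0))%C) with (s - x0). change (Im ((s, t) - (x0, y0))%C) with (t - y0).
    unfold S; rewrite Rmult_plus_distr_l, <- Ex, <- Ey.
    clear - Hs Ht; unfold Rmin, Rmax, Rabs in *.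
    destruct (Rle_dec x0 xm), (Rle_dec y0 ym), (Rcase_abs (s - x0)), (Rcase_abs (t - y0)),
      (Rcase_abs (xm - x0)), (Rcase_abs (ym - y0)); lra. }
  assert (BL : forall s t, Rmin x0 xm <= s <= Rmax x0 xm -> Rmin y0 ym <= t <= Rmax y0 ym -> Cmod (L (s, t)) <= K).
  { intros s t Hs Ht. replace (L (s, t)) with (L (x0, y0) + (L (s, t) - L (x0, y0)))%C by ring.
    apply Rle_trans with (Cmod (L (x0, y0)) + 1); [|generalize (Cmod_ge_0 (M (x0, y0))); unfold K; lra].
    apply Cmod_le_plus; [lra|]. left; apply H1. specialize (Hcl2 s t Hs Ht); lra. }
  assert (BM : forall s t, Rmin x0 xm <= s <= Rmax x0 xm -> Rmin y0 ym <= t <= Rmax y0 ym -> Cmod (M (s, t)) <= K).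
  { intros s t Hs Ht. replace (M (s, t)) with (M (x0, y0) + (M (s, t) - M (x0, y0)))%C by ring.
    apply Rle_trans with (Cmod (M (x0, y0)) + 1); [|generalize (Cmod_ge_0 (L (x0, y0))); unfold K; lra].
    apply Cmod_le_plus; [lra|]. left; apply H2. specialize (Hcl2 s t Hs Ht); lra. }
  eapply Rle_trans; [|apply Hl2].
  replace (lam * (2 * K * S)) with (Rabs (xm - x0) * (K + K) + Rabs (ym - y0) * (K + K))
    by (rewrite Ex, Ey; unfold S; ring).
  assert (my0 : Rmin y0 ym <= y0 <= Rmax y0 ym) by (split; [apply Rmin_l|apply Rmax_l]).
  assert (mym : Rmin y0 ym <= ym <= Rmax y0 ym) by (split; [apply Rmin_r|apply Rmax_r]).
  assert (mx0 : Rmin x0 xm <= x0 <= Rmax x0 xm) by (split; [apply Rmin_l|apply Rmax_l]).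
  assert (mxm : Rmin x0 xm <= xm <= Rmax x0 xm) by (split; [apply Rmin_r|apply Rmax_r]).
  unfold rect_int; apply Cmod_le_plus; apply CInt_bound.
  - intros t Ht; apply rcont_minus; (eapply (rcont_L c r L HL); [| |exact Ht]); assumption.
  - intros t Ht; apply Cmod_le_plus; [|rewrite Cmod_opp]; apply BL; auto.
  - intros t Ht; apply rcont_minus; (eapply (rcont_M c r M HM); [| |exact Ht]); assumption.
  - intros t Ht; apply Cmod_le_plus; [|rewrite Cmod_opp]; apply BM; auto.
Qed.

(** [P] integrates from [p] horizontally and then vertically, which shows its [t]-derivative; by
    [rect_int_corner] the other order gives the same value and shows the [s]-derivative. Taking the
    exceptional point as base point means that only rectangles with corner [p] occur. *)
Lemma exact_of_closed p : box c r p -> (forall z, box c r z -> z <> p -> closed_at L M z) ->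
  exists P : C -> C, forall z, box c r z -> partials P z (L z) (M z).
Proof.
  intros Hp Hcl.
  set (P := fun z => (CInt (fun s => L (s, Im p)) (Re p) (Re z) + CInt (fun t => M (Re z, t)) (Im p) (Im z))%C).
  assert (EP : forall z, box c r z -> P z =
    (CInt (fun s => L (s, Im z)) (Re p) (Re z) + CInt (fun t => M (Re p, t)) (Im p) (Im z))%C).
  { intros [x y] Hz. assert (E := rect_int_corner p Hp Hcl x y Hz).
    destruct p as [px py]. unfold P; change (Re (x, y)) with x in *; change (Im (x, y)) with y in *.
    change (Re (px, py)) with px in *; change (Im (px, py)) with py in *.
    assert (Bs : box c r (px, y) /\ box c r (x, py)) by (unfold box in *; simpl in *; tauto).
    destruct Bs as (B2 & B3). unfold rect_int in E.
    rewrite (CInt_minus (fun s => L (s, _)) (fun s => L (s, _))) in E by (apply (rcont_L c r L HL); assumption).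
    rewrite (CInt_minus (fun s => M (_, s)) (fun s => M (_, s))) in E by (apply (rcont_M c r M HM); assumption).
    apply Ceq_minus. rewrite <- E. ring. }
  exists P. intros [x y] Hz; split; change (Re (x, y)) with x; change (Im (x, y)) with y.
  - destruct (box_open c r _ Hz) as [d [Hd Hw]].
    apply der_ext_loc with (f := fun s => (CInt (fun s' => L (s', y)) (Re p) s + CInt (fun t => M (Re p, t)) (Im p) y)%C) (d := d); auto.
    + intros s Hs. rewrite EP; [reflexivity|]. apply Hw. rewrite Cmod_horiz. now rewrite Cmod_RtoC_minus in Hs.
    + eapply der_eq; [|apply der_plus; [|apply der_const]]; [apply Cplus_0_r|].
      set (e := Rmin (r - Rabs (x - Re c)) (r - Rabs (Re p - Re c))).
      assert (He : 0 < e).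
      { unfold box in *; simpl in *. apply Rmin_pos; lra. }
      apply (CInt_rder (fun s' => L (s', y)) (Re p) x e He).
      intros t Ht; apply ccont_horiz, HL. split; simpl; [|unfold box in Hz; simpl in Hz; tauto].
      assert (e <= r - Rabs (x - Re c)) by apply Rmin_l.
      assert (e <= r - Rabs (Re p - Re c)) by apply Rmin_r.
      revert Ht H H0; clear; unfold Rmin, Rmax, Rabs; intros Ht H H0.
      destruct (Rle_dec (Re p) x), (Rcase_abs (t - Re c)), (Rcase_abs (x - Re c)), (Rcase_abs (Re p - Re c)); lra.
  - unfold P; cbn [Re Im fst snd]. 
    eapply der_eq; [|apply der_plus; [apply der_const|]]; [apply Cplus_0_l|].
    set (e := Rmin (r - Rabs (y - Im c)) (r - Rabs (Im p - Im c))).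
    assert (He : 0 < e).
    { unfold box in *; simpl in *. apply Rmin_pos; lra. }
    apply (CInt_rder (fun t => M (x, t)) (Im p) y e He).
    intros t Ht; apply ccont_vert, HM. split; simpl; [unfold box in Hz; simpl in Hz; tauto|].
    assert (e <= r - Rabs (y - Im c)) by apply Rmin_l.
    assert (e <= r - Rabs (Im p - Im c)) by apply Rmin_r.
    revert Ht H H0; clear; unfold Rmin, Rmax, Rabs; intros Ht H H0.
    destruct (Rle_dec (Im p) y), (Rcase_abs (t - Im c)), (Rcase_abs (y - Im c)), (Rcase_abs (Im p - Im c)); lra.
Qed.
End Exact.

Lemma ccont_Cmult k f z : ccont f z -> ccont (fun w => k * f w)%C z.
Proof. apply ccont_mult, ccont_const. Qed.

Lemma cder_closed_at f z l : cder f z l -> closed_at f (fun w => Ci * f w)%C z.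
Proof.
  intros H. exists l, (Ci * l)%C, (Ci * (Ci * l))%C; split; apply cder_frechet; auto.
  now apply (der_scal (fun z => z)).
Qed.

(** f dz = f ds + i f dt is closed wherever [f] is complex differentiable. The exceptional point is
    there for difference quotients, which are at first only continuous at their centre. *)
Lemma primitive_exists c r p f : box c r p -> (forall z, box c r z -> ccont f z) ->
  (forall z, box c r z -> z <> p -> exists l, cder f z l) ->
  exists P, forall z, box c r z -> cder P z (f z).
Proof.
  intros Hp Hc Hd.
  destruct (exact_of_closed c r f (fun w => Ci * f w)%C Hc (fun z Hz => ccont_Cmult Ci f z (Hc z Hz)) p Hp) as [P HP].
  - intros z Hz Hne; destruct (Hd z Hz Hne) as [l Hl]; now apply cder_closed_at with l.
  - exists P; intros z Hz. destruct (box_open c r z Hz) as [d [Hdd Hw]].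
    apply (C1_cder P f z d); auto.
Qed.

(** * Cauchy's formula *)

Definition holo_at (f : C -> C) (z : C) : Prop :=
  exists d, 0 < d /\ forall w, Cmod (w - z)%C < d -> exists l, cder f w l.

Definition diffquot (f : C -> C) (z l w : C) : C :=
  if excluded_middle_informative (w = z) then l else ((f w - f z) / (w - z))%C.

Lemma Cminus_neq (w z : C) : w <> z -> (w - z)%C <> RtoC 0.
Proof. intros H E; apply H; now apply Ceq_minus. Qed.

Lemma cder_open_neq (f g : C -> C) w z l : w <> z -> (forall u, u <> z -> f u = g u) ->
  cder f w l -> cder g w l.
Proof.
  intros Hne E. apply der_ext_loc with (d := Cmod (w - z)%C).
  - apply Cmod_gt_0, Cminus_neq, Hne.
  - intros y Hy; apply E; intros ->. rewrite Cmod_minus_sym in Hy; lra.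
Qed.

Lemma diffquot_neq f z l w : w <> z -> diffquot f z l w = ((f w - f z) / (w - z))%C.
Proof. intros H; unfold diffquot; destruct (excluded_middle_informative (w = z)); [easy|auto]. Qed.

Lemma diffquot_eq f z l : diffquot f z l z = l.
Proof. unfold diffquot; now destruct (excluded_middle_informative (z = z)). Qed.

Lemma diffquot_cder f z l w m : w <> z -> cder f w m -> exists k, cder (diffquot f z l) w k.
Proof.
  intros Hne Hf. eexists.
  apply (cder_open_neq (fun u => (f u - f z) / (u - z))%C _ w z).
  - exact Hne.
  - intros u Hu; symmetry; now apply diffquot_neq.
  - apply der_div; [now apply Cminus_neq| |].
    + apply der_minus; [exact Hf|apply der_const].
    + apply der_minus; [apply der_id|apply der_const].
Qed.

Lemma diffquot_ccont f z l : cder f z l -> ccont (diffquot f z l) z.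
Proof.
  intros H eps He. destruct (H (eps / 2)) as [d [Hd Hw]]; [lra|]. exists d; split; auto.
  intros w Hwd. rewrite diffquot_eq.
  destruct (excluded_middle_informative (w = z)) as [->|Hne].
  - rewrite diffquot_eq. replace (l - l)%C with (RtoC 0) by ring. now rewrite Cmod_0.
  - rewrite diffquot_neq by auto. specialize (Hw w Hwd).
    assert (Hnz := Cminus_neq w z Hne).
    replace ((f w - f z) / (w - z) - l)%C with ((f w - f z - l * (w - z)) / (w - z))%C by (field; auto).
    rewrite Cmod_div by auto. apply Cmod_gt_0 in Hnz.
    apply Rle_lt_trans with (eps / 2); [|lra].
    apply Rmult_le_reg_r with (Cmod (w - z)%C); auto.
    unfold Rdiv at 1; rewrite Rmult_assoc, Rinv_l, Rmult_1_r; lra.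
Qed.

Lemma diffquot_primitive c r f f' z : box c r z -> (forall w, box c r w -> cder f w (f' w)) ->
  exists P, forall w, box c r w -> cder P w (diffquot f z (f' z) w).
Proof.
  intros Hz Hf. apply (primitive_exists c r z); auto.
  - intros w Hw. destruct (excluded_middle_informative (w = z)) as [->|Hne].
    + now apply diffquot_ccont, Hf.
    + destruct (diffquot_cder f z (f' z) w (f' w) Hne (Hf w Hw)) as [k Hk]. now apply cder_ccont with k.
  - intros w Hw Hne. apply (diffquot_cder f z (f' z) w (f' w)); auto.
Qed.

Definition cis (t : R) : C := (cos t, sin t).

Lemma rder_cis t : rder cis t (Ci * cis t)%C.
Proof.
  apply rder_parts; split; simpl.
  - replace (0 * cos t - 1 * sin t) with (- sin t) by ring. apply is_derive_Reals, derivable_pt_lim_cos.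
  - replace (0 * sin t + 1 * cos t) with (cos t) by ring. apply is_derive_Reals, derivable_pt_lim_sin.
Qed.

Lemma Cmod_cis t : Cmod (cis t) = 1.
Proof.
  unfold Cmod, cis; simpl fst; simpl snd. replace (cos t ^ 2 + sin t ^ 2) with 1; [apply sqrt_1|].
  generalize (sin2_cos2 t); unfold Rsqr; intros; lra.
Qed.

(** The scalar is complex while the integral is that of a real vector space; the equality is
    obtained by differentiating the primitive. *)
Lemma CInt_Cmult k f a b : (forall t, rcont f t) -> CInt (fun t => k * f t)%C a b = (k * CInt f a b)%C.
Proof.
  intros Hc.
  rewrite (CInt_FTC (fun x => k * CInt f a x)%C (fun t => k * f t)%C a b).
  - rewrite CInt_point; ring.
  - intros t _. apply der_scal. apply (CInt_rder f a t 1); [lra|auto].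
  - intros t _. apply rcont_mult; [apply rcont_const|auto].
Qed.

Lemma rcont_bounded f a b : a <= b -> (forall t, a <= t <= b -> rcont f t) ->
  exists B, 0 < B /\ forall t, a <= t <= b -> Cmod (f t) <= B.
Proof.
  intros Hab Hc.
  destruct (continuity_ab_maj (fun t => Cmod (f t)) a b Hab) as [t0 [Ht _]].
  - intros t Ht eps He. destruct (Hc t Ht eps He) as [d [Hd Hu]]. exists d; split; auto.
    intros u [_ Hud]. specialize (Hu u Hud). simpl. unfold Rdist.
    apply Rabs_def1.
    + generalize (Cmod_sub_ge (f u) (f t)); lra.
    + generalize (Cmod_sub_ge (f t) (f u)); rewrite Cmod_minus_sym; lra.
  - exists (Cmod (f t0) + 1); split; [generalize (Cmod_ge_0 (f t0)); lra|].
    intros t Htt; specialize (Ht t Htt); simpl in Ht; lra.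
Qed.

(** Differentiation under the integral sign: the quadratic remainder, uniform in [t], plays the part
    of dominated convergence. *)
Lemma CInt_param_cder (Psi : R -> C -> C) (Psi' : R -> C) a b z d K : a <= b -> 0 < d -> 0 <= K ->
  (forall w t, Cmod (w - z)%C < d -> rcont (fun t => Psi t w) t) ->
  (forall t, rcont Psi' t) ->
  (forall w t, Cmod (w - z)%C < d -> a <= t <= b ->
     Cmod (Psi t w - Psi t z - Psi' t * (w - z))%C <= K * Cmod (w - z)%C ^ 2) ->
  cder (fun w => CInt (fun t => Psi t w) a b) z (CInt Psi' a b).
Proof.
  intros Hab Hd HK Hc Hc' Hb eps He.
  set (E := (b - a) * K + 1).
  assert (PE : 0 < E) by (unfold E; nra).
  exists (Rmin d (eps / E)); split; [apply Rmin_pos; auto; now apply Rdiv_lt_0_compat|].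
  intros w Hw.
  apply Rlt_Rmin in Hw as [Hw1 Hw2].
  assert (Hz : Cmod (z - z)%C < d) by (replace (z - z)%C with (RtoC 0) by ring; now rewrite Cmod_0).
  replace (CInt (fun t => Psi t w) a b - CInt (fun t => Psi t z) a b - CInt Psi' a b * (w - z))%C
   with (CInt (fun t => (Psi t w - Psi t z) - (w - z) * Psi' t)%C a b).
  2:{ rewrite (CInt_minus (fun t => Psi t w - Psi t z)%C (fun t => (w - z) * Psi' t)%C).
      rewrite (CInt_minus (fun t => Psi t w)%C (fun t => Psi t z)%C).
      rewrite CInt_Cmult by auto. ring.
      1,2: intros t _; now apply Hc.
      - intros t _; apply rcont_minus; now apply Hc.
      - intros t _; apply rcont_mult; [apply rcont_const|auto]. }
  eapply Rle_trans; [apply CInt_bound with (M := K * Cmod (w - z)%C ^ 2)|].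
  - intros t _; apply rcont_minus; [apply rcont_minus; now apply Hc|].
    apply rcont_mult; [apply rcont_const|auto].
  - rewrite Rmin_left, Rmax_right by auto. intros t Ht.
    rewrite (Cmult_comm (w - z)). apply Hb; auto.
  - rewrite Rabs_right by lra. set (h := Cmod (w - z)%C) in *.
    assert (Ph : 0 <= h) by apply Cmod_ge_0.
    apply Rmult_lt_compat_l with (r := E) in Hw2; auto.
    replace (E * (eps / E)) with eps in Hw2 by (field; lra).
    unfold E in Hw2. replace ((b - a) * (K * h ^ 2)) with ((b - a) * K * h * h) by ring. nra.
Qed.

(** * Integrals over a circle and the Cauchy transform *)

Section Circle.
Variables (c : C) (rho : R).
Hypothesis Hrho : 0 < rho.

Definition circ (t : R) : C := (c + RtoC rho * cis t)%C.
Definition dcirc (t : R) : C := (Ci * (RtoC rho * cis t))%C.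

Lemma rder_circ t : rder circ t (dcirc t).
Proof.
  eapply der_eq; [|apply der_plus; [apply der_const|apply der_scal, rder_cis]]. unfold dcirc; ring.
Qed.

Lemma rcont_circ t : rcont circ t.
Proof. eapply rder_rcont, rder_circ. Qed.
Lemma rcont_dcirc t : rcont dcirc t.
Proof.
  apply rcont_mult; [apply rcont_const|]. apply rcont_mult; [apply rcont_const|].
  eapply rder_rcont, rder_cis.
Qed.

Lemma Cmod_circ t : Cmod (circ t - c)%C = rho.
Proof.
  unfold circ; replace (c + RtoC rho * cis t - c)%C with (RtoC rho * cis t)%C by ring.
  rewrite Cmod_mult, Cmod_cis, Cmod_R, Rabs_right; lra.
Qed.

Lemma Cmod_dcirc t : Cmod (dcirc t) = rho.
Proof. unfold dcirc; rewrite !Cmod_mult, Cmod_Ci, Cmod_cis, Cmod_R, Rabs_right; lra. Qed.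

Lemma circ_periodic : circ (2 * PI) = circ 0.
Proof. unfold circ, cis. now rewrite cos_2PI, sin_2PI, cos_0, sin_0. Qed.

Lemma Cmod_circ_ge z t : rho - Cmod (z - c)%C <= Cmod (circ t - z)%C.
Proof.
  rewrite <- (Cmod_circ t).
  replace (circ t - z)%C with ((circ t - c) - (z - c))%C by ring. apply Cmod_sub_ge.
Qed.

Lemma circ_neq z t : Cmod (z - c)%C < rho -> (circ t - z)%C <> RtoC 0.
Proof. intros H; apply Cmod_gt_0. generalize (Cmod_circ_ge z t); lra. Qed.

Lemma circ_int_exact P g : (forall t, cder P (circ t) (g t)) -> (forall t, rcont g t) ->
  CInt (fun t => g t * dcirc t)%C 0 (2 * PI) = RtoC 0.
Proof.
  intros HP Hg.
  rewrite (CInt_FTC (fun t => P (circ t))).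
  - rewrite circ_periodic; ring.
  - intros t _. apply (der_comp RtoC circ P); [apply HP|apply rder_circ].
  - intros t _. apply rcont_mult; [auto|apply rcont_dcirc].
Qed.

(** The Cauchy transform of a density on the circle, with [dcirc] absorbed into [H]. The orders 1,
    2, 3 occur: they represent a function and its first two derivatives up to constants. *)
Definition ctrans (H : R -> C) (k : nat) (z : C) : C :=
  CInt (fun t => H t / (circ t - z) ^ k)%C 0 (2 * PI).

Lemma rcont_pow f k t : rcont f t -> rcont (fun u => f u ^ k)%C t.
Proof.
  intros H; induction k; simpl; [apply rcont_const|]. now apply (rcont_mult f (fun u => f u ^ k)%C).
Qed.

Lemma rcont_kernel H k z t : Cmod (z - c)%C < rho -> (forall t, rcont H t) ->
  rcont (fun t => H t / (circ t - z) ^ k)%C t.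
Proof.
  intros Hz HH. apply rcont_mult; auto. apply (rcont_inv (fun t => (circ t - z) ^ k)%C).
  - apply Cpow_nz, circ_neq, Hz.
  - apply (rcont_pow (fun t => circ t - z)%C). apply rcont_minus; [apply rcont_circ|apply rcont_const].
Qed.

Lemma Cmod_pow_ge (u : C) a n : 0 <= a -> a <= Cmod u -> a ^ n <= Cmod (u ^ n)%C.
Proof. intros H0 H; rewrite Cmod_pow. now apply pow_incr. Qed.

Lemma ctrans_cder_aux H k K z : Cmod (z - c)%C < rho -> (forall t, rcont H t) ->
  (forall a, 0 < a -> exists K, 0 <= K /\ forall u h, a <= Cmod u -> Cmod h <= a / 2 ->
     Cmod (/ (u - h) ^ k - / u ^ k - RtoC (INR k) / u ^ S k * h)%C <= K * Cmod h ^ 2) ->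
  K = (RtoC (INR k) * ctrans H (S k) z)%C ->
  cder (ctrans H k) z K.
Proof.
  intros Hz HH Hk ->.
  (* [a] bounds the distance from [z] to the circle from below; moving [z] by less than a/2 keeps
     the kernel bounded uniformly in [t]. *)
  set (a := rho - Cmod (z - c)%C). assert (Ha : 0 < a) by (unfold a; lra).
  destruct (Hk a Ha) as [K [HK HKb]].
  destruct (rcont_bounded H 0 (2 * PI)) as [B [HB HBb]]; auto; [generalize PI_RGT_0; lra|].
  unfold ctrans. rewrite <- CInt_Cmult by (intros; now apply rcont_kernel).
  assert (Hnear : forall w, Cmod (w - z)%C < a / 2 -> Cmod (w - c)%C < rho).
  { intros w Hw. replace (w - c)%C with ((w - z) + (z - c))%C by ring.
    eapply Rle_lt_trans; [apply Cmod_triangle|]. unfold a in *; lra. }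
  apply (CInt_param_cder (fun t w => H t / (circ t - w) ^ k)%C _ 0 (2 * PI) z (a / 2) (B * K)).
  - generalize PI_RGT_0; lra.
  - lra.
  - nra.
  - intros w t Hw. apply rcont_kernel; auto.
  - intros t. apply rcont_mult; [apply rcont_const|]. now apply rcont_kernel.
  - intros w t Hw Ht.
    specialize (HKb (circ t - z)%C (w - z)%C (Cmod_circ_ge z t) (Rlt_le _ _ Hw)).
    replace (circ t - z - (w - z))%C with (circ t - w)%C in HKb by ring.
    replace (H t / (circ t - w) ^ k - H t / (circ t - z) ^ k -
      RtoC (INR k) * (H t / (circ t - z) ^ S k) * (w - z))%C with
     (H t * (/ (circ t - w) ^ k - / (circ t - z) ^ k - RtoC (INR k) / (circ t - z) ^ S k * (w - z)))%C.
    2:{ unfold Cdiv; ring. }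
    rewrite Cmod_mult, Rmult_assoc. apply Rmult_le_compat; auto using Cmod_ge_0.
Qed.

Lemma half_bound (u h : C) a : 0 < a -> a <= Cmod u -> Cmod h <= a / 2 -> 
  u <> RtoC 0 /\ (u - h)%C <> RtoC 0 /\ a / 2 <= Cmod (u - h)%C.
Proof.
  intros Ha Hu Hh. assert (Hb : a / 2 <= Cmod (u - h)%C) by (generalize (Cmod_sub_ge u h); lra).
  repeat split; auto; apply Cmod_gt_0; lra.
Qed.

Lemma ctrans_cder1 H z : Cmod (z - c)%C < rho -> (forall t, rcont H t) ->
  cder (ctrans H 1) z (ctrans H 2 z).
Proof.
  intros Hz HH. apply ctrans_cder_aux; auto; [|simpl; ring].
  intros a Ha. exists (/ (a ^ 2 * (a / 2))).
  assert (Hp : 0 < a ^ 2 * (a / 2)) by (apply Rmult_lt_0_compat; [apply pow_lt|]; lra).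
  split; [left; now apply Rinv_0_lt_compat|].
  intros u h Hu Hh. destruct (half_bound u h a Ha Hu Hh) as (N1 & N2 & N3).
  replace (/ (u - h) ^ 1 - / u ^ 1 - RtoC (INR 1) / u ^ 2 * h)%C with (h ^ 2 / (u ^ 2 * (u - h)))%C.
  2:{ simpl. field. auto. }
  rewrite Cmod_div by (apply Cmult_neq_0; [now apply Cpow_nz|auto]).
  rewrite Cmod_mult, Cmod_pow. unfold Rdiv at 1; rewrite (Rmult_comm (Cmod h ^ 2)). apply Rmult_le_compat_r; [apply pow_le, Cmod_ge_0|].
  apply Rinv_le_contravar; auto. apply Rmult_le_compat; try lra; [apply pow_le; lra|].
  apply Cmod_pow_ge; lra.
Qed.

Lemma ctrans_cder2 H z : Cmod (z - c)%C < rho -> (forall t, rcont H t) ->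
  cder (ctrans H 2) z (2 * ctrans H 3 z)%C.
Proof.
  intros Hz HH. apply ctrans_cder_aux; auto.
  (* 4 bounds |3 - 2 h/u|, since |h/u| is at most 1/2; the other factors are the lower bounds [a]
     for |u| and a/2 for |u - h|. *)
  intros a Ha. exists (4 / (a ^ 2 * (a / 2) ^ 2)).
  assert (Hp : 0 < a ^ 2 * (a / 2) ^ 2) by (apply Rmult_lt_0_compat; apply pow_lt; lra).
  split; [left; now apply Rdiv_lt_0_compat; [lra|]|].
  intros u h Hu Hh. destruct (half_bound u h a Ha Hu Hh) as (N1 & N2 & N3).
  replace (/ (u - h) ^ 2 - / u ^ 2 - RtoC (INR 2) / u ^ 3 * h)%C with
    (h ^ 2 * (3 - 2 * (h / u)) / (u ^ 2 * (u - h) ^ 2))%C.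
  2:{ replace (INR 2) with 2 by (simpl; ring). field. auto. }
  rewrite Cmod_div by (apply Cmult_neq_0; now apply Cpow_nz).
  rewrite !Cmod_mult, Cmod_pow.
  assert (H4 : Cmod (3 - 2 * (h / u))%C <= 4).
  { replace 4 with (3 + 2 * (/ 2)) by field.
    apply Cmod_le_plus; [rewrite Cmod_R, Rabs_right; lra|].
    rewrite Cmod_opp, Cmod_mult, Cmod_R, Rabs_right by lra. apply Rmult_le_compat_l; [lra|].
    rewrite Cmod_div by auto. apply Rmult_le_reg_r with (Cmod u); [lra|].
    unfold Rdiv; rewrite Rmult_assoc, Rinv_l; lra. }
  assert (H5 : a ^ 2 * (a / 2) ^ 2 <= Cmod (u ^ 2)%C * Cmod ((u - h) ^ 2)%C).
  { apply Rmult_le_compat; try (apply pow_le; lra); apply Cmod_pow_ge; lra. }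
  unfold Rdiv. rewrite (Rmult_comm (4 * _)), <- Rmult_assoc.
  apply Rmult_le_compat.
  - apply Rmult_le_pos; [apply pow_le|]; apply Cmod_ge_0.
  - left; apply Rinv_0_lt_compat; lra.
  - apply Rmult_le_compat_l; auto. apply pow_le, Cmod_ge_0.
  - apply Rinv_le_contravar; auto.
Qed.

Lemma cder_zero_const (f : C -> C) r : (forall z, Cmod (z - c)%C < r -> cder f z (RtoC 0)) ->
  forall z, Cmod (z - c)%C < r -> f z = f c.
Proof.
  intros Hf z Hz.
  set (g := fun t : R => f (c + RtoC t * (z - c))%C).
  assert (Hg : forall t, Rabs (t - 0) <= Rabs (1 - 0) -> rder g t (RtoC 0)).
  { intros t Ht. eapply der_eq; [|apply (der_comp RtoC (fun t => c + RtoC t * (z - c))%C f)].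
    2:{ apply Hf. replace (c + RtoC t * (z - c) - c)%C with (RtoC t * (z - c))%C by ring.
        rewrite Cmod_mult, Cmod_R. rewrite !Rminus_0_r, Rabs_R1 in Ht.
        generalize (Cmod_ge_0 (z - c)%C); nra. }
    2:{ apply der_plus; [apply der_const|apply der_mult; [apply der_id|apply der_const]]. }
    ring. }
  assert (E := rder_mvt g (fun _ => RtoC 0) 0 1 (RtoC 0) 0).
  assert (E' : Cmod (g 1 - g 0)%C <= 0).
  { eapply Rle_trans; [|eapply Rle_trans; [apply E|]].
    - right; f_equal; ring.
    - intros t Ht; split; [auto|]. replace (0 - 0)%C with (RtoC 0) by ring. rewrite Cmod_0; lra.
    - right; ring. }
  assert (E2 : (g 1 - g 0)%C = RtoC 0) by (apply Cmod_eq_0, Rle_antisym; [auto|apply Cmod_ge_0]).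
  apply Ceq_minus in E2. unfold g in E2.
  replace (c + 1 * (z - c))%C with z in E2 by ring. replace (c + 0 * (z - c))%C with c in E2 by ring. auto.
Qed.

(** The integral does not depend on [z]: its derivative is the integral of 1/(v - z)^2 dv, which has
    the primitive -1/(v - z). At the centre the integrand is the constant [Ci]. *)
Lemma circ_winding z : Cmod (z - c)%C < rho -> ctrans dcirc 1 z = (RtoC (2 * PI) * Ci)%C.
Proof.
  intros Hz. rewrite (cder_zero_const (ctrans dcirc 1) rho); auto.
  - unfold ctrans. rewrite (CInt_ext _ (fun _ => Ci)).
    + rewrite CInt_const; f_equal; f_equal; ring.
    + intros t _. unfold dcirc, circ.
      assert (cis t <> RtoC 0) by (apply Cmod_gt_0; rewrite Cmod_cis; lra).
      assert (RtoC rho <> RtoC 0) by (apply RtoC_neq; lra).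
      replace (c + RtoC rho * cis t - c)%C with (RtoC rho * cis t)%C by ring.
      simpl. field. split; auto.
  - intros w Hw. eapply der_eq; [|apply ctrans_cder1; [exact Hw|apply rcont_dcirc]].
    unfold ctrans.
    rewrite <- (circ_int_exact (fun v => - / (v - w))%C (fun t => / (circ t - w) ^ 2)%C).
    + apply CInt_ext; intros; unfold Cdiv; ring.
    + intros t. assert (Hne := circ_neq w t Hw).
      eapply der_eq; [|apply der_opp, der_inv; [exact Hne|]].
      2:{ apply der_minus; [apply der_id|apply der_const]. }
      simpl. field. auto.
    + intros t. apply (rcont_inv (fun t => (circ t - w) ^ 2)%C).
      * apply Cpow_nz, circ_neq, Hw.
      * apply (rcont_pow (fun t => circ t - w)%C). apply rcont_minus; [apply rcont_circ|apply rcont_const].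
Qed.

Lemma twopii_nz : (RtoC (2 * PI) * Ci)%C <> RtoC 0.
Proof. apply Cmult_neq_0; [apply RtoC_neq; generalize PI_RGT_0; lra|apply Ci_nz]. Qed.

Lemma ccont_rcont_comp f g t : rcont g t -> ccont f (g t) -> rcont (fun t => f (g t)) t.
Proof.
  intros Hg Hf eps He. destruct (Hf eps He) as [d [Hd Hw]]. destruct (Hg d Hd) as [e [Hee Hu]].
  exists e; split; auto.
Qed.

(** The difference quotient of [f] at [z] has a primitive, so its integral over the circle vanishes;
    splitting it leaves [f z] times the winding integral. *)
Lemma cauchy_formula f f' r z : rho < r -> (forall w, box c r w -> cder f w (f' w)) ->
  Cmod (z - c)%C < rho ->
  ctrans (fun t => f (circ t) * dcirc t)%C 1 z = (RtoC (2 * PI) * Ci * f z)%C.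
Proof.
  intros Hr Hf Hz.
  assert (Hin : forall w, Cmod (w - c)%C <= rho -> box c r w) by (intros w Hw; apply box_Cmod; lra).
  destruct (diffquot_primitive c r f f' z) as [P HP]; auto.
  { apply Hin; lra. }
  assert (Hcf : forall t, rcont (fun t => f (circ t)) t).
  { intros t; apply ccont_rcont_comp; [apply rcont_circ|]. eapply cder_ccont, Hf, Hin. rewrite Cmod_circ; lra. }
  assert (E := circ_int_exact P (fun t => (f (circ t) - f z) * / (circ t - z))%C).
  rewrite <- (circ_winding z Hz), Cmult_comm. unfold ctrans.
  assert (Hker : forall t, rcont (fun t => dcirc t / (circ t - z) ^ 1)%C t).
  { intros t; apply rcont_kernel; [auto|apply rcont_dcirc]. }
  rewrite <- CInt_Cmult by auto.
  apply Ceq_minus. rewrite <- CInt_minus.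
  - rewrite <- E.
    + apply CInt_ext. intros t _. simpl. field. now apply circ_neq.
    + intros t. assert (Hne := circ_neq z t Hz). eapply der_eq; [|apply HP, Hin; rewrite Cmod_circ; lra].
      rewrite diffquot_neq; [reflexivity|]. intros E'; apply Hne; rewrite E'; ring.
    + intros t. apply rcont_mult; [apply rcont_minus; [auto|apply rcont_const]|].
      apply rcont_inv; [now apply circ_neq|apply rcont_minus; [apply rcont_circ|apply rcont_const]].
  - intros t _. apply rcont_kernel; auto. intros u; apply rcont_mult; [auto|apply rcont_dcirc].
  - intros t _. apply rcont_mult; [apply rcont_const|auto].
Qed.

(** On the half disc |circ t - z| is at least rho/2, which costs the factor 2. *)
Lemma cauchy_estimate f f' r z B : rho < r -> (forall w, box c r w -> cder f w (f' w)) ->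
  (forall t, 0 <= t <= 2 * PI -> Cmod (f (circ t)) <= B) -> Cmod (z - c)%C <= rho / 2 -> Cmod (f z) <= 2 * B.
Proof.
  intros Hr Hf HB Hz.
  assert (Hz' : Cmod (z - c)%C < rho) by lra.
  assert (E := cauchy_formula f f' r z Hr Hf Hz').
  assert (HPI := PI_RGT_0).
  assert (HB0 : 0 <= B) by (eapply Rle_trans; [apply Cmod_ge_0|apply (HB 0); lra]).
  assert (E2 : Cmod (RtoC (2 * PI) * Ci * f z)%C <= Rabs (2 * PI - 0) * (2 * B)).
  { rewrite <- E. apply CInt_bound.
    - intros t _; apply rcont_kernel; auto. intros u; apply rcont_mult; [|apply rcont_dcirc].
      apply ccont_rcont_comp; [apply rcont_circ|]. eapply cder_ccont, Hf, box_Cmod; [lra|rewrite Cmod_circ; lra].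
    - intros t Ht. rewrite Rmin_left, Rmax_right in Ht by lra.
      assert (Hne := circ_neq z t Hz'). simpl Cpow. rewrite Cmult_1_r.
      rewrite Cmod_div, Cmod_mult, Cmod_dcirc by auto.
      assert (Hge := Cmod_circ_ge z t).
      apply Rmult_le_reg_r with (Cmod (circ t - z)%C); [lra|].
      unfold Rdiv; rewrite Rmult_assoc, Rinv_l, Rmult_1_r by lra.
      specialize (HB t Ht). nra. }
  rewrite !Cmod_mult, Cmod_Ci, Cmod_R, Rminus_0_r, Rmult_1_r in E2.
  apply Rmult_le_reg_l with (Rabs (2 * PI)); auto. apply Rabs_pos_lt; lra.
Qed.
End Circle.

(** Differentiating Cauchy's formula represents [f'] by the kernel of order 2, and that transform is
    differentiable again; nothing is assumed about the continuity of [f']. *)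
Lemma holo_deriv f f' z r : 0 < r -> (forall w, box z r w -> cder f w (f' w)) ->
  exists l, cder f' z l.
Proof.
  intros Hr Hf. set (rho := r / 2). assert (Hrho : 0 < rho) by (unfold rho; lra).
  assert (Hlt : rho < r) by (unfold rho; lra).
  set (H := fun t => (f (circ z rho t) * dcirc rho t)%C).
  assert (HH : forall t, rcont H t).
  { intros u; apply rcont_mult; [|apply rcont_dcirc].
    apply ccont_rcont_comp; [apply rcont_circ|]. eapply cder_ccont, Hf, box_Cmod; [lra|rewrite Cmod_circ; lra]. }
  set (k := (RtoC (2 * PI) * Ci)%C). assert (Hk := twopii_nz). fold k in Hk.
  assert (E : forall w, Cmod (w - z)%C < rho -> f' w = (/ k * ctrans z rho H 2 w)%C).
  { intros w Hw. apply (cder_unique f w); [apply Hf, box_Cmod; lra|].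
    apply der_ext_loc with (f := fun w => (/ k * ctrans z rho H 1 w)%C) (d := rho - Cmod (w - z)%C).
    - lra.
    - intros y Hy. unfold H. rewrite (cauchy_formula z rho Hrho f f' r); auto.
      + fold k. field. auto.
      + replace (y - z)%C with ((y - w) + (w - z))%C by ring.
        eapply Rle_lt_trans; [apply Cmod_triangle|]; lra.
    - now apply der_scal, ctrans_cder1. }
  eexists. apply der_ext_loc with (f := fun w => (/ k * ctrans z rho H 2 w)%C) (d := rho); auto.
  - intros y Hy; symmetry; now apply E.
  - apply der_scal, ctrans_cder2; auto. replace (z - z)%C with (RtoC 0) by ring. now rewrite Cmod_0.
Qed.

(** * Zeros of holomorphic functions *)

Definition near (z : C) (P : C -> Prop) : Prop :=
  exists d, 0 < d /\ forall w, Cmod (w - z)%C < d -> P w.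

Lemma near_and z P Q : near z P -> near z Q -> near z (fun w => P w /\ Q w).
Proof.
  intros [d [Hd H]] [e [He H']]; exists (Rmin d e); split; [now apply Rmin_pos|].
  intros w Hw; apply Rlt_Rmin in Hw as [Hw1 Hw2]; auto.
Qed.

Lemma near_imp z (P Q : C -> Prop) : (forall w, P w -> Q w) -> near z P -> near z Q.
Proof. intros H [d [Hd H']]; exists d; split; auto. Qed.

Lemma near_near z P : near z P -> near z (fun w => near w P).
Proof.
  intros [d [Hd H]]; exists d; split; auto. intros w Hw. exists (d - Cmod (w - z)%C); split; [lra|].
  intros u Hu; apply H. replace (u - z)%C with ((u - w) + (w - z))%C by ring.
  eapply Rle_lt_trans; [apply Cmod_triangle|]; lra.
Qed.

Lemma Cmod_diag z : Cmod (z - z)%C = 0.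
Proof. replace (z - z)%C with (RtoC 0) by ring; apply Cmod_0. Qed.

Lemma near_self z (P : C -> Prop) : near z P -> P z.
Proof. intros [d [Hd H]]; apply H; now rewrite Cmod_diag. Qed.

Lemma near_ccont_neq f z k : ccont f z -> f z <> k -> near z (fun w => f w <> k).
Proof.
  intros Hc Hk. destruct (Hc (Cmod (f z - k)%C)) as [d [Hd Hw]].
  - now apply Cmod_gt_0, Cminus_neq.
  - exists d; split; auto; intros w Hwd E. specialize (Hw w Hwd). rewrite E, Cmod_minus_sym in Hw; lra.
Qed.

Lemma near_neq z u : z <> u -> near z (fun w => w <> u).
Proof.
  intros H; apply (near_ccont_neq (fun w => w)); auto.
  apply cder_ccont with (RtoC 1), der_id.
Qed.

Lemma ccont_ext_near f g z : near z (fun w => f w = g w) -> ccont f z -> ccont g z.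
Proof.
  intros E H eps He. destruct (H eps He) as [d Hd].
  destruct (near_and _ _ _ E (ex_intro _ d Hd)) as [e [H1 H2]]. exists e; split; auto.
  intros w Hw. destruct (H2 w Hw) as [E1 H3]. rewrite <- E1, <- (near_self _ _ E). exact H3.
Qed.

Lemma cder_ext_near f g z l : near z (fun w => f w = g w) -> cder f z l -> cder g z l.
Proof. intros [d [Hd E]]; now apply der_ext_loc with d. Qed.

Lemma wirt_ext_near f g z A B : near z (fun w => f w = g w) -> wirt f z A B -> wirt g z A B.
Proof. intros [d [Hd E]]; now apply wirt_ext_loc with d. Qed.

(* Arbitrary where [f] is not complex differentiable. *)
Definition CD (f : C -> C) (z : C) : C := epsilon (inhabits (RtoC 0)) (fun l => cder f z l).

Lemma CD_spec f z : (exists l, cder f z l) -> cder f z (CD f z).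
Proof. intros H; exact (epsilon_spec _ _ H). Qed.

Lemma CD_unique f z l : cder f z l -> CD f z = l.
Proof. intros H; apply (cder_unique f z); auto. apply CD_spec; now exists l. Qed.

Lemma holo_at_near f z : holo_at f z -> near z (fun w => holo_at f w).
Proof. exact (near_near z _). Qed.

Lemma holo_at_cder f z : holo_at f z -> cder f z (CD f z).
Proof. intros H; apply CD_spec. exact (near_self _ _ H). Qed.

Lemma holo_at_ccont f z : holo_at f z -> ccont f z.
Proof. intros H; eapply cder_ccont, holo_at_cder, H. Qed.

Lemma holo_at_box f z : holo_at f z -> exists r, 0 < r /\ forall w, box z r w -> holo_at f w.
Proof.
  intros H; destruct (holo_at_near _ _ H) as [d [Hd Hw]]. exists (d / 2); split; [lra|].
  intros w [H1 H2]; apply Hw. eapply Rle_lt_trans; [apply Cmod_re_im|].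
  change (Re (w - z)%C) with (Re w - Re z). change (Im (w - z)%C) with (Im w - Im z). lra.
Qed.

Lemma holo_at_CD f z : holo_at f z -> holo_at (CD f) z.
Proof.
  intros H. apply (near_imp z (fun w => holo_at f w)); [|now apply holo_at_near].
  intros w Hw; destruct (holo_at_box f w Hw) as [r [Hr Hb]].
  apply (holo_deriv f (CD f) w r); auto. intros u Hu; apply holo_at_cder, Hb, Hu.
Qed.

Lemma holo_at_ext f g z : near z (fun w => f w = g w) -> holo_at f z -> holo_at g z.
Proof.
  intros E H. apply (near_imp z (fun w => near w (fun u => f u = g u) /\ exists l, cder f w l)).
  - intros w [E' [l Hl]]; exists l; now apply (cder_ext_near f).
  - apply near_and; [now apply near_near|exact H].
Qed.

Lemma holo_at_lift2 (op : C -> C -> C) f g z :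
  (forall w l m, cder f w l -> cder g w m -> exists k, cder (fun u => op (f u) (g u)) w k) ->
  holo_at f z -> holo_at g z -> holo_at (fun u => op (f u) (g u)) z.
Proof.
  intros H Hf Hg. apply (near_imp z (fun w => (exists l, cder f w l) /\ exists m, cder g w m)).
  - intros w [[l Hl] [m Hm]]; now apply (H w l m).
  - now apply near_and.
Qed.

Lemma holo_at_plus f g z : holo_at f z -> holo_at g z -> holo_at (fun u => f u + g u)%C z.
Proof. apply holo_at_lift2; intros w l m Hl Hm; exists (l + m)%C; now apply der_plus. Qed.
Lemma holo_at_minus f g z : holo_at f z -> holo_at g z -> holo_at (fun u => f u - g u)%C z.
Proof. apply holo_at_lift2; intros w l m Hl Hm; exists (l - m)%C; now apply der_minus. Qed.
Lemma holo_at_mult f g z : holo_at f z -> holo_at g z -> holo_at (fun u => f u * g u)%C z.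
Proof. apply holo_at_lift2; intros w l m Hl Hm; eexists; apply der_mult; [exact Hl|exact Hm]. Qed.
Lemma holo_at_const k z : holo_at (fun _ => k) z.
Proof. exists 1; split; [lra|]; intros; exists (RtoC 0); apply der_const. Qed.
Lemma holo_at_id z : holo_at (fun w => w) z.
Proof. exists 1; split; [lra|]; intros; exists (RtoC 1); apply der_id. Qed.
Lemma holo_at_scal k f z : holo_at f z -> holo_at (fun u => k * f u)%C z.
Proof. apply (holo_at_mult (fun _ => k)), holo_at_const. Qed.
Lemma holo_at_pow f n z : holo_at f z -> holo_at (fun u => f u ^ n)%C z.
Proof.
  intros H; apply (near_imp z (fun w => exists l, cder f w l)); auto.
  intros w [l Hl]; eexists; now apply (der_pow (fun z => z)), Hl.
Qed.
Lemma holo_at_div f g z : g z <> RtoC 0 -> holo_at f z -> holo_at g z -> holo_at (fun u => f u / g u)%C z.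
Proof.
  intros Hnz Hf Hg.
  apply (near_imp z (fun w => g w <> RtoC 0 /\ (exists l, cder f w l) /\ exists m, cder g w m)).
  - intros w [Hw [[l Hl] [m Hm]]]; eexists; apply (der_div (fun z => z)); [exact Hw|exact Hl|exact Hm].
  - apply near_and; [|now apply near_and]. apply near_ccont_neq; auto. now apply holo_at_ccont.
Qed.

Lemma Cconj_inj_0 z : Cconj z = RtoC 0 -> z = RtoC 0.
Proof. intros E; rewrite <- (Cconj_conj z), E. apply injective_projections; simpl; ring. Qed.

Definition crefl (f : C -> C) (z : C) : C := Cconj (f (Cconj z)).

Lemma near_crefl z P : near (Cconj z) P -> near z (fun w => P (Cconj w)).
Proof.
  intros [d [Hd H]]; exists d; split; auto; intros w Hw; apply H.
  now rewrite <- Cminus_conj, Cmod_conj.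
Qed.

Lemma holo_at_crefl f z : holo_at f (Cconj z) -> holo_at (crefl f) z.
Proof.
  intros H. apply near_crefl in H. eapply near_imp; [|exact H].
  intros w [l Hl]; exists (Cconj l); now apply cder_conj_refl.
Qed.

(** Iterated difference quotients at [c]: [dqn f c m c] is the Taylor coefficient of order [m],
    obtained without a power series. *)
Fixpoint dqn (f : C -> C) (c : C) (m : nat) : C -> C :=
  match m with
  | O => f
  | S m => diffquot (dqn f c m) c (CD (dqn f c m) c)
  end.

(** Removable singularity: a difference quotient has a primitive on the square, hence is the
    derivative of a holomorphic function. *)
Lemma dqn_holo f c r m : (forall w, box c r w -> holo_at f w) -> 0 < r ->
  forall w, box c r w -> holo_at (dqn f c m) w.
Proof.
  intros Hf Hr; induction m; auto.
  assert (Hc : box c r c) by (apply box_Cmod; auto; now rewrite Cmod_diag).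
  destruct (diffquot_primitive c r (dqn f c m) (CD (dqn f c m)) c Hc) as [P HP].
  { intros w Hw; apply holo_at_cder, IHm, Hw. }
  intros w Hw. simpl.
  apply (holo_at_ext (CD P)).
  - destruct (box_open c r w Hw) as [d [Hd Hb]]. exists d; split; auto.
    intros u Hu; apply CD_unique, HP; auto.
  - apply holo_at_CD. destruct (box_open c r w Hw) as [d [Hd Hb]]. exists d; split; auto.
    intros u Hu; eexists; apply HP; auto.
Qed.

Lemma dqn_factor f c m : (forall k, (k < m)%nat -> dqn f c k c = RtoC 0) ->
  forall w, f w = ((w - c) ^ m * dqn f c m w)%C.
Proof.
  induction m; intros H w; [simpl; ring|].
  rewrite IHm by (intros; apply H; lia).
  simpl dqn; simpl Cpow. destruct (excluded_middle_informative (w = c)) as [->|Hne].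
  - rewrite (H m) by lia. ring.
  - rewrite diffquot_neq, (H m) by (auto; lia). field. now apply Cminus_neq.
Qed.

(** The first nonzero Taylor coefficient gives the factorization. If there is none, f = (w - c)^m *
    dqn f c m for all [m]; with |f| at most [B] on the circle, Cauchy's estimate bounds the second
    factor by 2B / rho^m, and on the half disc |f| is at most 2B / 2^m. *)
Lemma holo_factor f c : holo_at f c -> near c (fun w => f w = RtoC 0) \/
  exists m h, holo_at h c /\ h c <> RtoC 0 /\ forall w, f w = ((w - c) ^ m * h w)%C.
Proof.
  intros Hf. destruct (holo_at_box f c Hf) as [r [Hr Hb]].
  destruct (Classical_Prop.classic (exists m, dqn f c m c <> RtoC 0)) as [Hex|Hno].
  - right.
    assert (Hmin : exists m, dqn f c m c <> RtoC 0 /\ forall k, (k < m)%nat -> dqn f c k c = RtoC 0).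
    { destruct Hex as [m Hm]. revert Hm. induction m as [m IH] using (well_founded_induction Wf_nat.lt_wf); intros Hm.
      destruct (Classical_Prop.classic (exists k, (k < m)%nat /\ dqn f c k c <> RtoC 0)) as [[k [Hk1 Hk2]]|Hn].
      - now apply (IH k).
      - exists m; split; auto. intros k Hk. apply Classical_Prop.NNPP; intros Hne; apply Hn; now exists k. }
    destruct Hmin as [m [Hm Hk]]. exists m, (dqn f c m); repeat split; auto.
    + apply (dqn_holo f c r m Hb Hr). apply box_Cmod; auto; now rewrite Cmod_diag.
    + now apply dqn_factor.
  - left. assert (Hz : forall m, dqn f c m c = RtoC 0).
    { intros m; apply Classical_Prop.NNPP; intros Hne; apply Hno; now exists m. }
    set (rho := r / 2). assert (Hrho : 0 < rho) by (unfold rho; lra).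
    assert (Hlt : rho < r) by (unfold rho; lra).
    destruct (rcont_bounded (fun t => f (circ c rho t)) 0 (2 * PI)) as [B [HB HBb]].
    { generalize PI_RGT_0; lra. }
    { intros t _; apply ccont_rcont_comp; [apply rcont_circ|].
      apply holo_at_ccont, Hb, box_Cmod; [lra|rewrite Cmod_circ; lra]. }
    assert (Hpow : forall m w, Cmod (w - c)%C <= rho / 2 -> Cmod (f w) <= 2 * B * (/ 2) ^ m).
    { intros m w Hw. assert (Hfac := dqn_factor f c m (fun k _ => Hz k)).
      assert (Hrm : 0 < rho ^ m) by (now apply pow_lt).
      assert (Hest : Cmod (dqn f c m w) <= 2 * (B / rho ^ m)).
      { apply (cauchy_estimate c rho Hrho _ (CD (dqn f c m)) r); auto.
        - intros u Hu; apply holo_at_cder. now apply (dqn_holo f c r).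
        - intros t Ht. specialize (HBb t Ht). cbv beta in HBb. rewrite Hfac, Cmod_mult, Cmod_pow, Cmod_circ in HBb by auto.
          apply Rmult_le_reg_l with (rho ^ m); auto.
          replace (rho ^ m * (B / rho ^ m)) with B by (field; lra). exact HBb. }
      rewrite Hfac, Cmod_mult, Cmod_pow.
      apply Rle_trans with ((rho * / 2) ^ m * (2 * (B / rho ^ m))).
      - apply Rmult_le_compat; auto using Cmod_ge_0; [apply pow_le, Cmod_ge_0|].
        apply pow_incr; split; [apply Cmod_ge_0|exact Hw].
      - rewrite Rpow_mult_distr. right; field; lra. }
    exists (rho / 2); split; [lra|]. intros w Hw.
    apply Cmod_eq_0, Rle_antisym; [|apply Cmod_ge_0]. apply le_epsilon; intros eps He. rewrite Rplus_0_l.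
    destruct (pow_lt_1_zero (/ 2)) with (y := eps / (2 * B)) as [n Hn].
    + rewrite Rabs_right; lra.
    + apply Rdiv_lt_0_compat; lra.
    + specialize (Hn n (Nat.le_refl n)). rewrite Rabs_right in Hn by (left; apply pow_lt; lra).
      eapply Rle_trans; [apply (Hpow n); lra|].
      apply Rmult_lt_compat_l with (r := 2 * B) in Hn; [|lra].
      replace (2 * B * (eps / (2 * B))) with eps in Hn by (field; lra). lra.
Qed.

Lemma holo_isolated f c : holo_at f c -> near c (fun w => f w = RtoC 0) \/
  near c (fun w => w <> c -> f w <> RtoC 0).
Proof.
  intros Hf; destruct (holo_factor f c Hf) as [H|(m & h & Hh & Hc & E)]; [now left|right].
  apply (near_imp c (fun w => h w <> RtoC 0)).
  - intros w Hw Hne. rewrite E. apply Cmult_neq_0; auto. now apply Cpow_nz, Cminus_neq.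
  - apply near_ccont_neq; auto. now apply holo_at_ccont.
Qed.

(** Real zeros accumulate at [s]. This is how identities known on the punctured axis spread to a
    neighbourhood in the plane, the omitted point included. *)
Lemma holo_zero_real f s : holo_at f (RtoC s) ->
  (exists d, 0 < d /\ forall s', Rabs (s' - s) < d -> s' <> s -> f (RtoC s') = RtoC 0) ->
  near (RtoC s) (fun w => f w = RtoC 0).
Proof.
  intros Hf [d [Hd H]]. destruct (holo_isolated f _ Hf) as [H0|[e [He H0]]]; auto. exfalso.
  set (h := Rmin d e / 2). assert (0 < Rmin d e) by now apply Rmin_pos.
  assert (Rmin d e <= d) by apply Rmin_l. assert (Rmin d e <= e) by apply Rmin_r.
  assert (Hh : Rabs (s + h - s) = h) by (rewrite Rabs_right; unfold h; lra).
  apply (H0 (RtoC (s + h))).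
  - rewrite Cmod_RtoC_minus, Hh; unfold h; lra.
  - intros E; apply RtoC_inj in E; unfold h in E; lra.
  - apply H; [rewrite Hh; unfold h; lra|unfold h; lra].
Qed.

Lemma open_near (A : C -> Prop) : open (T := C_UniformSpace) A <-> forall z, A z -> near z A.
Proof.
  split; intros H z Hz; specialize (H z Hz); now apply C_locally_Cmod in H || now apply C_locally_Cmod.
Qed.

(** Since [V] is open, V cut with [E] and V minus [E] are open in the plane, which is the form of
    cover that [connected_open] asks for. *)
Lemma connected_clopen V (E : C -> Prop) : connected_open V ->
  (forall z, V z -> E z -> near z E) -> (forall z, V z -> ~ E z -> near z (fun w => ~ E w)) ->
  (exists z, V z /\ E z) -> forall z, V z -> E z.
Proof.
  intros [Vo Vc] H1 H2 [z0 [V0 E0]] z Vz. apply Classical_Prop.NNPP; intros Hn.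
  rewrite open_near in Vo.
  destruct (Vc (fun z => V z /\ E z) (fun z => V z /\ ~ E z)) as [w Hw]; try tauto.
  - apply open_near; intros w [Hw1 Hw2]; apply near_and; auto.
  - apply open_near; intros w [Hw1 Hw2]; apply near_and; auto.
  - intros w Hw; destruct (Classical_Prop.classic (E w)); tauto.
  - now exists z0.
  - now exists z.
Qed.

(** The set where [f] vanishes on a whole neighbourhood is open by construction, and relatively
    closed because other zeros are isolated. *)
Lemma identity_theorem V f : connected_open V -> (forall z, V z -> holo_at f z) ->
  (exists z, V z /\ near z (fun w => f w = RtoC 0)) -> forall z, V z -> f z = RtoC 0.
Proof.
  intros HV Hf Hex z Hz.
  apply (near_self z (fun w => f w = RtoC 0)).
  apply (connected_clopen V (fun z => near z (fun w => f w = RtoC 0))); auto.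
  - intros w _ Hw; now apply near_near.
  - intros w Hw Hne. destruct (holo_isolated f w (Hf w Hw)) as [H|H]; [contradiction|].
    apply (near_imp w (fun u => u = w \/ near u (fun v => f v <> RtoC 0))).
    + intros u [->|Hu]; auto. intros H0; now apply (near_self _ _ Hu), (near_self _ _ H0).
    + destruct (near_near _ _ H) as [d [Hd Hw']]. exists d; split; auto. intros u Hu.
      destruct (excluded_middle_informative (u = w)) as [->|Hn]; auto. right.
      apply (near_imp u (fun v => (v <> w -> f v <> RtoC 0) /\ v <> w)); [tauto|].
      apply near_and; [now apply Hw'|now apply near_neq].
Qed.

(** * Uniqueness of Liouville jets *)

(** The integrating factor exp(sg * N * t) makes [E] monotone in the useful direction: [sg] is -1
    when [x1] lies to the right of [x0], and 1 when it lies to the left. *)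
Lemma gronwall_zero (E E' : R -> R) (x0 x1 N : R) :
  (forall t, Rmin x0 x1 <= t <= Rmax x0 x1 -> is_derive E t (E' t) /\ Rabs (E' t) <= N * E t) ->
  0 <= E x1 -> E x0 = 0 -> E x1 = 0.
Proof.
  intros H Hpos H0.
  assert (Key : forall sg, (sg = 1 \/ sg = -1) -> exists t, Rmin x0 x1 <= t <= Rmax x0 x1 /\
    E x1 * exp (sg * N * x1) = (E' t + sg * N * E t) * exp (sg * N * t) * (x1 - x0)).
  { intros sg Hsg.
    assert (Hd : forall t, Rmin x0 x1 <= t <= Rmax x0 x1 ->
      is_derive (fun t => E t * exp (sg * N * t)) t ((E' t + sg * N * E t) * exp (sg * N * t))).
    { intros t Ht. destruct (H t Ht) as [HE _]. auto_derive.
      - repeat split; auto. now exists (E' t).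
      - replace (Derive (fun x => E x) t) with (E' t) by (symmetry; now apply is_derive_unique). ring. }
    destruct (MVT_gen (fun t => E t * exp (sg * N * t)) x0 x1 (fun t => (E' t + sg * N * E t) * exp (sg * N * t))) as [t [Ht Et]].
    - intros t Ht; apply Hd; lra.
    - intros t Ht. apply derivable_continuous_pt. eexists. apply is_derive_Reals. now apply Hd.
    - exists t; split; auto. rewrite <- Et, H0. ring. }
  assert (Habs : forall t, Rmin x0 x1 <= t <= Rmax x0 x1 -> E' t <= N * E t /\ - (N * E t) <= E' t).
  { intros t Ht. destruct (H t Ht) as [_ HE]. apply Rabs_le_between in HE. lra. }
  apply Rle_antisym; auto.
  destruct (Rle_dec x0 x1) as [Hle|Hle].
  - destruct (Key (-1)) as [t [Ht Et]]; [now right|].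
    specialize (Habs t Ht). 
    apply Rmult_le_reg_r with (exp (-1 * N * x1)); [apply exp_pos|]. rewrite Et, Rmult_0_l.
    generalize (exp_pos (-1 * N * t)); intros He.
    assert ((E' t + -1 * N * E t) * exp (-1 * N * t) <= 0) by nra. nra.
  - destruct (Key 1) as [t [Ht Et]]; [now left|].
    specialize (Habs t Ht). 
    apply Rmult_le_reg_r with (exp (1 * N * x1)); [apply exp_pos|]. rewrite Et, Rmult_0_l.
    generalize (exp_pos (1 * N * t)); intros He.
    assert (0 <= (E' t + 1 * N * E t) * exp (1 * N * t)) by nra. nra.
Qed.

Lemma is_derive_Cmod2 (f : R -> C) t l : rder f t l ->
  is_derive (fun t => Cmod (f t) ^ 2) t (2 * Re (Cconj (f t) * l)%C).
Proof.
  intros H; apply rder_parts in H; destruct H as [H1 H2].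
  apply is_derive_ext with (f := fun t => Re (f t) * Re (f t) + Im (f t) * Im (f t)).
  - intros u. symmetry. rewrite (Cmod2_alt (f u)). change (Re (f u) ^ 2 + Im (f u) ^ 2 = Re (f u) * Re (f u) + Im (f u) * Im (f u)). ring.
  - replace (2 * Re (Cconj (f t) * l)%C) with
      ((Re l * Re (f t) + Re (f t) * Re l) + (Im l * Im (f t) + Im (f t) * Im l)).
    + apply (is_derive_plus (V := R_NormedModule)); apply (is_derive_mult (K := R_AbsRing));
        auto; intros; apply Rmult_comm.
    + unfold Re, Im; simpl. ring.
Qed.

Lemma Re_conj_mult_le (u v : C) : Rabs (Re (Cconj u * v)%C) <= Cmod u * Cmod v.
Proof. rewrite <- (Cmod_conj u), <- Cmod_mult. apply re_le_Cmod. Qed.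

Lemma linear_system_zero (d1 d2 d3 e1 e2 e3 : R -> C) (x0 x1 M : R) : 0 <= M ->
  (forall t, Rmin x0 x1 <= t <= Rmax x0 x1 -> rder d1 t (e1 t) /\ rder d2 t (e2 t) /\ rder d3 t (e3 t) /\
     Cmod (e1 t) <= M * (Cmod (d1 t) + Cmod (d2 t) + Cmod (d3 t)) /\
     Cmod (e2 t) <= M * (Cmod (d1 t) + Cmod (d2 t) + Cmod (d3 t)) /\
     Cmod (e3 t) <= M * (Cmod (d1 t) + Cmod (d2 t) + Cmod (d3 t))) ->
  d1 x0 = RtoC 0 -> d2 x0 = RtoC 0 -> d3 x0 = RtoC 0 ->
  d1 x1 = RtoC 0 /\ d2 x1 = RtoC 0 /\ d3 x1 = RtoC 0.
Proof.
  intros HM H Z1 Z2 Z3.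
  set (E := fun t => Cmod (d1 t) ^ 2 + Cmod (d2 t) ^ 2 + Cmod (d3 t) ^ 2).
  assert (HE : E x1 = 0).
  (* With n the sum of the three moduli, |E'| is at most 2 M n^2, and n^2 is at most 3 E; hence
     [6 * M]. *)
  { apply (gronwall_zero E (fun t => 2 * Re (Cconj (d1 t) * e1 t)%C + 2 * Re (Cconj (d2 t) * e2 t)%C
       + 2 * Re (Cconj (d3 t) * e3 t)%C) x0 x1 (6 * M)).
    - intros t Ht. destruct (H t Ht) as (H1 & H2 & H3 & B1 & B2 & B3). split.
      + unfold E.
        apply (is_derive_plus (V := R_NormedModule) (fun t => Cmod (d1 t) ^ 2 + Cmod (d2 t) ^ 2) (fun t => Cmod (d3 t) ^ 2)).
        * apply (is_derive_plus (V := R_NormedModule) (fun t => Cmod (d1 t) ^ 2) (fun t => Cmod (d2 t) ^ 2));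
          now apply is_derive_Cmod2.
        * now apply is_derive_Cmod2.
      + generalize (Re_conj_mult_le (d1 t) (e1 t)) (Re_conj_mult_le (d2 t) (e2 t)) (Re_conj_mult_le (d3 t) (e3 t)).
        unfold E. generalize (Cmod_ge_0 (d1 t)) (Cmod_ge_0 (d2 t)) (Cmod_ge_0 (d3 t)).
        revert B1 B2 B3.
        generalize (Re (Cconj (d1 t) * e1 t)%C) (Re (Cconj (d2 t) * e2 t)%C) (Re (Cconj (d3 t) * e3 t)%C).
        generalize (Cmod (d1 t)) (Cmod (d2 t)) (Cmod (d3 t)) (Cmod (e1 t)) (Cmod (e2 t)) (Cmod (e3 t)).
        intros a b c p q r u v w B1 B2 B3 Pa Pb Pc Hu Hv Hw.
        apply Rle_trans with (2 * (Rabs u + Rabs v + Rabs w)).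
        * eapply Rle_trans; [apply Rabs_triang|]. rewrite !Rabs_mult, (Rabs_right 2) by lra.
          generalize (Rabs_triang (2 * u) (2 * v)). rewrite !Rabs_mult, (Rabs_right 2) by lra. lra.
        * assert (a * p <= a * (M * (a + b + c))) by (apply Rmult_le_compat_l; auto).
          assert (b * q <= b * (M * (a + b + c))) by (apply Rmult_le_compat_l; auto).
          assert (c * r <= c * (M * (a + b + c))) by (apply Rmult_le_compat_l; auto).
          assert (M * (a + b + c) ^ 2 <= M * (3 * (a ^ 2 + b ^ 2 + c ^ 2))).
          { apply Rmult_le_compat_l; auto.
            generalize (pow2_ge_0 (a - b)) (pow2_ge_0 (a - c)) (pow2_ge_0 (b - c)); nra. }
          lra.
    - unfold E. generalize (pow2_ge_0 (Cmod (d1 x1))) (pow2_ge_0 (Cmod (d2 x1))) (pow2_ge_0 (Cmod (d3 x1))); lra.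
    - unfold E; rewrite Z1, Z2, Z3, Cmod_0; ring. }
  unfold E in HE.
  generalize (pow2_ge_0 (Cmod (d1 x1))) (pow2_ge_0 (Cmod (d2 x1))) (pow2_ge_0 (Cmod (d3 x1))); intros P1 P2 P3.
  repeat split; apply Cmod_eq_0; apply Rsqr_0_uniq; unfold Rsqr; nra.
Qed.

(* [w] and [om] are the two Wirtinger derivatives of [log Phi], and [Q] is the
   holomorphic projective connection [(log Phi)_zz - ((log Phi)_z)^2 / 2]. *)
Definition liouville_jet (c : R) (Q Phi w om : C -> C) (z : C) : Prop :=
  wirt Phi z (Phi z * w z)%C (Phi z * om z)%C /\
  wirt w z (Q z + w z ^ 2 / 2)%C (- (RtoC c / 2) * Phi z)%C /\
  wirt om z (- (RtoC c / 2) * Phi z)%C (Cconj (Q z) + om z ^ 2 / 2)%C.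

(** Along a line the derivative is al times d/dz plus be times d/dzbar: (1, 1) for horizontal and
    (i, -i) for vertical lines. The functions [q1], [q2] are common to both jets and cancel in the
    differences, which solve a linear system with bounded coefficients. *)
Lemma line_unique (k al be : C) (q1 q2 : R -> C) (F w o F' w' o' : R -> C) (x0 x1 : R) :
  (forall t, Rmin x0 x1 <= t <= Rmax x0 x1 ->
    rder F t (al * (F t * w t) + be * (F t * o t))%C /\
    rder w t (al * (q1 t + w t ^ 2 / 2) + be * (k * F t))%C /\
    rder o t (al * (k * F t) + be * (q2 t + o t ^ 2 / 2))%C /\
    rder F' t (al * (F' t * w' t) + be * (F' t * o' t))%C /\
    rder w' t (al * (q1 t + w' t ^ 2 / 2) + be * (k * F' t))%C /\
    rder o' t (al * (k * F' t) + be * (q2 t + o' t ^ 2 / 2))%C) ->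
  F x0 = F' x0 -> w x0 = w' x0 -> o x0 = o' x0 ->
  F x1 = F' x1 /\ w x1 = w' x1 /\ o x1 = o' x1.
Proof.
  intros H E1 E2 E3.
  assert (Hab : Rmin x0 x1 <= Rmax x0 x1) by (eapply Rle_trans; [apply Rmin_l|apply Rmax_l]).
  assert (Bd : forall g : R -> C, (forall t, Rmin x0 x1 <= t <= Rmax x0 x1 -> exists l, rder g t l) ->
     exists B, 0 < B /\ forall t, Rmin x0 x1 <= t <= Rmax x0 x1 -> Cmod (g t) <= B).
  { intros g Hg. apply rcont_bounded; auto. intros t Ht; destruct (Hg t Ht) as [l Hl]; eapply rder_rcont, Hl. }
  destruct (Bd (fun t => al * w t + be * o t)%C) as [B1 [P1 H1]].
  { intros t Ht; destruct (H t Ht) as (G1 & G2 & G3 & G4 & G5 & G6); eexists.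
    apply der_plus; apply der_scal; eassumption. }
  destruct (Bd (fun t => al * F' t)%C) as [B2 [P2 H2]].
  { intros t Ht; destruct (H t Ht) as (G1 & G2 & G3 & G4 & G5 & G6); eexists. apply der_scal; eassumption. }
  destruct (Bd (fun t => be * F' t)%C) as [B3 [P3 H3]].
  { intros t Ht; destruct (H t Ht) as (G1 & G2 & G3 & G4 & G5 & G6); eexists. apply der_scal; eassumption. }
  destruct (Bd (fun t => al / 2 * (w t + w' t))%C) as [B4 [P4 H4]].
  { intros t Ht; destruct (H t Ht) as (G1 & G2 & G3 & G4 & G5 & G6); eexists.
    apply der_scal, der_plus; eassumption. }
  destruct (Bd (fun t => be / 2 * (o t + o' t))%C) as [B5 [P5 H5]].
  { intros t Ht; destruct (H t Ht) as (G1 & G2 & G3 & G4 & G5 & G6); eexists.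
    apply der_scal, der_plus; eassumption. }
  set (K1 := Cmod (be * k)%C). set (K2 := Cmod (al * k)%C).
  assert (Q1 : 0 <= K1) by apply Cmod_ge_0. assert (Q2 : 0 <= K2) by apply Cmod_ge_0.
  set (M := B1 + B2 + B3 + B4 + B5 + K1 + K2).
  destruct (linear_system_zero (fun t => F t - F' t)%C (fun t => w t - w' t)%C (fun t => o t - o' t)%C
    (fun t => (al * w t + be * o t) * (F t - F' t) + al * F' t * (w t - w' t) + be * F' t * (o t - o' t))%C
    (fun t => al / 2 * (w t + w' t) * (w t - w' t) + be * k * (F t - F' t))%C
    (fun t => al * k * (F t - F' t) + be / 2 * (o t + o' t) * (o t - o' t))%C x0 x1 M) as (Z1 & Z2 & Z3).
  - unfold M; lra.
  - intros t Ht. destruct (H t Ht) as (G1 & G2 & G3 & G4 & G5 & G6).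
    specialize (H1 t Ht); specialize (H2 t Ht); specialize (H3 t Ht); specialize (H4 t Ht); specialize (H5 t Ht).
    cbv beta in *.
    set (n1 := Cmod (F t - F' t)%C). set (n2 := Cmod (w t - w' t)%C). set (n3 := Cmod (o t - o' t)%C).
    assert (N1 : 0 <= n1) by apply Cmod_ge_0. assert (N2 : 0 <= n2) by apply Cmod_ge_0.
    assert (N3 : 0 <= n3) by apply Cmod_ge_0.
    repeat split.
    + eapply der_eq; [|apply der_minus; [exact G1|exact G4]]. ring.
    + eapply der_eq; [|apply der_minus; [exact G2|exact G5]]. field.
    + eapply der_eq; [|apply der_minus; [exact G3|exact G6]]. field.
    + apply Rle_trans with (B1 * n1 + B2 * n2 + B3 * n3).
      * repeat apply Cmod_le_plus; rewrite Cmod_mult; apply Rmult_le_compat_r; auto.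
      * unfold M; nra.
    + apply Rle_trans with (B4 * n2 + K1 * n1).
      * repeat apply Cmod_le_plus; rewrite Cmod_mult; [apply Rmult_le_compat_r; auto|]. apply Rle_refl.
      * unfold M; nra.
    + apply Rle_trans with (K2 * n1 + B5 * n3).
      * repeat apply Cmod_le_plus; rewrite Cmod_mult; [apply Rle_refl|]. apply Rmult_le_compat_r; auto.
      * unfold M; nra.
  - rewrite E1; ring.
  - rewrite E2; ring.
  - rewrite E3; ring.
  - repeat split; apply Ceq_minus; assumption.
Qed.

(** Every point of the square is reached by a horizontal segment followed by a vertical one. The
    third entries need not be conjugate to the second ones, which later lets the lemma compare a jet
    with its own conjugate. *)
Lemma jet_unique c Q z0 r F w o F' w' o' :
  (forall z, box z0 r z -> liouville_jet c Q F w o z) ->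
  (forall z, box z0 r z -> liouville_jet c Q F' w' o' z) ->
  F z0 = F' z0 -> w z0 = w' z0 -> o z0 = o' z0 ->
  forall z, box z0 r z -> F z = F' z /\ w z = w' z /\ o z = o' z.
Proof.
  intros HJ HJ' E1 E2 E3 [x y] Hz. destruct z0 as [x0 y0].
  set (k := (- (RtoC c / 2))%C).
  assert (Hr : 0 < r). { destruct Hz as [Hz _]. eapply Rle_lt_trans; [apply Rabs_pos|apply Hz]. }
  assert (B0 : box (x0, y0) r (x0, y0)) by (apply box_Cmod; auto; now rewrite Cmod_diag).
  assert (B1 : box (x0, y0) r (x, y0)) by (destruct Hz, B0; split; assumption).
  destruct (line_unique k 1 1 (fun s => Q (s, y0)) (fun s => Cconj (Q (s, y0)))
    (fun s => F (s, y0)) (fun s => w (s, y0)) (fun s => o (s, y0))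
    (fun s => F' (s, y0)) (fun s => w' (s, y0)) (fun s => o' (s, y0)) x0 x) as (G1 & G2 & G3); auto.
  - intros s Hs.
    assert (Bs : box (x0, y0) r (s, y0)).
    { apply (box_between _ _ x0 x y0 y0); auto. unfold Rmin, Rmax; destruct (Rle_dec y0 y0); lra. }
    destruct (HJ _ Bs) as ((J1 & _) & (J2 & _) & (J3 & _)).
    destruct (HJ' _ Bs) as ((J4 & _) & (J5 & _) & (J6 & _)).
    repeat split; (eapply der_eq; [|eassumption]); unfold k; ring.
  - destruct (line_unique k Ci (- Ci) (fun t => Q (x, t)) (fun t => Cconj (Q (x, t)))
      (fun t => F (x, t)) (fun t => w (x, t)) (fun t => o (x, t))
      (fun t => F' (x, t)) (fun t => w' (x, t)) (fun t => o' (x, t)) y0 y) as (H1 & H2 & H3); auto.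
    intros t Ht.
    assert (Bs : box (x0, y0) r (x, t)).
    { apply (box_between _ _ x x y0 y); auto. unfold Rmin, Rmax; destruct (Rle_dec x x); lra. }
    destruct (HJ _ Bs) as ((_ & J1) & (_ & J2) & (_ & J3)).
    destruct (HJ' _ Bs) as ((_ & J4) & (_ & J5) & (_ & J6)).
    repeat split; (eapply der_eq; [|eassumption]); unfold k; ring.
Qed.

Lemma near_box z P : near z P -> exists r, 0 < r /\ forall w, box z r w -> P w.
Proof.
  intros [d [Hd H]]; exists (d / 2); split; [lra|]. intros w [H1 H2]; apply H.
  eapply Rle_lt_trans; [apply Cmod_re_im|].
  change (Re (w - z)%C) with (Re w - Re z). change (Im (w - z)%C) with (Im w - Im z). lra.
Qed.

Lemma jet_unique_connected c Q V F w o F' w' o' : connected_open V ->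
  (forall z, V z -> liouville_jet c Q F w o z) ->
  (forall z, V z -> liouville_jet c Q F' w' o' z) ->
  (exists z, V z /\ F z = F' z /\ w z = w' z /\ o z = o' z) ->
  forall z, V z -> F z = F' z /\ w z = w' z /\ o z = o' z.
Proof.
  intros HV HJ HJ' Hex. 
  assert (Vo := proj1 (open_near V) (proj1 HV)).
  apply (connected_clopen V (fun z => F z = F' z /\ w z = w' z /\ o z = o' z)); auto.
  - intros z Hz (E1 & E2 & E3). destruct (near_box z V (Vo z Hz)) as [r [Hr Hb]].
    exists r; split; auto. intros u Hu.
    apply (jet_unique c Q z r); auto. now apply box_Cmod.
  - intros z Hz Hne. destruct (near_box z V (Vo z Hz)) as [r [Hr Hb]].
    (* Half the radius: the square of radius r/2 about a nearby [u] stays in [V] and contains [z],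
       so agreement at [u] would propagate back to [z]. *)
    exists (r / 2); split; [lra|]. intros u Hu (E1 & E2 & E3). apply Hne.
    apply (box_Cmod z (r / 2) u) in Hu; [|lra].
    assert (Hsub : forall v, box u (r / 2) v -> V v).
    { intros v [H1 H2]; apply Hb; destruct Hu as [H3 H4]; split.
      - replace (Re v - Re z) with ((Re v - Re u) + (Re u - Re z)) by ring.
        eapply Rle_lt_trans; [apply Rabs_triang|]; lra.
      - replace (Im v - Im z) with ((Im v - Im u) + (Im u - Im z)) by ring.
        eapply Rle_lt_trans; [apply Rabs_triang|]; lra. }
    apply (jet_unique c Q u (r / 2)); auto.
    destruct Hu as [H3 H4]; split; rewrite Rabs_minus_sym; auto.
Qed.

(** * Jets of classical solutions *)

Lemma ccont_ext f g z : (forall w, f w = g w) -> ccont f z -> ccont g z.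
Proof. intros E; apply ccont_ext_near. exists 1; split; [lra|auto]. Qed.

Lemma ccont_conj f z : ccont f z -> ccont (fun w => Cconj (f w)) z.
Proof.
  intros H eps He; destruct (H eps He) as [d [Hd Hw]]; exists d; split; auto.
  intros w Hw'. rewrite <- Cminus_conj, Cmod_conj. auto.
Qed.

Lemma ccont_RtoC (f : C -> R) z :
  ccont (fun w => RtoC (f w)) z <-> continuous (T := C_UniformSpace) (U := R_UniformSpace) f z.
Proof.
  split.
  - intros H P [e He]. destruct (H e (cond_pos e)) as [d [Hd Hw]].
    apply C_locally_Cmod. exists d; split; auto. intros w Hwd. apply He.
    specialize (Hw w Hwd). now rewrite Cmod_RtoC_minus in Hw.
  - intros H eps He. specialize (H (fun y => Rabs (y - f z) < eps)).
    assert (Hl : locally (T := R_UniformSpace) (f z) (fun y => Rabs (y - f z) < eps)).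
    { exists (mkposreal eps He); intros y Hy; exact Hy. }
    specialize (H Hl). apply C_locally_Cmod in H. destruct H as [d [Hd Hw]].
    exists d; split; auto. intros w Hwd. rewrite Cmod_RtoC_minus. exact (Hw w Hwd).
Qed.

Lemma wirt_partials f z A B : wirt f z A B <-> partials f z (A + B)%C (Ci * (A - B))%C.
Proof. reflexivity. Qed.

Lemma wirt_of_partials f z A B : partials f z A B -> wirt f z ((A - Ci * B) / 2)%C ((A + Ci * B) / 2)%C.
Proof.
  intros [H1 H2]; split.
  - eapply der_eq; [|exact H1]. field.
  - eapply der_eq; [|exact H2]. replace B with (- (Ci * Ci) * B)%C at 1 by (rewrite Ci2; ring). field.
Qed.

Lemma ps_ext_near (f g : C -> R) z : near z (fun w => f w = g w) -> ps f z = ps g z.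
Proof.
  intros [d [Hd H]]. apply Derive_ext_loc. exists (mkposreal d Hd). intros s Hs. apply H.
  destruct z as [x y]. change (Im (x, y)) with y. rewrite Cmod_horiz. exact Hs.
Qed.
Lemma pt_ext_near (f g : C -> R) z : near z (fun w => f w = g w) -> pt f z = pt g z.
Proof.
  intros [d [Hd H]]. apply Derive_ext_loc. exists (mkposreal d Hd). intros s Hs. apply H.
  destruct z as [x y]. change (Re (x, y)) with x. rewrite Cmod_vert. exact Hs.
Qed.

Lemma near_Re_near (f g : C -> C) z : near z (fun w => f w = g w) ->
  near z (fun w => Re (f w) = Re (g w)) /\ near z (fun w => Im (f w) = Im (g w)).
Proof. intros H; split; (eapply near_imp; [|exact H]); intros w Hw; now rewrite Hw. Qed.

Lemma cps_ext_near f g z : near z (fun w => f w = g w) -> cps f z = cps g z.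
Proof.
  intros H; destruct (near_Re_near _ _ _ H) as [H1 H2].
  unfold cps. now rewrite (ps_ext_near _ _ _ H1), (ps_ext_near _ _ _ H2).
Qed.
Lemma cpt_ext_near f g z : near z (fun w => f w = g w) -> cpt f z = cpt g z.
Proof.
  intros H; destruct (near_Re_near _ _ _ H) as [H1 H2].
  unfold cpt. now rewrite (pt_ext_near _ _ _ H1), (pt_ext_near _ _ _ H2).
Qed.
Lemma dz_ext_near f g z : near z (fun w => f w = g w) -> dz f z = dz g z.
Proof. intros H; unfold dz. now rewrite (cps_ext_near _ _ _ H), (cpt_ext_near _ _ _ H). Qed.
Lemma dzbar_ext_near f g z : near z (fun w => f w = g w) -> dzbar f z = dzbar g z.
Proof. intros H; unfold dzbar. now rewrite (cps_ext_near _ _ _ H), (cpt_ext_near _ _ _ H). Qed.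

Lemma partials_real (f : C -> R) z A B :
  partials (fun w => RtoC (f w)) z (RtoC A) (RtoC B) <->
  is_derive (fun s => f (s, Im z)) (Re z) A /\ is_derive (fun t => f (Re z, t)) (Im z) B.
Proof. unfold partials. now rewrite 2!(rder_RtoC (fun _ => f _)). Qed.

Lemma partials_of_ex (f : C -> R) z :
  ex_derive (fun s => f (s, Im z)) (Re z) /\ ex_derive (fun t => f (Re z, t)) (Im z) ->
  partials (fun w => RtoC (f w)) z (RtoC (ps f z)) (RtoC (pt f z)).
Proof. intros [H1 H2]; apply partials_real; split; now apply Derive_correct. Qed.

Lemma partials_ln (f : C -> R) z A B : 0 < f z ->
  partials (fun w => RtoC (f w)) z (RtoC A) (RtoC B) ->
  partials (fun w => RtoC (ln (f w))) z (RtoC (A / f z)) (RtoC (B / f z)).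
Proof.
  intros Hpos H; apply partials_real in H; destruct H as [H1 H2]; apply (partials_real (fun w => ln (f w))).
  destruct z as [x y]; cbn [Re Im fst snd] in *. split.
  - apply (is_derive_comp ln (fun s => f (s, y)) x (/ f (x, y)) A); auto.
    apply is_derive_Reals, derivable_pt_lim_ln; auto.
  - apply (is_derive_comp ln (fun t => f (x, t)) y (/ f (x, y)) B); auto.
    apply is_derive_Reals, derivable_pt_lim_ln; auto.
Qed.

(** Equals (log psi)_z where [psi] is positive; written as a quotient it takes the value b/a on the
    axis at once. *)
Definition logdz (psi : C -> R) (z : C) : C := (dz (fun w => RtoC (psi w)) z / RtoC (psi z))%C.

Lemma C1_real_ccont (U : C -> Prop) (f : C -> R) : (forall z, U z -> near z U) -> Ck_on 1 U f ->
  forall z, U z -> ccont (fun w => RtoC (f w)) z.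
Proof.
  intros Uo (He & Hs & Ht) z Hz.
  destruct (Uo z Hz) as [d [Hd Hn]].
  apply (frechet_ccont _ _ (RtoC (ps f z)) (RtoC (pt f z))).
  apply (C1_frechet (fun w => RtoC (f w)) (fun w => RtoC (ps f w)) (fun w => RtoC (pt f w)) z d Hd).
  - intros w Hw. apply partials_of_ex, He, Hn, Hw.
  - apply ccont_RtoC, Hs, Hz.
  - apply ccont_RtoC, Ht, Hz.
Qed.

Lemma Ck_on_2_1 (U : C -> Prop) (f : C -> R) :
  (forall z, U z -> near z U) -> Ck_on 2 U f -> Ck_on 1 U f.
Proof.
  intros Uo (He & Hs & Ht). split; [exact He|].
  split; intros z Hz; apply ccont_RtoC; now apply (C1_real_ccont U).
Qed.

(** The quotient rule expresses w_z by derivatives of [psi] of order at most 2, so that [Q], defined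
    from it, is continuous. The equation supplies w_zbar, and conjugation gives the equations of the
    third entry. *)
Lemma solution_jet c U psi : (forall z, U z -> near z U) -> Ck_on 2 U psi ->
  (forall z, U z -> 0 < psi z) ->
  (forall z, U z -> dzbar (dz (fun w => RtoC (ln (psi w)))) z = RtoC (- (c / 2) * psi z)) ->
  exists Q, forall z, U z -> ccont Q z /\ ccont (fun w => RtoC (psi w)) z /\ ccont (logdz psi) z /\
    liouville_jet c Q (fun w => RtoC (psi w)) (logdz psi) (fun w => Cconj (logdz psi w)) z.
Proof.
  intros Uo HC2 Hpos HPDE.
  assert (HC1 := Ck_on_2_1 U psi Uo HC2).
  destruct HC2 as (He & (Hes & Hss & Hst) & (Het & Hts & Htt)).
  assert (Hc0 := C1_real_ccont U psi Uo HC1).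
  destruct HC1 as (_ & Hcs & Hct).
  set (F := fun w => RtoC (psi w)).
  set (Fz := fun w => ((RtoC (ps psi w) - Ci * RtoC (pt psi w)) / 2)%C).
  assert (HF : forall z, U z -> wirt F z (Fz z) ((RtoC (ps psi z) + Ci * RtoC (pt psi z)) / 2)%C).
  { intros z Hz; apply wirt_of_partials, partials_of_ex, He, Hz. }
  assert (HFz : forall z, U z -> dz F z = Fz z) by (intros z Hz; exact (wirt_dz _ _ _ _ (HF z Hz))).
  assert (Hnz : forall z, U z -> F z <> RtoC 0).
  { intros z Hz; apply RtoC_neq. specialize (Hpos z Hz); lra. }
  assert (cF : forall z, U z -> ccont F z) by exact Hc0.
  assert (cFz : forall z, U z -> ccont Fz z).
  { intros z Hz. apply ccont_mult; [|apply ccont_const]. apply ccont_minus; [apply ccont_RtoC, Hcs, Hz|].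
    apply ccont_mult; [apply ccont_const|apply ccont_RtoC, Hct, Hz]. }
  set (a1 := fun z => ((RtoC (ps (ps psi) z) - Ci * RtoC (pt (ps psi) z)) / 2)%C).
  set (a2 := fun z => ((RtoC (ps (ps psi) z) + Ci * RtoC (pt (ps psi) z)) / 2)%C).
  set (b1 := fun z => ((RtoC (ps (pt psi) z) - Ci * RtoC (pt (pt psi) z)) / 2)%C).
  set (b2 := fun z => ((RtoC (ps (pt psi) z) + Ci * RtoC (pt (pt psi) z)) / 2)%C).
  assert (HFzz : forall z, U z -> wirt Fz z (/ 2 * (a1 z - Ci * b1 z))%C (/ 2 * (a2 z - Ci * b2 z))%C).
  { intros z Hz.
    apply (wirt_ext_near (fun w => / 2 * (RtoC (ps psi w) - Ci * RtoC (pt psi w)))%C).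
    - exists 1; split; [lra|]; intros; unfold Fz; field.
    - apply wirt_scal, wirt_minus; [|apply wirt_scal]; apply wirt_of_partials, partials_of_ex; auto. }
  set (wz := fun z => ((/ 2 * (a1 z - Ci * b1 z)) / F z - Fz z * Fz z * (/ F z * / F z))%C).
  set (Q := fun z => (wz z - (Fz z / F z) * (Fz z / F z) * / 2)%C).
  assert (Ew : forall z, U z -> near z (fun w => (Fz w / F w)%C = logdz psi w)).
  { intros z Hz. apply (near_imp z U); [|auto]. intros w Hw; unfold logdz. fold F. now rewrite HFz. }
  assert (Hw : forall z, U z -> exists B, wirt (logdz psi) z (wz z) B).
  { intros z Hz. eexists. apply (wirt_ext_near (fun w => Fz w / F w)%C); [now apply Ew|].
    eapply wirt_eq; [|reflexivity|apply wirt_div; [now apply Hnz|now apply HFzz|now apply HF]].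
    unfold wz; field. now apply Hnz. }
  (* [dzbar] is a total function and proves no differentiability. That of [w] comes from [Hw]; the
     equation only identifies the coefficient [B]. *)
  assert (Hwb : forall z, U z -> wirt (logdz psi) z (wz z) (- (RtoC c / 2) * F z)%C).
  { intros z Hz. destruct (Hw z Hz) as [B HB]. eapply wirt_eq; [reflexivity| |exact HB].
    rewrite <- (wirt_dzbar _ _ _ _ HB). rewrite <- (dzbar_ext_near (dz (fun w => RtoC (ln (psi w))))).
    - rewrite HPDE by auto. unfold F. rewrite RtoC_mult, RtoC_opp, RtoC_div by lra. reflexivity.
    - apply (near_imp z (fun w => U w /\ (Fz w / F w)%C = logdz psi w)); [|apply near_and; auto].
      intros w [Hu E]. rewrite <- E.
      rewrite (wirt_dz _ _ _ _ (wirt_of_partials _ _ _ _ (partials_ln psi w _ _ (Hpos w Hu) (partials_of_ex psi w (He w Hu))))).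
      unfold Fz, F. assert (Hn := Hnz w Hu). unfold F in Hn.
      rewrite !RtoC_div by (specialize (Hpos w Hu); lra). field. exact Hn. }
  exists Q. intros z Hz. 
  assert (cinv : ccont (fun w => / F w)%C z) by (apply ccont_inv; auto).
  assert (cq : ccont (fun w => Fz w / F w)%C z) by (apply ccont_mult; auto).
  split; [|split; [|split]].
  - assert (ca : forall g h : C -> R, ccont (fun w => RtoC (g w)) z -> ccont (fun w => RtoC (h w)) z ->
      ccont (fun w => (RtoC (g w) - Ci * RtoC (h w)) / 2)%C z).
    { intros g h Hg Hh. apply ccont_mult; [|apply ccont_const]. apply ccont_minus; auto.
      apply ccont_mult; [apply ccont_const|auto]. }
    assert (c1 : ccont a1 z) by (apply ca; apply ccont_RtoC; [now apply Hss|now apply Hst]).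
    assert (c2 : ccont b1 z) by (apply ca; apply ccont_RtoC; [now apply Hts|now apply Htt]).
    unfold Q, wz. apply ccont_minus.
    + apply ccont_minus.
      * apply ccont_mult; auto. apply ccont_mult; [apply ccont_const|]. apply ccont_minus; auto.
        apply ccont_mult; [apply ccont_const|auto].
      * apply ccont_mult; apply ccont_mult; auto.
    + apply ccont_mult; [|apply ccont_const]. apply ccont_mult; auto.
  - auto.
  - apply (ccont_ext_near (fun w => Fz w / F w)%C); auto.
  - assert (Elog : logdz psi z = (Fz z / F z)%C) by (symmetry; exact (near_self _ _ (Ew z Hz))).
    assert (Econj : Cconj (F z) = F z).
    { unfold F. apply injective_projections; simpl; ring. }
    assert (EFz : Cconj (Fz z) = ((RtoC (ps psi z) + Ci * RtoC (pt psi z)) / 2)%C).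
    { unfold Fz. apply injective_projections; simpl; field. }
    assert (HQ : wz z = (Q z + logdz psi z ^ 2 / 2)%C).
    { unfold Q. rewrite Elog. field. now apply Hnz. }
    split; [|split].
    + eapply wirt_eq; [| |apply HF; exact Hz].
      * rewrite Elog. fold (F z). field. now apply Hnz.
      * rewrite Elog, Cdiv_conj, EFz, Econj by now apply Hnz. fold (F z). field. now apply Hnz.
    + rewrite <- HQ. apply Hwb, Hz.
    + eapply wirt_eq; [| |apply wirt_conj, Hwb, Hz].
      * rewrite Cmult_conj, Econj. f_equal. apply injective_projections; simpl; field.
      * rewrite HQ, Cplus_conj. f_equal. simpl.
        rewrite Cdiv_conj by apply C2_nz. rewrite !Cmult_conj. f_equal; [f_equal; f_equal|]; apply injective_projections; simpl; ring.
Qed.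

(** If dP = Q dz - dw, then [P + w] has differential Q dz; since [Q] is continuous, it is the
    complex derivative of [P + w], hence holomorphic itself. *)
Lemma jet_Q_holo c U Q F w o : (forall z, U z -> near z U) ->
  (forall z, U z -> ccont Q z /\ ccont F z /\ ccont w z /\ ccont o z /\ liouville_jet c Q F w o z) ->
  forall z, U z -> holo_at Q z.
Proof.
  intros Uo HJ.
  assert (Hloc : forall z, U z -> near z (fun v => exists l, cder Q v l)); [|exact Hloc].
  intros z0 Hz0. destruct (near_box z0 U (Uo z0 Hz0)) as [r [Hr Hb]].
  set (k := (RtoC c / 2)%C).
  (* L ds + M dt is -(w^2/2) dz + k F dzbar, that is, Q dz - dw after substituting the derivatives
     of [w]. *)
  set (L := fun z => (k * F z - w z ^ 2 / 2)%C).
  set (M := fun z => (Ci * (- k * F z - w z ^ 2 / 2))%C).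
  set (Lz := fun z => (k * (F z * w z) - w z * (Q z + w z ^ 2 / 2))%C).
  set (Lb := fun z => (k * (F z * o z) + k * (w z * F z))%C).
  set (Mz := fun z => (Ci * (- k * (F z * w z) - w z * (Q z + w z ^ 2 / 2)))%C).
  set (Mb := fun z => (Ci * (- k * (F z * o z) + k * (w z * F z)))%C).
  assert (Hsq : forall z, U z -> wirt (fun z => w z ^ 2 / 2)%C z (w z * (Q z + w z ^ 2 / 2))%C (- (k * (w z * F z)))%C).
  { intros z Hz. destruct (HJ z Hz) as (_ & _ & _ & _ & _ & Jw & _).
    apply (wirt_ext_near (fun z => / 2 * (w z * w z))%C); [exists 1; split; [lra|]; intros; field|].
    eapply wirt_eq; [| |apply wirt_scal, wirt_mult; exact Jw]; unfold k; field. }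
  assert (HL : forall z, U z -> wirt L z (Lz z) (Lb z)).
  { intros z Hz. destruct (HJ z Hz) as (_ & _ & _ & _ & JF & _ & _).
    eapply wirt_eq; [| |apply wirt_minus; [apply (wirt_scal k), JF|now apply Hsq]]; unfold Lz, Lb; ring. }
  assert (HM : forall z, U z -> wirt M z (Mz z) (Mb z)).
  { intros z Hz. destruct (HJ z Hz) as (_ & _ & _ & _ & JF & _ & _).
    eapply wirt_eq; [| |apply (wirt_scal Ci), wirt_minus; [apply (wirt_scal (- k)), JF|now apply Hsq]];
    unfold Mz, Mb; ring. }
  assert (cw2 : forall z, U z -> ccont (fun z => w z ^ 2 / 2)%C z).
  { intros z Hz; destruct (HJ z Hz) as (_ & _ & Cw & _).
    apply (ccont_ext (fun z => w z * w z * / 2)%C); [intros; field|].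
    apply ccont_mult; [now apply ccont_mult|apply ccont_const]. }
  assert (cLM : forall z, U z -> ccont L z /\ ccont M z /\ ccont Lz z /\ ccont Lb z /\ ccont Mz z /\ ccont Mb z).
  { intros z Hz; destruct (HJ z Hz) as (CQ & CF & Cw & Co & _).
    assert (C2 := cw2 z Hz).
    assert (CFw : ccont (fun z => F z * w z)%C z) by now apply ccont_mult.
    assert (CwF : ccont (fun z => w z * F z)%C z) by now apply ccont_mult.
    assert (CFo : ccont (fun z => F z * o z)%C z) by now apply ccont_mult.
    assert (Cq2 : ccont (fun z => w z * (Q z + w z ^ 2 / 2))%C z).
    { apply ccont_mult; auto. apply (ccont_plus Q (fun z => w z ^ 2 / 2)%C); auto. }
    repeat split; unfold L, M, Lz, Lb, Mz, Mb; repeat apply (ccont_Cmult Ci);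
     first [apply (ccont_minus (fun z => _ * _)%C) | apply ccont_plus]; try apply ccont_Cmult; auto. }
  assert (frech : forall G Gz Gb, (forall z, U z -> wirt G z (Gz z) (Gb z)) ->
    (forall z, U z -> ccont Gz z) -> (forall z, U z -> ccont Gb z) ->
    forall z, U z -> frechet G z (Gz z + Gb z)%C (Ci * (Gz z - Gb z))%C).
  { intros G Gz Gb HG c1 c2 z Hz. destruct (Uo z Hz) as [d [Hd Hn]].
    apply (C1_frechet G (fun z => Gz z + Gb z)%C (fun z => Ci * (Gz z - Gb z))%C z d Hd).
    - intros v Hv; apply wirt_partials, HG, Hn, Hv.
    - apply ccont_plus; auto.
    - apply ccont_Cmult, ccont_minus; auto. }
  assert (Hclosed : forall z, U z -> closed_at L M z).
  { intros z Hz. exists (Lz z + Lb z)%C, (Ci * (Lz z - Lb z))%C, (Ci * (Mz z - Mb z))%C. split.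
    - apply frech; auto; intros; now apply cLM.
    (* This equality is L_t = M_s: the terms in [w * F] cancel, which is the formal computation
       Q_zbar = 0. *)
    - replace (Ci * (Lz z - Lb z))%C with (Mz z + Mb z)%C by (unfold Lz, Lb, Mz, Mb; ring).
      apply frech; auto; intros; now apply cLM. }
  destruct (exact_of_closed z0 r L M (fun z Hz => proj1 (cLM z (Hb z Hz)))
    (fun z Hz => proj1 (proj2 (cLM z (Hb z Hz)))) z0) as [P HP].
  { apply box_Cmod; auto; now rewrite Cmod_diag. }
  { intros z Hz _; auto. }
  assert (HPw : forall z, box z0 r z -> partials (fun z => P z + w z)%C z (Q z) (Ci * Q z)%C).
  { intros z Hz. destruct (HP z Hz) as [P1 P2]. destruct (HJ z (Hb z Hz)) as (_ & _ & _ & _ & _ & [W1 W2] & _).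
    split.
    - eapply der_eq; [|apply der_plus; [exact P1|exact W1]]. unfold L, k; ring.
    - eapply der_eq; [|apply der_plus; [exact P2|exact W2]]. unfold M, k; ring. }
  assert (HPQ : forall z, box z0 r z -> cder (fun z => P z + w z)%C z (Q z)).
  { intros z Hz. destruct (box_open z0 r z Hz) as [d [Hd Hn]].
    apply (C1_cder _ Q z d Hd); auto. apply (HJ z (Hb z Hz)). }
  exists r; split; auto. intros v Hv. assert (Bv : box z0 r v) by now apply box_Cmod.
  destruct (box_open z0 r v Bv) as [d [Hd Hn]].
  apply (holo_deriv (fun z => P z + w z)%C Q v (d / 2)); [lra|].
  intros u [H1 H2]; apply HPQ, Hn. eapply Rle_lt_trans; [apply Cmod_re_im|].
  change (Re (u - v)%C) with (Re u - Re v). change (Im (u - v)%C) with (Im u - Im v). lra.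
Qed.

(** * Uniqueness for the Cauchy problem *)

Lemma interval_oo_open lo hi s : interval_oo lo hi s ->
  exists d, 0 < d /\ forall s', Rabs (s' - s) < d -> interval_oo lo hi s'.
Proof.
  intros [H1 H2].
  assert (D1 : exists d, 0 < d /\ forall s', Rabs (s' - s) < d -> Rbar_lt lo s').
  { destruct lo as [l| |]; simpl in *; try easy.
    - exists (s - l); split; [lra|]; intros s' Hs; apply Rabs_def2 in Hs; lra.
    - exists 1; split; [lra|auto]. }
  assert (D2 : exists d, 0 < d /\ forall s', Rabs (s' - s) < d -> Rbar_lt s' hi).
  { destruct hi as [h| |]; simpl in *; try easy.
    - exists (h - s); split; [lra|]; intros s' Hs; apply Rabs_def2 in Hs; lra.
    - exists 1; split; [lra|auto]. }
  destruct D1 as [d [Hd D1]], D2 as [e [He D2]]. exists (Rmin d e); split; [now apply Rmin_pos|].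
  intros s' Hs; apply Rlt_Rmin in Hs as [Hs1 Hs2]; split; auto.
Qed.

Lemma interval_oo_nonempty lo hi : Rbar_lt lo hi -> exists s, interval_oo lo hi s.
Proof.
  destruct lo as [l| |], hi as [h| |]; simpl; try easy; intros H.
  - exists ((l + h) / 2); split; simpl; lra.
  - exists (l + 1); split; simpl; auto; lra.
  - exists (h - 1); split; simpl; auto; lra.
  - exists 0; split; simpl; auto.
Qed.

Lemma interval_oo_convex lo hi s1 s2 s : interval_oo lo hi s1 -> interval_oo lo hi s2 ->
  Rmin s1 s2 <= s <= Rmax s1 s2 -> interval_oo lo hi s.
Proof.
  intros [H1 H2] [H3 H4] Hs; destruct lo as [l| |], hi as [h| |]; split; simpl in *; try easy;
    revert Hs; unfold Rmin, Rmax; destruct (Rle_dec s1 s2); lra.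
Qed.

Lemma cauchy_solution_jet c I a b U psi : cauchy_solution c I a b U psi ->
  exists Q, (forall z, U z -> holo_at Q z /\
    liouville_jet c Q (fun w => RtoC (psi w)) (logdz psi) (fun w => Cconj (logdz psi w)) z) /\
   forall s, I s -> psi (RtoC s) = a s /\ logdz psi (RtoC s) = b_over_a a b s.
Proof.
  intros (Uo & UI & HC2 & Hpos & HPDE & HI). rewrite open_near in Uo.
  destruct (solution_jet c U psi Uo HC2 Hpos HPDE) as [Q HQ].
  exists Q; split.
  - intros z Hz; split; [|now apply HQ].
    apply (jet_Q_holo c U Q (fun w => RtoC (psi w)) (logdz psi) (fun w => Cconj (logdz psi w))); auto.
    intros v Hv; destruct (HQ v Hv) as (H1 & H2 & H3 & H4). repeat split; auto; try apply H4. now apply ccont_conj.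
  - intros s Hs; destruct (HI s Hs) as [E1 E2]; split; auto. unfold logdz, b_over_a. now rewrite E1, E2.
Qed.

(** On the axis (b/a)' = Q + (b/a)^2/2 - (c/2) a holds for both solutions, so their [Q] agree there,
    then on all of [V]; the jets agree at a point of the axis, hence on [V]. *)
Lemma cauchy_solution_unique c lo hi a b U psi U' psi' V : Rbar_lt lo hi ->
  cauchy_solution c (interval_oo lo hi) a b U psi ->
  cauchy_solution c (interval_oo lo hi) a b U' psi' ->
  connected_open V -> (forall s, interval_oo lo hi s -> V (RtoC s)) ->
  (forall z, V z -> U z /\ U' z) -> forall z, V z -> psi z = psi' z.
Proof.
  intros Hlh HS HS' HV HI HUV.
  destruct (cauchy_solution_jet _ _ _ _ _ _ HS) as [Q [HJ HA]].
  destruct (cauchy_solution_jet _ _ _ _ _ _ HS') as [Q' [HJ' HA']].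
  destruct (interval_oo_nonempty lo hi Hlh) as [s0 Hs0].
  assert (HQaxis : forall s, interval_oo lo hi s -> Q (RtoC s) = Q' (RtoC s)).
  { intros s Hs.
    destruct (HUV _ (HI s Hs)) as [Us Us'].
    destruct (HJ _ Us) as (_ & _ & [J _] & _). destruct (HJ' _ Us') as (_ & _ & [J' _] & _).
    destruct (interval_oo_open lo hi s Hs) as [d [Hd Hn]].
    destruct (HA s Hs) as [E1 E2]. destruct (HA' s Hs) as [E1' E2'].
    assert (E := rder_unique _ _ _ _ (der_ext_loc RtoC (fun t => logdz psi (t, 0)) (fun t => logdz psi' (t, 0)) s _ d Hd
       (fun t Ht => eq_trans (proj2 (HA t (Hn t ltac:(rewrite Cmod_RtoC_minus in Ht; exact Ht))))
                             (eq_sym (proj2 (HA' t (Hn t ltac:(rewrite Cmod_RtoC_minus in Ht; exact Ht)))))) J) J').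
    cbv beta in E. rewrite E1, E2, E1', E2' in E.
    apply Ceq_minus in E. apply Ceq_minus. rewrite <- E. ring. }
  assert (HQ : forall z, V z -> Q z = Q' z).
  { intros z Hz. apply Ceq_minus.
    apply (identity_theorem V (fun z => Q z - Q' z)%C); auto.
    - intros v Hv; destruct (HUV v Hv) as [Uv Uv']. apply holo_at_minus; [apply HJ|apply HJ']; auto.
    - exists (RtoC s0); split; [now apply HI|].
      destruct (HUV _ (HI s0 Hs0)) as [Us Us'].
      apply holo_zero_real; [apply holo_at_minus; [apply HJ|apply HJ']; auto|].
      destruct (interval_oo_open lo hi s0 Hs0) as [d [Hd Hn]].
      exists d; split; auto. intros s Hs _. apply (proj1 (Ceq_minus _ _)), HQaxis, Hn, Hs. }
  intros z Hz. apply RtoC_inj.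
  apply (jet_unique_connected c Q V (fun w => RtoC (psi w)) (logdz psi) (fun w => Cconj (logdz psi w))
    (fun w => RtoC (psi' w)) (logdz psi') (fun w => Cconj (logdz psi' w)) HV); auto.
  - intros v Hv; apply HJ, HUV, Hv.
  - intros v Hv. destruct (HUV v Hv) as [_ Uv']. destruct (HJ' v Uv') as (_ & J1 & J2 & J3).
    rewrite <- (HQ v Hv) in J2, J3. repeat split; assumption || apply J1 || apply J2 || apply J3.
  - exists (RtoC s0). destruct (HA s0 Hs0) as [E1 E2]. destruct (HA' s0 Hs0) as [E1' E2'].
    rewrite E1, E2, E1', E2'. repeat split; auto.
Qed.

(** * Holomorphic extension of real analytic functions *)

Definition CSeries (v : nat -> C) : C := (Series (fun n => Re (v n)), Series (fun n => Im (v n))).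
Definition abs_summable (v : nat -> C) : Prop := ex_series (fun n => Cmod (v n)).

Lemma ex_series_dom (a b : nat -> R) : (forall n, Rabs (a n) <= b n) -> ex_series b -> ex_series a.
Proof. exact (ex_series_le (K := R_AbsRing) (V := R_CompleteNormedModule) a b). Qed.

Lemma abs_summable_parts v : abs_summable v ->
  ex_series (fun n => Re (v n)) /\ ex_series (fun n => Im (v n)).
Proof.
  intros H; split; eapply ex_series_dom; try exact H; intros n; [apply re_le_Cmod|apply im_le_Cmod].
Qed.

Lemma CSeries_minus v w : abs_summable v -> abs_summable w ->
  CSeries (fun n => v n - w n)%C = (CSeries v - CSeries w)%C.
Proof.
  intros Hv Hw. destruct (abs_summable_parts v Hv), (abs_summable_parts w Hw).
  apply injective_projections.
  - exact (Series_minus (fun n => Re (v n)) (fun n => Re (w n)) ltac:(assumption) ltac:(assumption)).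
  - exact (Series_minus (fun n => Im (v n)) (fun n => Im (w n)) ltac:(assumption) ltac:(assumption)).
Qed.

Lemma CSeries_scal v k : abs_summable v -> CSeries (fun n => v n * k)%C = (CSeries v * k)%C.
Proof.
  intros Hv. destruct (abs_summable_parts v Hv) as [H1 H2]. apply injective_projections.
  - change (Series (fun n => Re (v n) * Re k - Im (v n) * Im k) =
      Series (fun n => Re (v n)) * Re k - Series (fun n => Im (v n)) * Im k).
    rewrite <- !Series_scal_r. apply Series_minus; now apply ex_series_scal_r.
  - change (Series (fun n => Re (v n) * Im k + Im (v n) * Re k) =
      Series (fun n => Re (v n)) * Im k + Series (fun n => Im (v n)) * Re k).
    rewrite <- !Series_scal_r. apply Series_plus; now apply ex_series_scal_r.
Qed.

Lemma CSeries_bound v : abs_summable v -> Cmod (CSeries v) <= 2 * Series (fun n => Cmod (v n)).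
Proof.
  intros Hv. eapply Rle_trans; [apply Cmod_re_im|]. simpl.
  assert (H : forall f : C -> R, (forall z, Rabs (f z) <= Cmod z) ->
    Rabs (Series (fun n => f (v n))) <= Series (fun n => Cmod (v n))).
  { intros f Hf. eapply Rle_trans; [apply Series_Rabs|apply Series_le; auto].
    - eapply ex_series_dom; [|exact Hv]. intros n; rewrite Rabs_Rabsolu; apply Hf.
    - intros n; split; [apply Rabs_pos|apply Hf]. }
  generalize (H Re re_le_Cmod) (H Im im_le_Cmod). unfold Re, Im; simpl; lra.
Qed.

(** The remainder is a polynomial in [z] and [h] with nonnegative coefficients, so its modulus is at
    most its value at the moduli. The induction uses the recursion that the complex and the real
    remainders share. *)
Lemma pow_remainder_bound (z h : C) n :
  Cmod ((z + h) ^ n - z ^ n - RtoC (INR n) * z ^ pred n * h)%C <=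
  (Cmod z + Cmod h) ^ n - Cmod z ^ n - INR n * Cmod z ^ pred n * Cmod h.
Proof.
  induction n as [|n IH].
  - simpl. replace (1 - 1 - 0 * 1 * h)%C with (RtoC 0) by ring. rewrite Cmod_0; lra.
  - assert (EC : ((z + h) ^ S n - z ^ S n - RtoC (INR (S n)) * z ^ pred (S n) * h)%C =
      ((z + h) * ((z + h) ^ n - z ^ n - RtoC (INR n) * z ^ pred n * h) + RtoC (INR n) * z ^ pred n * h * h)%C).
    { rewrite S_INR, RtoC_plus. destruct n; simpl; ring. }
    set (a := Cmod z) in *. set (b := Cmod h) in *.
    assert (ER : (a + b) ^ S n - a ^ S n - INR (S n) * a ^ pred (S n) * b =
      (a + b) * ((a + b) ^ n - a ^ n - INR n * a ^ pred n * b) + INR n * a ^ pred n * b * b).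
    { rewrite S_INR. destruct n; simpl; ring. }
    rewrite EC, ER. apply Cmod_le_plus.
    + rewrite Cmod_mult. apply Rmult_le_compat; try apply Cmod_ge_0; auto. apply Cmod_triangle.
    + rewrite !Cmod_mult, Cmod_pow, Cmod_R, Rabs_right by (apply Rle_ge, pos_INR). unfold a, b; lra.
Qed.

Section PowerSeries.
Variable (u : nat -> C).
Let A := fun n => Cmod (u n).

Lemma abs_summable_power z : Rbar_lt (Cmod z) (CV_radius A) -> abs_summable (fun n => u n * z ^ n)%C.
Proof.
  intros H. apply (ex_series_ext (fun n => Rabs (A n * Cmod z ^ n))).
  - intros n. rewrite Cmod_mult, Cmod_pow, Rabs_right; [reflexivity|].
    apply Rle_ge, Rmult_le_pos; [apply Cmod_ge_0|apply pow_le, Cmod_ge_0].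
  - apply CV_disk_inside. rewrite Rabs_right; [exact H|apply Rle_ge, Cmod_ge_0].
Qed.

Lemma ex_series_derive t : 0 <= t -> Rbar_lt t (CV_radius A) ->
  ex_series (fun n => A n * (INR n * t ^ pred n)) /\
  Series (fun n => A n * (INR n * t ^ pred n)) = PSeries (PS_derive A) t.
Proof.
  intros Ht H.
  assert (Hex : ex_series (fun k => PS_derive A k * t ^ k)).
  { apply ex_series_Rabs, CV_disk_inside. rewrite CV_radius_derive, Rabs_right; [exact H|lra]. }
  assert (Hs : ex_series (fun k => A (S k) * (INR (S k) * t ^ pred (S k)))).
  { eapply ex_series_ext; [|exact Hex]. intros n; unfold PS_derive; simpl pred.
    match goal with |- ?p = ?q => change (@eq R p q) end. ring. }
  assert (Hex' : ex_series (fun n => A n * (INR n * t ^ pred n))) by (now apply ex_series_incr_1).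
  split; auto. rewrite Series_incr_1 by auto. simpl INR at 1. rewrite Rmult_0_l, Rmult_0_r, Rplus_0_l.
  apply Series_ext. intros n; unfold PS_derive; simpl pred; ring.
Qed.

(** By [pow_remainder_bound] the complex first-order remainder at [z] is dominated term by term by
    the real remainder of the series with coefficients |u n| at |z|, with increment |h|. That one is
    small because real power series are differentiable. *)
Lemma cder_power_series z : Rbar_lt (Cmod z) (CV_radius A) ->
  cder (fun w => CSeries (fun n => u n * w ^ n)%C) z (CSeries (fun n => u n * (RtoC (INR n) * z ^ pred n))%C).
Proof.
  intros Hz eps He.
  set (t := Cmod z) in *. assert (Ht : 0 <= t) by apply Cmod_ge_0.
  assert (HR : exists rr, t < rr /\ Rbar_lt rr (CV_radius A)).
  { destruct (CV_radius A) as [x| |]; simpl in *; try easy.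
    - exists ((t + x) / 2); split; simpl; lra.
    - exists (t + 1); split; auto; lra. }
  destruct HR as [rr [Hr1 Hr2]].
  assert (Hlt : forall y, y <= rr -> Rbar_lt y (CV_radius A)).
  { intros y Hy. eapply Rbar_le_lt_trans; [|exact Hr2]. exact Hy. }
  assert (Hd : rder (fun y => RtoC (PSeries A y)) t (RtoC (PSeries (PS_derive A) t))).
  { apply rder_RtoC, is_derive_PSeries. rewrite Rabs_right; [exact Hz|lra]. }
  destruct (Hd (eps / 2)) as [d [Hd0 Hdd]]; [lra|].
  exists (Rmin d (rr - t)); split; [apply Rmin_pos; lra|].
  intros w Hw; cbv beta in *. set (h := (w - z)%C) in *.
  apply Rlt_Rmin in Hw as [Hw1 Hw2].
  replace w with (z + h)%C by (unfold h; ring).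
  set (b := Cmod h) in *. assert (Hb : 0 <= b) by apply Cmod_ge_0.
  assert (Hzh : Cmod (z + h)%C <= rr) by (eapply Rle_trans; [apply Cmod_triangle|]; fold t b; lra).
  destruct (ex_series_derive t Ht (Hlt t ltac:(lra))) as [X1 X2].
  assert (S1 := abs_summable_power (z + h)%C (Hlt _ Hzh)).
  assert (S2 := abs_summable_power z Hz).
  assert (S3 : abs_summable (fun n => u n * (RtoC (INR n) * z ^ pred n))%C).
  { eapply ex_series_ext; [|exact X1]. intros n. rewrite !Cmod_mult, Cmod_pow, Cmod_R.
    rewrite (Rabs_right (INR n)) by (apply Rle_ge, pos_INR). reflexivity. }
  assert (S3h : abs_summable (fun n => u n * (RtoC (INR n) * z ^ pred n) * h)%C).
  { eapply ex_series_ext; [|apply (ex_series_scal_r b), S3]. intros n. now rewrite (Cmod_mult _ h). }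
  assert (S12 : abs_summable (fun n => u n * (z + h) ^ n - u n * z ^ n)%C).
  { eapply ex_series_dom; [|apply (ex_series_plus (V := R_NormedModule)); [exact S1|exact S2]].
    intros n. rewrite Rabs_right by (apply Rle_ge, Cmod_ge_0).
    change (Cmod (u n * (z + h) ^ n - u n * z ^ n)%C <= Cmod (u n * (z + h) ^ n)%C + Cmod (u n * z ^ n)%C).
    unfold Cminus; eapply Rle_trans; [apply Cmod_triangle|]. rewrite Cmod_opp; lra. }
  rewrite <- CSeries_scal, <- !CSeries_minus by assumption.
  assert (Z1 : ex_series (fun n => A n * (t + b) ^ n)).
  { apply ex_series_Rabs, CV_disk_inside. rewrite Rabs_right by lra. apply Hlt; lra. }
  assert (Z2 : ex_series (fun n => A n * t ^ n)).
  { apply ex_series_Rabs, CV_disk_inside. rewrite Rabs_right by lra. apply Hlt; lra. }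
  assert (Z3 := ex_series_scal_r b _ X1).
  assert (Z12 := ex_series_minus (V := R_NormedModule) _ _ Z1 Z2).
  assert (Z := ex_series_minus (V := R_NormedModule) _ _ Z12 Z3).
  assert (Hterm : forall n, Cmod (u n * (z + h) ^ n - u n * z ^ n - u n * (RtoC (INR n) * z ^ pred n) * h)%C <=
     A n * (t + b) ^ n - A n * t ^ n - A n * (INR n * t ^ pred n) * b).
  { intros n.
    replace (u n * (z + h) ^ n - u n * z ^ n - u n * (RtoC (INR n) * z ^ pred n) * h)%C with
     (u n * ((z + h) ^ n - z ^ n - RtoC (INR n) * z ^ pred n * h))%C by ring.
    rewrite Cmod_mult. fold (A n).
    replace (A n * (t + b) ^ n - A n * t ^ n - A n * (INR n * t ^ pred n) * b) with
     (A n * ((t + b) ^ n - t ^ n - INR n * t ^ pred n * b)) by ring.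
    apply Rmult_le_compat_l; [apply Cmod_ge_0|apply pow_remainder_bound]. }
  eapply Rle_trans; [apply CSeries_bound|].
  { eapply ex_series_dom; [|exact Z]. intros n. rewrite Rabs_right by (apply Rle_ge, Cmod_ge_0). apply Hterm. }
  replace (eps * b) with (2 * (eps / 2 * b)) by field.
  apply Rmult_le_compat_l; [lra|].
  eapply Rle_trans; [apply Series_le; [intros n; split; [apply Cmod_ge_0|apply Hterm]|exact Z]|].
  rewrite Series_minus by assumption. rewrite Series_minus by assumption.
  rewrite Series_scal_r, X2.
  specialize (Hdd (t + b)). rewrite Cmod_RtoC_minus in Hdd.
  replace (t + b - t) with b in Hdd by ring. rewrite (Rabs_right b) in Hdd by lra.
  specialize (Hdd Hw1). rewrite <- !RtoC_minus, <- RtoC_mult, <- RtoC_minus, Cmod_R in Hdd.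
  eapply Rle_trans; [|exact Hdd]. eapply Rle_trans; [|apply Rle_abs].
  right. unfold PSeries. replace (t + b - t) with b by ring. ring.
Qed.
End PowerSeries.

Lemma is_series_parts (v : nat -> C) (l : C) : is_series (V := C_R_NormedModule) v l ->
  is_series (fun n => Re (v n)) (Re l) /\ is_series (fun n => Im (v n)) (Im l).
Proof.
  assert (E : forall n, sum_n (G := C_R_NormedModule) v n =
     (sum_n (fun n => Re (v n)) n, sum_n (fun n => Im (v n)) n)).
  { induction n.
    - now rewrite !sum_O, <- C_eta_re_im.
    - rewrite !sum_Sn, IHn. apply injective_projections; reflexivity. }
  intros H; destruct l as [p q]. split.
  - apply (filterlim_ext (fun n => fst (sum_n (G := C_R_NormedModule) v n))); [intros n; now rewrite E|].
    eapply filterlim_comp; [exact H|]. exact (continuous_fst (U := R_UniformSpace) (V := R_UniformSpace) p q).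
  - apply (filterlim_ext (fun n => snd (sum_n (G := C_R_NormedModule) v n))); [intros n; now rewrite E|].
    eapply filterlim_comp; [exact H|]. exact (continuous_snd (U := R_UniformSpace) (V := R_UniformSpace) p q).
Qed.

Lemma ex_series_radius (a : nat -> R) (x : R) : 0 <= x -> ex_series (fun n => a n * x ^ n) ->
  Rbar_le x (CV_radius a).
Proof.
  intros Hx H. apply Rbar_not_lt_le. intros Hlt.
  apply (CV_disk_outside a x); [rewrite Rabs_right; [exact Hlt|lra]|]. now apply ex_series_lim_0.
Qed.

Lemma analytic_extension (f : R -> C) s0 (u : nat -> C) :
  locally s0 (fun s => is_pseries (V := C_R_NormedModule) u (s - s0) (f s)) ->
  exists F, holo_at F (RtoC s0) /\ exists d, 0 < d /\ forall s, Rabs (s - s0) < d -> F (RtoC s) = f s.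
Proof.
  intros [d Hd].
  assert (Hser : forall x, Rabs x < d ->
     is_series (fun n => Re (u n * RtoC x ^ n)%C) (Re (f (s0 + x))) /\
     is_series (fun n => Im (u n * RtoC x ^ n)%C) (Im (f (s0 + x)))).
  { intros x Hx. apply is_series_parts.
    specialize (Hd (s0 + x)). replace (s0 + x - s0) with x in Hd by ring.
    apply (is_series_ext (V := C_R_NormedModule) (fun n => scal (V := C_R_NormedModule) (pow_n (K := R_AbsRing) x n) (u n))); [|apply Hd].
    - intros n. rewrite scal_R_Cmult, Cmult_comm. f_equal. rewrite <- RtoC_pow. f_equal.
    - change (Rabs (s0 + x - s0) < d). now replace (s0 + x - s0) with x by ring. }
  assert (Eterm : forall x n, Re (u n * RtoC x ^ n)%C = Re (u n) * x ^ n /\ Im (u n * RtoC x ^ n)%C = Im (u n) * x ^ n).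
  { intros x n. rewrite <- RtoC_pow. now rewrite re_scal_r, im_scal_r. }
  (* Convergence at [x] only bounds the radii of the real and imaginary series from below by [x]; at
     the smaller [y] both converge absolutely, and so does the series of moduli. *)
  set (x := d / 2). set (y := d / 4). assert (Hd0 := cond_pos d).
  assert (Hx : Rabs x < d) by (unfold x; rewrite Rabs_right; lra).
  destruct (Hser x Hx) as [H1 H2].
  assert (R1 : Rbar_le x (CV_radius (fun n => Re (u n)))).
  { apply ex_series_radius; [unfold x; lra|]. eexists. eapply is_series_ext; [|exact H1]. intros n; apply Eterm. }
  assert (R2 : Rbar_le x (CV_radius (fun n => Im (u n)))).
  { apply ex_series_radius; [unfold x; lra|]. eexists. eapply is_series_ext; [|exact H2]. intros n; apply Eterm. }
  assert (Hyx : y < x) by (unfold x, y; lra). assert (Hy0 : 0 <= y) by (unfold y; lra).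
  assert (RA : Rbar_le y (CV_radius (fun n => Cmod (u n)))).
  { apply ex_series_radius; auto.
    eapply ex_series_dom; [|apply (ex_series_plus (V := R_NormedModule));
      [apply (CV_disk_inside (fun n => Re (u n)) y)|apply (CV_disk_inside (fun n => Im (u n)) y)]].
    - intros n. cbv beta. rewrite !Rabs_mult, (Rabs_right (Cmod _)) by (apply Rle_ge, Cmod_ge_0).
      change (Cmod (u n) * Rabs (y ^ n) <= Rabs (Re (u n)) * Rabs (y ^ n) + Rabs (Im (u n)) * Rabs (y ^ n)).
      rewrite <- Rmult_plus_distr_r. apply Rmult_le_compat_r; [apply Rabs_pos|apply Cmod_re_im].
    - rewrite Rabs_right by lra. eapply Rbar_lt_le_trans; [|exact R1]. exact Hyx.
    - rewrite Rabs_right by lra. eapply Rbar_lt_le_trans; [|exact R2]. exact Hyx. }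
  exists (fun w => CSeries (fun n => u n * (w - RtoC s0) ^ n)%C). split.
  - exists y; split; [unfold y; lra|]. intros w Hw. eexists.
    apply (der_comp (fun z => z) (fun w => w - RtoC s0)%C (fun w => CSeries (fun n => u n * w ^ n)%C)).
    + apply cder_power_series. eapply Rbar_lt_le_trans; [|exact RA]. exact Hw.
    + apply der_minus; [apply der_id|apply der_const].
  - exists d; split; auto. intros s Hs. rewrite <- RtoC_minus.
    destruct (Hser (s - s0) Hs) as [G1 G2]. replace (s0 + (s - s0)) with s in * by ring.
    unfold CSeries. rewrite (is_series_unique _ _ G1), (is_series_unique _ _ G2). now destruct (f s).
Qed.

Lemma real_analytic_extension (I : R -> Prop) (f : R -> C) s0 :
  real_analytic_on (V := C_R_NormedModule) I f -> I s0 ->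
  exists F, holo_at F (RtoC s0) /\ exists d, 0 < d /\ forall s, Rabs (s - s0) < d -> F (RtoC s) = f s.
Proof. intros H Hs; destruct (H s0 Hs) as [u Hu]; now apply (analytic_extension f s0 u). Qed.

Lemma real_analytic_RtoC (I : R -> Prop) (f : R -> R) :
  real_analytic_on (V := R_NormedModule) I f -> real_analytic_on (V := C_R_NormedModule) I (fun s => RtoC (f s)).
Proof.
  intros H s0 Hs; destruct (H s0 Hs) as [u Hu]. exists (fun n => RtoC (u n)).
  eapply filter_imp; [|exact Hu]. intros s Hsum.
  unfold is_pseries, is_series in *.
  apply (filterlim_ext (fun n => RtoC (sum_n (fun k => scal (pow_n (s - s0) k) (u k)) n))).
  - intros n. induction n; [rewrite !sum_O|rewrite !sum_Sn, <- IHn].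
    + rewrite scal_R_Cmult, <- RtoC_mult. reflexivity.
    + rewrite scal_R_Cmult, <- RtoC_mult. change plus with Cplus at 2. rewrite <- RtoC_plus. reflexivity.
  - eapply filterlim_comp; [exact Hsum|].
    intros P [e HP]. exists e. intros y Hy. apply HP. split; [exact Hy|apply ball_center].
Qed.

(** * The Liouville formula and the Schwarzian *)

(** The Liouville expression with conj(R) replaced by an arbitrary antiholomorphic [r0], of
    zbar-derivative [r1]; this makes it symmetric in the two functions. *)
Definition formula (c : R) (S1 r1 S r0 : C -> C) (z : C) : C :=
  (4 * S1 z * r1 z / ((1 + RtoC c * S z * r0 z) * (1 + RtoC c * S z * r0 z)))%C.
(** The [z]-derivative of the logarithm of [formula]; exchanging the roles of [S] and [r0] gives the
    zbar-derivative. *)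
Definition formula_w (c : R) (S S1 S2 r0 : C -> C) (z : C) : C :=
  (S2 z / S1 z - 2 * RtoC c * S1 z * r0 z / (1 + RtoC c * S z * r0 z))%C.

Ltac wirt_tac := repeat first
  [ eassumption | apply wirt_const | apply wirt_minus | apply wirt_plus | apply wirt_div | apply wirt_mult ].

Section FormulaJet.
Variables (c : R) (S S1 S2 r0 r1 r2 : C -> C) (s3 t3 z : C).
Hypothesis (hS : wirt S z (S1 z) (RtoC 0)) (hS1 : wirt S1 z (S2 z) (RtoC 0)) (hS2 : wirt S2 z s3 (RtoC 0)).
Hypothesis (hr : wirt r0 z (RtoC 0) (r1 z)) (hr1 : wirt r1 z (RtoC 0) (r2 z)) (hr2 : wirt r2 z (RtoC 0) t3).
Hypothesis (nS : S1 z <> RtoC 0) (nr : r1 z <> RtoC 0) (nd : (1 + RtoC c * S z * r0 z)%C <> RtoC 0).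

Lemma formula_wirt : wirt (formula c S1 r1 S r0) z
  (formula c S1 r1 S r0 z * formula_w c S S1 S2 r0 z)%C
  (formula c S1 r1 S r0 z * formula_w c r0 r1 r2 S z)%C.
Proof.
  assert (nd' : (1 + RtoC c * r0 z * S z)%C <> RtoC 0).
  { replace (1 + RtoC c * r0 z * S z)%C with (1 + RtoC c * S z * r0 z)%C by ring. exact nd. }
  eapply wirt_eq; [| |unfold formula; wirt_tac]; cbv beta; unfold formula, formula_w.
  - field. auto.
  - field. auto.
  - now apply Cmult_neq_0.
Qed.

(** The terms with [r0] in the [z]-derivative complete a square, so the [Q] of the formula is the
    Schwarzian of [S] alone; the zbar-derivative sees only [r0]. *)
Lemma formula_w_wirt : wirt (formula_w c S S1 S2 r0) z
  (s3 / S1 z - 3 / 2 * (S2 z / S1 z) ^ 2 + formula_w c S S1 S2 r0 z ^ 2 / 2)%C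
  (- (RtoC c / 2) * formula c S1 r1 S r0 z)%C.
Proof.
  eapply wirt_eq; [| |unfold formula_w; wirt_tac]; cbv beta; unfold formula, formula_w; auto.
  - field. auto.
  - field. auto.
Qed.
Lemma formula_wbar_wirt : wirt (formula_w c r0 r1 r2 S) z
  (- (RtoC c / 2) * formula c S1 r1 S r0 z)%C
  (t3 / r1 z - 3 / 2 * (r2 z / r1 z) ^ 2 + formula_w c r0 r1 r2 S z ^ 2 / 2)%C.
Proof.
  assert (nd' : (1 + RtoC c * r0 z * S z)%C <> RtoC 0).
  { replace (1 + RtoC c * r0 z * S z)%C with (1 + RtoC c * S z * r0 z)%C by ring. exact nd. }
  eapply wirt_eq; [| |unfold formula_w; wirt_tac]; cbv beta; unfold formula, formula_w; auto.
  - field. auto.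
  - field. auto.
Qed.
End FormulaJet.

(** * Germs on the real axis, with and without the centre *)

Definition rloc (s : R) (P : R -> Prop) : Prop := exists d, 0 < d /\ forall s', Rabs (s' - s) < d -> P s'.
Definition rpunct (s : R) (P : R -> Prop) : Prop :=
  exists d, 0 < d /\ forall s', Rabs (s' - s) < d -> s' <> s -> P s'.

Lemma near_rloc s P : near (RtoC s) P -> rloc s (fun t => P (RtoC t)).
Proof. intros [d [Hd H]]; exists d; split; auto. intros t Ht; apply H; now rewrite Cmod_RtoC_minus. Qed.

Lemma rloc_and s P Q : rloc s P -> rloc s Q -> rloc s (fun t => P t /\ Q t).
Proof.
  intros [d [Hd H]] [e [He H']]; exists (Rmin d e); split; [now apply Rmin_pos|].
  intros t Ht; apply Rlt_Rmin in Ht as [Ht1 Ht2]; auto.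
Qed.
Lemma rpunct_and s P Q : rpunct s P -> rpunct s Q -> rpunct s (fun t => P t /\ Q t).
Proof.
  intros [d [Hd H]] [e [He H']]; exists (Rmin d e); split; [now apply Rmin_pos|].
  intros t Ht Hne; apply Rlt_Rmin in Ht as [Ht1 Ht2]; auto.
Qed.
Lemma rloc_imp s (P Q : R -> Prop) : (forall t, P t -> Q t) -> rloc s P -> rloc s Q.
Proof. intros H [d [Hd H']]; exists d; split; auto. Qed.
Lemma rpunct_imp s (P Q : R -> Prop) : (forall t, P t -> Q t) -> rpunct s P -> rpunct s Q.
Proof. intros H [d [Hd H']]; exists d; split; auto. Qed.
Lemma rloc_rpunct s P : rloc s P -> rpunct s P.
Proof. intros [d [Hd H]]; exists d; split; auto. Qed.
Lemma rloc_self s (P : R -> Prop) : rloc s P -> P s.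
Proof. intros [d [Hd H]]; apply H. rewrite Rminus_diag, Rabs_R0; auto. Qed.
Lemma rloc_rloc s P : rloc s P -> rloc s (fun t => rloc t P).
Proof.
  intros [d [Hd H]]; exists d; split; auto. intros t Ht. exists (d - Rabs (t - s)); split; [lra|].
  intros u Hu; apply H. replace (u - s) with ((u - t) + (t - s)) by ring.
  eapply Rle_lt_trans; [apply Rabs_triang|]; lra.
Qed.
Lemma rpunct_rloc s P : rpunct s P -> rpunct s (fun t => rloc t P).
Proof.
  intros [d [Hd H]]; exists d; split; auto. intros t Ht Hne.
  exists (Rmin (d - Rabs (t - s)) (Rabs (t - s))); split.
  - apply Rmin_pos; [lra|apply Rabs_pos_lt; lra].
  - intros u Hu; apply H.
    + replace (u - s) with ((u - t) + (t - s)) by ring.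
      eapply Rle_lt_trans; [apply Rabs_triang|].
      generalize (Rlt_le_trans _ _ _ Hu (Rmin_l _ _)); lra.
    + intros ->. generalize (Rlt_le_trans _ _ _ Hu (Rmin_r _ _)). rewrite Rabs_minus_sym; lra.
Qed.
Lemma rpunct_ex s P : rpunct s P -> exists t, t <> s /\ P t.
Proof.
  intros [d [Hd H]]; exists (s + d / 2). split; [lra|]. apply H; [|lra].
  replace (s + d / 2 - s) with (d / 2) by ring. rewrite Rabs_right; lra.
Qed.
Lemma rpunct_locally' s P : locally' (T := R_UniformSpace) s P <-> rpunct s P.
Proof.
  split.
  - intros [d H]; exists d; split; [apply cond_pos|]. intros t Ht Hne; apply H; auto.
  - intros [d [Hd H]]; exists (mkposreal d Hd). intros t Ht Hne; now apply H.
Qed.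

Lemma cder_rder f s l : cder f (RtoC s) l -> rder (fun t => f (RtoC t)) s l.
Proof.
  intros H; eapply der_eq; [|apply (der_comp RtoC RtoC f); [exact H|apply der_id]]. ring.
Qed.

Lemma rder_ext_rloc f g s l : rloc s (fun t => f t = g t) -> rder f s l -> rder g s l.
Proof.
  intros [d [Hd H]]. apply der_ext_loc with d; auto. intros y Hy; apply H; now rewrite <- Cmod_RtoC_minus.
Qed.

Lemma rder_holo T f s : rloc s (fun t => f (RtoC t) = T t) -> holo_at f (RtoC s) ->
  rder T s (CD f (RtoC s)).
Proof. intros E H; apply (rder_ext_rloc _ _ _ _ E), cder_rder, holo_at_cder, H. Qed.

Lemma rD_holo T f s : rloc s (fun t => f (RtoC t) = T t) -> holo_at f (RtoC s) ->
  rloc s (fun t => CD f (RtoC t) = rD T t).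
Proof.
  intros E H. eapply rloc_imp; [|exact (rloc_and _ _ _ (rloc_rloc _ _ E) (near_rloc _ _ (holo_at_near _ _ H)))].
  intros t [Et Ht]. symmetry; apply rder_rD. now apply rder_holo.
Qed.

(** * Moebius transformations and the Schwarzian derivative *)

Section Mobius.
Variables (k1 k2 k3 k4 : C) (S : C -> C).
Let Delta := (k1 * k4 - k2 * k3)%C.
Definition mob (z : C) : C := ((k1 * S z + k2) / (k3 * S z + k4))%C.

Lemma mob_holo z : holo_at S z -> (k3 * S z + k4)%C <> RtoC 0 -> holo_at mob z.
Proof.
  intros HS Hp. unfold mob. apply (holo_at_div (fun z => k1 * S z + k2)%C (fun z => k3 * S z + k4)%C); auto;
  apply holo_at_plus; try apply holo_at_const; now apply holo_at_scal.
Qed.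

Lemma near_den z : holo_at S z -> (k3 * S z + k4)%C <> RtoC 0 -> near z (fun w => (k3 * S w + k4)%C <> RtoC 0).
Proof.
  intros HS Hp. apply (near_ccont_neq (fun w => k3 * S w + k4)%C); auto.
  apply holo_at_ccont. apply holo_at_plus; [now apply holo_at_scal|apply holo_at_const].
Qed.

Lemma CD_mob z : holo_at S z -> (k3 * S z + k4)%C <> RtoC 0 ->
  CD mob z = (Delta * CD S z / (k3 * S z + k4) ^ 2)%C.
Proof.
  intros HS Hp. apply CD_unique. assert (H := holo_at_cder _ _ HS).
  eapply der_eq; [|apply (der_div (fun z => z) (fun z => k1 * S z + k2)%C (fun z => k3 * S z + k4)%C); [exact Hp| |]].
  3,2: apply der_plus; [apply der_scal; exact H|apply der_const].
  unfold Delta; field. auto.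
Qed.

Lemma CD2_mob z : holo_at S z -> (k3 * S z + k4)%C <> RtoC 0 ->
  CD (CD mob) z = (Delta * (CD (CD S) z * (k3 * S z + k4) - 2 * k3 * CD S z ^ 2) / (k3 * S z + k4) ^ 3)%C.
Proof.
  intros HS Hp. apply CD_unique.
  assert (H := holo_at_cder _ _ HS). assert (H1 := holo_at_cder _ _ (holo_at_CD _ _ HS)).
  apply (cder_ext_near (fun z => Delta * CD S z / ((k3 * S z + k4) * (k3 * S z + k4)))%C).
  - eapply near_imp; [|apply (near_and _ _ _ (holo_at_near _ _ HS) (near_den z HS Hp))].
    intros w [Hw Hpw]. rewrite CD_mob by auto. simpl Cpow. now rewrite Cmult_1_r.
  - assert (Hk : cder (fun z => k3 * S z + k4)%C z (k3 * CD S z + 0)%C).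
    { apply der_plus; [apply der_scal; exact H|apply der_const]. }
    eapply der_eq; [|apply (der_div (fun z => z) (fun z => Delta * CD S z)%C (fun z => (k3 * S z + k4) * (k3 * S z + k4))%C)].
    2: now apply Cmult_neq_0.
    2: apply der_scal; exact H1.
    2: apply (der_mult (fun z => z) (fun z => k3 * S z + k4)%C (fun z => k3 * S z + k4)%C); exact Hk.
    unfold Delta; field. auto.
Qed.

(** Moebius invariance, with real-variable derivatives of [T] on one side and complex derivatives of
    [S] on the other. It rests on T''/T' = S''/S' - 2 k3 S'/(k3 S + k4). *)
Lemma schwarzian_mob T s : Delta <> RtoC 0 -> holo_at S (RtoC s) -> (k3 * S (RtoC s) + k4)%C <> RtoC 0 ->
  rloc s (fun t => mob (RtoC t) = T t) -> rD T s <> RtoC 0 ->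
  CD S (RtoC s) <> RtoC 0 /\
  schwarzian T s = (CD (CD (CD S)) (RtoC s) / CD S (RtoC s) - 3 / 2 * (CD (CD S) (RtoC s) / CD S (RtoC s)) ^ 2)%C.
Proof.
  intros HD HS Hp ET HT. set (z := RtoC s) in *.
  assert (Hm := mob_holo z HS Hp).
  assert (E1 := rD_holo _ _ _ ET Hm). assert (E2 := rD_holo _ _ _ E1 (holo_at_CD _ _ Hm)).
  assert (HS1 : CD S z <> RtoC 0).
  { intros E. apply HT. rewrite <- (rloc_self _ _ E1). fold z. rewrite CD_mob by auto. rewrite E. field. exact Hp. }
  split; auto.
  assert (H0 := holo_at_cder _ _ HS).
  assert (H1 := holo_at_cder _ _ (holo_at_CD _ _ HS)).
  assert (H2 := holo_at_cder _ _ (holo_at_CD _ _ (holo_at_CD _ _ HS))).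
  assert (Hne : near z (fun w => CD S w <> RtoC 0)).
  { apply near_ccont_neq; auto. now apply holo_at_ccont, holo_at_CD. }
  unfold schwarzian. rewrite <- (rloc_self _ _ E2), <- (rloc_self _ _ E1). fold z.
  rewrite CD_mob, CD2_mob by auto.
  assert (Hk : cder (fun z => k3 * S z + k4)%C z (k3 * CD S z + 0)%C).
  { apply der_plus; [apply der_scal; exact H0|apply der_const]. }
  assert (Hr : rder (fun x => rD (rD T) x / rD T x)%C s
     ((CD (CD (CD S)) z * CD S z - CD (CD S) z * CD (CD S) z) / (CD S z * CD S z) -
      ((2 * k3 * CD (CD S) z) * (k3 * S z + k4) - (2 * k3 * CD S z) * (k3 * CD S z + 0)) /
       ((k3 * S z + k4) * (k3 * S z + k4)))%C).
  { apply (rder_ext_rloc (fun t => CD (CD S) (RtoC t) / CD S (RtoC t) - 2 * k3 * CD S (RtoC t) / (k3 * S (RtoC t) + k4))%C).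
    - eapply rloc_imp; [|exact (rloc_and _ _ _ (rloc_and _ _ _ E1 E2) (near_rloc _ _ (near_and _ _ _ (holo_at_near _ _ HS) (near_and _ _ _ (near_den z HS Hp) Hne))))].
      intros t [[F1 F2] [G1 [G2 G3]]]. rewrite <- F1, <- F2, CD_mob, CD2_mob by auto. field. auto.
    - apply (cder_rder (fun z => CD (CD S) z / CD S z - 2 * k3 * CD S z / (k3 * S z + k4))%C).
      apply der_minus.
      + apply (der_div (fun z => z)); auto.
      + apply (der_div (fun z => z) (fun z => 2 * k3 * CD S z)%C (fun z => k3 * S z + k4)%C); auto.
        apply der_scal, H1. }
  rewrite (rder_rD _ _ _ Hr). field. auto.
Qed.
End Mobius.

(* If [S'] vanished to order [m + 1] at [s0], the Schwarzian would have a double pole there. *)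
Lemma schwarzian_immersion S U s0 : holo_at S (RtoC s0) -> holo_at U (RtoC s0) ->
  rpunct s0 (fun s => CD S (RtoC s) <> RtoC 0 /\
   (CD (CD (CD S)) (RtoC s) / CD S (RtoC s) - 3 / 2 * (CD (CD S) (RtoC s) / CD S (RtoC s)) ^ 2)%C = U (RtoC s)) ->
  CD S (RtoC s0) <> RtoC 0.
Proof.
  intros HS HU Heq HS0. set (z0 := RtoC s0) in *.
  assert (HS1 := holo_at_CD _ _ HS).
  destruct (holo_factor _ _ HS1) as [Hz|(l & e & He & He0 & El)].
  { destruct (rpunct_ex _ _ (rpunct_and _ _ _ Heq (rloc_rpunct _ _ (near_rloc _ _ Hz)))) as [t (_ & [Ht _] & Ht')].
    contradiction. }
  destruct l as [|m].
  { rewrite El in HS0. simpl in HS0. rewrite Cmult_1_l in HS0. contradiction. }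
  assert (He1 := holo_at_CD _ _ He). assert (He2 := holo_at_CD _ _ He1).
  assert (Hp : forall n w, cder (fun w => (w - z0) ^ n)%C w (RtoC (INR n) * (w - z0) ^ pred n)%C).
  { intros n w. eapply der_eq; [|apply (der_pow (fun z => z) (fun w => w - z0)%C)].
    2: apply der_minus; [apply der_id|apply der_const]. ring. }
  assert (E2 : near z0 (fun w => CD (CD S) w =
     (RtoC (INR (Datatypes.S m)) * (w - z0) ^ m * e w + (w - z0) ^ Datatypes.S m * CD e w)%C)).
  { eapply near_imp; [|exact (near_and _ _ _ (holo_at_near _ _ He) (holo_at_near _ _ HS1))].
    intros w [Hw Hw']. apply CD_unique. apply (der_ext _ (fun w => (w - z0) ^ Datatypes.S m * e w)%C); [intros; symmetry; apply El|].
    apply (der_mult (fun z => z) (fun w => (w - z0) ^ Datatypes.S m)%C e); [apply (Hp (Datatypes.S m))|now apply holo_at_cder]. }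
  assert (E3 : near z0 (fun w => CD (CD (CD S)) w =
     (RtoC (INR (Datatypes.S m)) * (RtoC (INR m) * (w - z0) ^ pred m) * e w
      + RtoC (INR (Datatypes.S m)) * (w - z0) ^ m * CD e w
      + (RtoC (INR (Datatypes.S m)) * (w - z0) ^ m * CD e w + (w - z0) ^ Datatypes.S m * CD (CD e) w))%C)).
  { eapply near_imp; [|exact (near_and _ _ _ (near_near _ _ E2) (near_and _ _ _ (holo_at_near _ _ He) (holo_at_near _ _ He1)))].
    intros w (G1 & G2 & G3). apply CD_unique.
    apply (cder_ext_near _ _ _ _ (near_imp _ _ _ (fun v E => eq_sym E) G1)).
    apply der_plus.
    - apply (der_mult (fun z => z) (fun w => RtoC (INR (Datatypes.S m)) * (w - z0) ^ m)%C e); [|now apply holo_at_cder].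
      apply der_scal, Hp.
    - apply (der_mult (fun z => z) (fun w => (w - z0) ^ Datatypes.S m)%C (CD e)); [apply (Hp (Datatypes.S m))|now apply holo_at_cder]. }
  set (L := RtoC (INR (Datatypes.S m))) in *. set (M := RtoC (INR m)) in *.
  (* With S' = (w - z0)^(m+1) e, [B] is the difference of the two sides of the Schwarzian equation
     times (w - z0)^2 e^2. It is holomorphic at [z0] too, and vanishes on the punctured axis. *)
  set (B := fun w => (L * M * (e w * e w) + 2 * L * (w - z0) * (e w * CD e w) + (w - z0) * (w - z0) * (CD (CD e) w * e w)
     - 3 / 2 * ((L * e w + (w - z0) * CD e w) * (L * e w + (w - z0) * CD e w)) - (w - z0) * (w - z0) * (U w * (e w * e w)))%C).
  assert (HB : near z0 (fun w => B w = RtoC 0)).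
  { apply holo_zero_real.
    - unfold B. assert (Hx : holo_at (fun w => w - z0)%C z0) by (apply holo_at_minus; [apply holo_at_id|apply holo_at_const]).
      repeat first [apply holo_at_const | assumption | apply (holo_at_minus (fun _ => _ + _)%C) | apply holo_at_plus | apply (holo_at_minus (fun _ => _ * _)%C) | apply (holo_at_minus (fun _ => _ - _)%C) | apply holo_at_mult].
    - eapply rpunct_imp; [|exact (rpunct_and _ _ _ Heq (rpunct_and _ _ _ (rloc_rpunct _ _ (near_rloc _ _ E2)) (rloc_rpunct _ _ (near_rloc _ _ E3))))].
      intros s [[G1 G2] [G3 G4]]. set (w := RtoC s) in *.
      rewrite El in G1.
      assert (Gx : (w - z0)%C <> RtoC 0).
      { intros E; apply G1. rewrite E. simpl; ring. }
      assert (Ge : e w <> RtoC 0).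
      { intros E; apply G1. rewrite E. ring. }
      assert (Gm : ((w - z0) ^ m)%C <> RtoC 0) by now apply Cpow_nz.
      (* For m = 0 the truncated predecessor gives a wrong power, but its coefficient [M] is then
         0. *)
      assert (Gp : (M * ((w - z0) * (w - z0) ^ pred m))%C = (M * (w - z0) ^ m)%C).
      { destruct m; [unfold M; simpl; ring|]. reflexivity. }
      rewrite G3, G4, El in G2. simpl Cpow in G2.
      unfold B.
      assert (GU : (U w * (((w - z0) * (w - z0)) * (e w * e w)))%C =
       ((L * (M * ((w - z0) * (w - z0) ^ pred m)) * e w / (w - z0) ^ m + 2 * L * (w - z0) * CD e w + (w - z0) * (w - z0) * CD (CD e) w) * e w
        - 3 / 2 * ((L * e w + (w - z0) * CD e w) * (L * e w + (w - z0) * CD e w)))%C).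
      { rewrite <- G2. field. auto. }
      rewrite Gp in GU.
      replace ((w - z0) * (w - z0) * (U w * (e w * e w)))%C with (U w * (((w - z0) * (w - z0)) * (e w * e w)))%C by ring.
      rewrite GU. field. auto. }
  apply near_self in HB. unfold B in HB.
  replace (z0 - z0)%C with (RtoC 0) in HB by ring.
  (* At [z0] only L (M - 3L/2) e^2 survives in [B]; since L = m + 1 and M = m, the bracket is -(m +
     3)/2. *)
  assert (HLM : (L * (M - 3 / 2 * L))%C <> RtoC 0).
  { assert (HmL : L = (M + 1)%C) by (unfold L, M; rewrite S_INR, RtoC_plus; reflexivity).
    assert (Hm0 := pos_INR m). apply Cmult_neq_0.
    - unfold L; apply RtoC_neq. rewrite S_INR; lra.
    - replace (M - 3 / 2 * L)%C with (- (RtoC (INR m + 3) / 2))%C.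
      + replace (- (RtoC (INR m + 3) / 2))%C with (RtoC (- (INR m + 3) / 2)).
        * apply RtoC_neq; lra.
        * rewrite RtoC_div, RtoC_opp by lra. field.
      + rewrite HmL. unfold M. rewrite RtoC_plus. field. }
  apply (Cmult_neq_0 _ _ HLM (Cmult_neq_0 _ _ He0 He0)). rewrite <- HB. field.
Qed.

(** * Regularity and the equation recovered from a jet *)

Lemma near_horiz (P : C -> Prop) z : near z P -> locally (Re z) (fun s => P (s, Im z)).
Proof.
  intros [d [Hd H]]. exists (mkposreal d Hd). intros s Hs. apply H.
  destruct z as [x y]. change (Im (x, y)) with y. rewrite Cmod_horiz. exact Hs.
Qed.
Lemma near_vert (P : C -> Prop) z : near z P -> locally (Im z) (fun t => P (Re z, t)).
Proof.
  intros [d [Hd H]]. exists (mkposreal d Hd). intros t Ht. apply H.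
  destruct z as [x y]. change (Re (x, y)) with x. rewrite Cmod_vert. exact Ht.
Qed.

Lemma Ck_on_ext k U : (forall z, U z -> near z U) -> forall f g : C -> R,
  (forall z, U z -> f z = g z) -> Ck_on k U f -> Ck_on k U g.
Proof.
  intros Uo; induction k; intros f g E H.
  - intros z Hz. apply ccont_RtoC. apply (ccont_ext_near (fun w => RtoC (f w))).
    + eapply near_imp; [|apply Uo, Hz]. intros w Hw; now rewrite E.
    + apply ccont_RtoC, H, Hz.
  - assert (En : forall z, U z -> near z (fun w => f w = g w)).
    { intros z Hz. eapply near_imp; [|apply Uo, Hz]. exact E. }
    destruct H as (H1 & H2 & H3). split; [|split].
    + intros z Hz. destruct (H1 z Hz) as [X1 X2]. split.
      * eapply ex_derive_ext_loc; [|exact X1]. exact (near_horiz (fun w => f w = g w) z (En z Hz)).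
      * eapply ex_derive_ext_loc; [|exact X2]. exact (near_vert (fun w => f w = g w) z (En z Hz)).
    + apply (IHk (ps f)); auto. intros z Hz; now apply ps_ext_near, En.
    + apply (IHk (pt f)); auto. intros z Hz; now apply pt_ext_near, En.
Qed.

Lemma Ck_on_local k U : forall f, (forall z, U z -> exists V : C -> Prop, V z /\ Ck_on k V f) -> Ck_on k U f.
Proof.
  induction k; intros f H.
  - intros z Hz; destruct (H z Hz) as [V [Vz HV]]. now apply HV.
  - split; [|split].
    + intros z Hz; destruct (H z Hz) as [V [Vz (HV & _ & _)]]. now apply HV.
    + apply IHk. intros z Hz; destruct (H z Hz) as [V [Vz (_ & HV & _)]]. now exists V.
    + apply IHk. intros z Hz; destruct (H z Hz) as [V [Vz (_ & _ & HV)]]. now exists V.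
Qed.

Lemma partials_ps_pt (f : C -> R) z A B :
  partials (fun w => RtoC (f w)) z (RtoC A) (RtoC B) -> ps f z = A /\ pt f z = B.
Proof. intros H; apply partials_real in H; destruct H; split; now apply is_derive_unique. Qed.

Lemma Ck_on_of_partials k U (f p q : C -> R) : (forall z, U z -> near z U) ->
  (forall z, U z -> partials (fun w => RtoC (f w)) z (RtoC (p z)) (RtoC (q z))) ->
  Ck_on k U p -> Ck_on k U q -> Ck_on (S k) U f.
Proof.
  intros Uo H Hp Hq. split; [|split].
  - intros z Hz. destruct (proj1 (partials_real _ _ _ _) (H z Hz)) as [H1 H2]. split; eexists; eassumption.
  - apply (Ck_on_ext k U Uo p); auto. intros z Hz; symmetry; now apply (partials_ps_pt f z (p z) (q z)), H.
  - apply (Ck_on_ext k U Uo q); auto. intros z Hz; symmetry; now apply (partials_ps_pt f z (p z) (q z)), H.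
Qed.

Lemma wirt_Re_partials G z A B : wirt G z A B ->
  partials (fun w => RtoC (Re (G w))) z (RtoC (Re (A + B)%C)) (RtoC (Re (Ci * (A - B))%C)).
Proof. intros [H1 H2]; split; [exact (rder_Re _ _ _ H1)|exact (rder_Re _ _ _ H2)]. Qed.

Lemma ccont_Re f z : ccont f z -> ccont (fun w => RtoC (Re (f w))) z.
Proof.
  intros H eps He; destruct (H eps He) as [d [Hd Hw]]; exists d; split; auto.
  intros w Hwd. rewrite Cmod_RtoC_minus. eapply Rle_lt_trans; [|apply (Hw w Hwd)].
  apply (re_le_Cmod (f w - f z)%C).
Qed.

Lemma Ck1_Re U G A B : (forall z, U z -> near z U) -> (forall z, U z -> wirt G z (A z) (B z)) ->
  (forall z, U z -> ccont A z) -> (forall z, U z -> ccont B z) -> Ck_on 1 U (fun z => Re (G z)).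
Proof.
  intros Uo HG HA HB.
  apply (Ck_on_of_partials 0 U _ (fun z => Re (A z + B z)%C) (fun z => Re (Ci * (A z - B z))%C) Uo).
  - intros z Hz; now apply wirt_Re_partials, HG.
  - intros z Hz. apply ccont_RtoC, (ccont_Re (fun z => A z + B z)%C), ccont_plus; auto.
  - intros z Hz. apply ccont_RtoC, (ccont_Re (fun z => Ci * (A z - B z))%C), ccont_Cmult, ccont_minus; auto.
Qed.

(** Converse of [solution_jet]. The first derivatives of [phi] are combinations of F w and F
    conj(w); the jet system differentiates these once more, with results that are polynomials in
    [F], [w], [Q] and conjugates, hence continuous. *)
Lemma jet_solution c U Q phi w : (forall z, U z -> near z U) -> (forall z, U z -> 0 < phi z) ->
  (forall z, U z -> ccont Q z /\ ccont (fun v => RtoC (phi v)) z /\ ccont w z /\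
     liouville_jet c Q (fun v => RtoC (phi v)) w (fun v => Cconj (w v)) z) ->
  Ck_on 2 U phi /\
  (forall z, U z -> dz (fun v => RtoC (phi v)) z = (RtoC (phi z) * w z)%C) /\
  (forall z, U z -> dzbar (dz (fun v => RtoC (ln (phi v)))) z = RtoC (- (c / 2) * phi z)).
Proof.
  intros Uo Hpos HJ.
  set (F := fun v => RtoC (phi v)) in *. set (o := fun v => Cconj (w v)) in *.
  assert (HF : forall z, U z -> wirt F z (F z * w z)%C (F z * o z)%C) by (intros z Hz; apply HJ, Hz).
  assert (cF : forall z, U z -> ccont F z) by (intros z Hz; apply HJ, Hz).
  assert (cw : forall z, U z -> ccont w z) by (intros z Hz; apply HJ, Hz).
  assert (cQ : forall z, U z -> ccont Q z) by (intros z Hz; apply HJ, Hz).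
  assert (co : forall z, U z -> ccont o z) by (intros z Hz; apply ccont_conj, cw, Hz).
  split; [|split].
  - set (Az := fun z => (F z * w z * w z + F z * (Q z + w z * w z * / 2))%C).
    set (Ab := fun z => (F z * o z * w z + F z * (- (RtoC c / 2) * F z))%C).
    set (Bz := fun z => (F z * w z * o z + F z * (- (RtoC c / 2) * F z))%C).
    set (Bb := fun z => (F z * o z * o z + F z * (Cconj (Q z) + o z * o z * / 2))%C).
    assert (HA : forall z, U z -> wirt (fun z => F z * w z)%C z (Az z) (Ab z)).
    { intros z Hz. destruct (HJ z Hz) as (_ & _ & _ & J1 & J2 & J3).
      eapply wirt_eq; [| |apply wirt_mult; [exact J1|exact J2]]; unfold Az, Ab; [field|reflexivity]. }
    assert (HB : forall z, U z -> wirt (fun z => F z * o z)%C z (Bz z) (Bb z)).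
    { intros z Hz. destruct (HJ z Hz) as (_ & _ & _ & J1 & J2 & J3).
      eapply wirt_eq; [| |apply wirt_mult; [exact J1|exact J3]]; unfold Bz, Bb; [reflexivity|field]. }
    assert (cA : forall z, U z -> ccont Az z /\ ccont Ab z /\ ccont Bz z /\ ccont Bb z).
    { intros z Hz. specialize (cF z Hz); specialize (cw z Hz); specialize (cQ z Hz); specialize (co z Hz).
      assert (cQc := ccont_conj _ _ cQ).
      repeat split; unfold Az, Ab, Bz, Bb;
      repeat first [assumption | apply ccont_const | apply ccont_plus | apply ccont_mult]. }
    apply (Ck_on_of_partials 1 U _ (fun z => Re (F z * w z + F z * o z)%C) (fun z => Re (Ci * (F z * w z - F z * o z))%C) Uo).
    + intros z Hz. exact (wirt_Re_partials F z _ _ (HF z Hz)).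
    + apply (Ck1_Re U _ (fun z => Az z + Bz z)%C (fun z => Ab z + Bb z)%C Uo).
      * intros z Hz; apply wirt_plus; auto.
      * intros z Hz; destruct (cA z Hz) as (? & ? & ? & ?); now apply ccont_plus.
      * intros z Hz; destruct (cA z Hz) as (? & ? & ? & ?); now apply ccont_plus.
    + apply (Ck1_Re U _ (fun z => Ci * (Az z - Bz z))%C (fun z => Ci * (Ab z - Bb z))%C Uo).
      * intros z Hz; apply wirt_scal, wirt_minus; auto.
      * intros z Hz; destruct (cA z Hz) as (? & ? & ? & ?); now apply ccont_Cmult, ccont_minus.
      * intros z Hz; destruct (cA z Hz) as (? & ? & ? & ?); now apply ccont_Cmult, ccont_minus.
  - intros z Hz. exact (wirt_dz _ _ _ _ (HF z Hz)).
  - assert (Hln : forall z, U z -> dz (fun v => RtoC (ln (phi v))) z = w z).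
    { intros z Hz. specialize (Hpos z Hz).
      assert (Hp := wirt_Re_partials F z _ _ (HF z Hz)).
      assert (Hnz : F z <> RtoC 0) by (apply RtoC_neq; lra).
      assert (H1 := wirt_of_partials _ _ _ _ (partials_ln phi z _ _ Hpos Hp)).
      rewrite (wirt_dz _ _ _ _ H1). rewrite !RtoC_div by lra. fold (F z).
      replace (RtoC (Re (F z * w z + F z * o z)%C)) with (F z * w z + F z * o z)%C.
      2:{ unfold F, o; apply injective_projections; simpl; ring. }
      replace (RtoC (Re (Ci * (F z * w z - F z * o z))%C)) with (Ci * (F z * w z - F z * o z))%C.
      2:{ unfold F, o; apply injective_projections; simpl; ring. }
      replace (Ci * (Ci * (F z * w z - F z * o z) / F z))%C with ((Ci * Ci) * ((F z * w z - F z * o z) / F z))%C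
        by (unfold Cdiv; ring).
      rewrite Ci2. field. exact Hnz. }
    intros z Hz. rewrite (dzbar_ext_near _ w).
    + destruct (HJ z Hz) as (_ & _ & _ & _ & J2 & _). rewrite (wirt_dzbar _ _ _ _ J2).
      unfold F. rewrite RtoC_mult, RtoC_opp, RtoC_div by lra. reflexivity.
    + eapply near_imp; [|apply Uo, Hz]. exact Hln.
Qed.

Definition schw (S : C -> C) (z : C) : C :=
  (CD (CD (CD S)) z / CD S z - 3 / 2 * (CD (CD S) z / CD S z) ^ 2)%C.

Lemma holo_at_schw S z : holo_at S z -> CD S z <> RtoC 0 -> holo_at (schw S) z.
Proof.
  intros H Hn. assert (H1 := holo_at_CD _ _ H). assert (H2 := holo_at_CD _ _ H1). assert (H3 := holo_at_CD _ _ H2).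
  unfold schw. apply (holo_at_minus (fun z => CD (CD (CD S)) z / CD S z)%C (fun z => 3 / 2 * (CD (CD S) z / CD S z) ^ 2)%C).
  - now apply holo_at_div.
  - apply holo_at_scal. apply (holo_at_pow (fun z => CD (CD S) z / CD S z)%C). now apply holo_at_div.
Qed.

Lemma Cconj_RtoC s : Cconj (RtoC s) = RtoC s.
Proof. apply injective_projections; simpl; ring. Qed.

Lemma wirt_antiholo f z : holo_at f (Cconj z) -> wirt (fun w => f (Cconj w)) z (RtoC 0) (CD f (Cconj z)).
Proof.
  intros H. assert (Hc := wirt_conj _ _ _ _ (wirt_holo _ _ _ (cder_conj_refl _ _ _ (holo_at_cder _ _ H)))).
  rewrite Cconj_conj, Cconj_RtoC in Hc.
  eapply wirt_ext_near; [|exact Hc]. exists 1; split; [lra|]. intros; now rewrite Cconj_conj.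
Qed.

Lemma near_conj s (P : C -> Prop) : near (RtoC s) P -> near (RtoC s) (fun w => P (Cconj w)).
Proof. intros H; apply near_crefl. now rewrite Cconj_RtoC. Qed.

Lemma ccont_comp_conj f z : ccont f (Cconj z) -> ccont (fun w => f (Cconj w)) z.
Proof.
  intros H eps He; destruct (H eps He) as [d [Hd Hw]]; exists d; split; auto.
  intros w Hwd. apply Hw. now rewrite <- Cminus_conj, Cmod_conj.
Qed.

(** * The solution in a chart that vanishes at a point of the axis *)

Section LocalCore.
Variables (c : R) (a : R -> R) (S A beta : C -> C) (s0 : R).
Let z0 := RtoC s0.
Hypothesis Hc : c <> 0.
Hypothesis (HS : holo_at S z0) (HA : holo_at A z0) (Hb : holo_at beta z0).
Hypothesis (S0 : S z0 = RtoC 0) (S1 : CD S z0 <> RtoC 0) (Ha0 : 0 < a s0).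
(** [A] continues [a] and [beta] continues b/a; the second equation is a' = 2 Re b divided through
    by nothing but rewritten with b = a beta. *)
Hypothesis Haxis : rloc s0 (fun s => A (RtoC s) = RtoC (a s) /\
  CD A (RtoC s) = (A (RtoC s) * (beta (RtoC s) + Cconj (beta (RtoC s))))%C).
Hypothesis Hschw : rpunct s0 (fun s => schw S (RtoC s) =
  ((2 * CD beta (RtoC s) - beta (RtoC s) ^ 2 + RtoC c * A (RtoC s)) / 2)%C).

Definition Nfun (z : C) : C := (CD (CD S) z - beta z * CD S z)%C.
Definition Dfun (z : C) : C := (2 * (CD S z * CD S z) - S z * Nfun z)%C.
(** Solving [formula_w] = [beta] for [r0] on the axis gives N = c D r0. So [Kfun] is the conjugate
    of [R_data] with [T] replaced by [S], continued holomorphically. *)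
Definition Kfun (z : C) : C := (Nfun z / (RtoC c * Dfun z))%C.

Lemma holo_Nfun : holo_at Nfun z0.
Proof.
  assert (H1 := holo_at_CD _ _ HS). assert (H2 := holo_at_CD _ _ H1).
  apply holo_at_minus; auto. now apply holo_at_mult.
Qed.
Lemma holo_Dfun : holo_at Dfun z0.
Proof.
  assert (H1 := holo_at_CD _ _ HS).
  apply holo_at_minus; [apply holo_at_scal; now apply holo_at_mult|]. apply holo_at_mult; auto. apply holo_Nfun.
Qed.
(** This is what the normalization S = 0 buys: [Dfun] reduces to 2 S'^2 at [z0], so [Kfun] has no
    pole there. *)
Lemma Dfun_nz : Dfun z0 <> RtoC 0.
Proof.
  unfold Dfun; rewrite S0. replace (2 * (CD S z0 * CD S z0) - 0 * Nfun z0)%C with (2 * (CD S z0 * CD S z0))%C by ring.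
  repeat apply Cmult_neq_0; auto using C2_nz.
Qed.
Lemma c_nz : RtoC c <> RtoC 0.
Proof. now apply RtoC_neq. Qed.

Lemma near_Dfun_nz : near z0 (fun z => Dfun z <> RtoC 0).
Proof. apply near_ccont_neq; [apply holo_at_ccont, holo_Dfun|apply Dfun_nz]. Qed.
Lemma near_S1_nz : near z0 (fun z => CD S z <> RtoC 0).
Proof. apply near_ccont_neq; [now apply holo_at_ccont, holo_at_CD|exact S1]. Qed.

Lemma holo_Kfun : holo_at Kfun z0.
Proof.
  apply (holo_at_div Nfun (fun z => RtoC c * Dfun z)%C).
  - apply Cmult_neq_0; [apply c_nz|apply Dfun_nz].
  - apply holo_Nfun.
  - apply holo_at_scal, holo_Dfun.
Qed.

Lemma near_schw : near z0 (fun z => schw S z = ((2 * CD beta z - beta z ^ 2 + RtoC c * A z) / 2)%C).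
Proof.
  eapply near_imp; [|apply (holo_zero_real (fun z => schw S z - (2 * CD beta z - beta z ^ 2 + RtoC c * A z) / 2)%C s0)].
  - intros z Hz; now apply Ceq_minus.
  - apply holo_at_minus; [now apply holo_at_schw|].
    apply (holo_at_div (fun z => 2 * CD beta z - beta z ^ 2 + RtoC c * A z)%C (fun _ => RtoC 2)); [apply C2_nz| |apply holo_at_const].
    apply (holo_at_plus (fun z => 2 * CD beta z - beta z ^ 2)%C (fun z => RtoC c * A z)%C).
    + apply (holo_at_minus (fun z => 2 * CD beta z)%C (fun z => beta z ^ 2)%C); [now apply holo_at_scal, holo_at_CD|now apply holo_at_pow].
    + now apply holo_at_scal.
  - eapply rpunct_imp; [|exact Hschw]. intros s Hs. apply (proj1 (Ceq_minus _ _)), Hs.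
Qed.

(** The third derivative of [S] is eliminated through the Schwarzian equation. The term [c * A] of
    that equation is what remains, and it makes the formula take the value [a] on the axis. *)
Lemma CD_Kfun : near z0 (fun z => CD Kfun z = (A z * CD S z ^ 3 / Dfun z ^ 2)%C).
Proof.
  assert (Hnear := near_and _ _ _ near_schw (near_and _ _ _ near_Dfun_nz (near_and _ _ _ near_S1_nz
    (near_and _ _ _ (holo_at_near _ _ HS) (holo_at_near _ _ Hb))))).
  eapply near_imp; [|exact Hnear]. intros z (E & ND & NS & hS & hb). apply CD_unique.
  assert (d0 := holo_at_cder _ _ hS). assert (d1 := holo_at_cder _ _ (holo_at_CD _ _ hS)).
  assert (d2 := holo_at_cder _ _ (holo_at_CD _ _ (holo_at_CD _ _ hS))). assert (db := holo_at_cder _ _ hb).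
  assert (dN : cder Nfun z (CD (CD (CD S)) z - (CD beta z * CD S z + beta z * CD (CD S) z))%C).
  { apply der_minus; auto. now apply (der_mult (fun z => z)). }
  assert (dD := der_minus (fun z => z) _ _ _ _ _ (der_scal (fun z => z) (RtoC 2) _ _ _ (der_mult (fun z => z) _ _ _ _ _ d1 d1))
     (der_mult (fun z => z) _ _ _ _ _ d0 dN)).
  eapply der_eq; [|apply (der_div (fun z => z) Nfun (fun z => RtoC c * Dfun z)%C);
     [now apply Cmult_neq_0; [apply c_nz|]|exact dN|apply der_scal; exact dD]].
  assert (E3 : CD (CD (CD S)) z = (CD S z * ((2 * CD beta z - beta z ^ 2 + RtoC c * A z) / 2 + 3 / 2 * (CD (CD S) z / CD S z) ^ 2))%C).
  { rewrite <- E. unfold schw. field. exact NS. }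
  rewrite E3. unfold Dfun, Nfun in *. field.
  repeat split; auto using c_nz.
Qed.

Lemma A_nz : A z0 <> RtoC 0.
Proof. unfold z0; rewrite (proj1 (rloc_self _ _ Haxis)). apply RtoC_neq; lra. Qed.

Lemma CD_Kfun_nz : CD Kfun z0 <> RtoC 0.
Proof.
  rewrite (near_self _ _ CD_Kfun). intros E. apply A_nz.
  assert (Hx : (A z0 * CD S z0 ^ 3)%C = (A z0 * CD S z0 ^ 3 / Dfun z0 ^ 2 * Dfun z0 ^ 2)%C) by (field; apply Dfun_nz).
  rewrite E, Cmult_0_l in Hx.
  replace (A z0) with (A z0 * CD S z0 ^ 3 / CD S z0 ^ 3)%C by (field; exact S1). rewrite Hx. field. exact S1.
Qed.

(** Composition with conjugation makes [Kfun] antiholomorphic without changing it on the axis; this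
    is the conj(R) of the chart. *)
Let r0 := fun z => Kfun (Cconj z).
Let r1 := fun z => CD Kfun (Cconj z).
Let r2 := fun z => CD (CD Kfun) (Cconj z).
Let F := formula c (CD S) r1 S r0.
Let w := formula_w c S (CD S) (CD (CD S)) r0.
Let o := formula_w c r0 r1 r2 S.

Lemma near_all : near z0 (fun z => holo_at S z /\ holo_at Kfun (Cconj z) /\ CD S z <> RtoC 0 /\
   r1 z <> RtoC 0 /\ (1 + RtoC c * S z * r0 z)%C <> RtoC 0).
Proof.
  assert (hK := holo_Kfun).
  apply near_and; [now apply holo_at_near|].
  apply near_and; [apply near_conj; now apply holo_at_near|].
  apply near_and; [apply near_S1_nz|].
  apply near_and.
  - apply (near_conj s0 (fun z => CD Kfun z <> RtoC 0)).
    apply near_ccont_neq; [now apply holo_at_ccont, holo_at_CD|apply CD_Kfun_nz].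
  - apply (near_ccont_neq (fun z => 1 + RtoC c * S z * r0 z)%C).
    + apply ccont_plus; [apply ccont_const|]. apply (ccont_mult (fun z => RtoC c * S z)%C r0).
      * now apply ccont_Cmult, holo_at_ccont.
      * apply ccont_comp_conj. unfold z0; rewrite Cconj_RtoC. now apply holo_at_ccont.
    + rewrite S0. replace (1 + RtoC c * 0 * r0 z0)%C with (RtoC 1) by ring. apply C1_nz.
Qed.

Lemma near_jet0 : near z0 (fun z =>
  wirt F z (F z * w z)%C (F z * o z)%C /\
  wirt w z (schw S z + w z ^ 2 / 2)%C (- (RtoC c / 2) * F z)%C /\
  wirt o z (- (RtoC c / 2) * F z)%C (schw Kfun (Cconj z) + o z ^ 2 / 2)%C).
Proof.
  eapply near_imp; [|exact near_all]. intros z (hS & hK & n1 & n2 & n3).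
  assert (w0 := wirt_holo _ _ _ (holo_at_cder _ _ hS)).
  assert (w1 := wirt_holo _ _ _ (holo_at_cder _ _ (holo_at_CD _ _ hS))).
  assert (w2 := wirt_holo _ _ _ (holo_at_cder _ _ (holo_at_CD _ _ (holo_at_CD _ _ hS)))).
  assert (v0 := wirt_antiholo _ _ hK). assert (v1 := wirt_antiholo _ _ (holo_at_CD _ _ hK)).
  assert (v2 := wirt_antiholo _ _ (holo_at_CD _ _ (holo_at_CD _ _ hK))).
  fold r0 in v0. fold r1 in v1. fold r2 in v2.
  split; [|split].
  - now apply (formula_wirt c S (CD S) (CD (CD S)) r0 r1 r2 z).
  - now apply (formula_w_wirt c S (CD S) (CD (CD S)) r0 r1 _ z).
  - now apply (formula_wbar_wirt c S (CD S) r0 r1 r2 _ z).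
Qed.

Lemma near_ccont : near z0 (fun z => ccont F z /\ ccont w z /\ ccont o z /\ ccont (schw S) z).
Proof.
  eapply near_imp; [|exact near_all]. intros z (hS & hK & n1 & n2 & n3).
  assert (hS1 := holo_at_CD _ _ hS). assert (hS2 := holo_at_CD _ _ hS1).
  assert (hK1 := holo_at_CD _ _ hK). assert (hK2 := holo_at_CD _ _ hK1).
  assert (cS := holo_at_ccont _ _ hS). assert (cS1 := holo_at_ccont _ _ hS1). assert (cS2 := holo_at_ccont _ _ hS2).
  assert (cr0 : ccont r0 z) by (apply ccont_comp_conj; now apply holo_at_ccont).
  assert (cr1 : ccont r1 z) by (apply ccont_comp_conj; now apply holo_at_ccont).
  assert (cr2 : ccont r2 z) by (apply ccont_comp_conj; now apply holo_at_ccont).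
  assert (cd : ccont (fun z => 1 + RtoC c * S z * r0 z)%C z).
  { apply ccont_plus; [apply ccont_const|]. apply ccont_mult; auto. apply ccont_mult; auto using ccont_const. }
  assert (cd' : ccont (fun z => 1 + RtoC c * r0 z * S z)%C z).
  { apply ccont_plus; [apply ccont_const|]. apply ccont_mult; auto. apply ccont_mult; auto using ccont_const. }
  assert (n3' : (1 + RtoC c * r0 z * S z)%C <> RtoC 0).
  { replace (1 + RtoC c * r0 z * S z)%C with (1 + RtoC c * S z * r0 z)%C by ring. exact n3. }
  repeat split; [| | |apply holo_at_ccont; now apply holo_at_schw].
  - unfold F, formula. apply ccont_mult.
    + apply ccont_mult; auto. apply ccont_mult; auto using ccont_const.
    + apply ccont_inv; [now apply Cmult_neq_0|]. now apply ccont_mult.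
  - unfold w, formula_w. apply ccont_minus; (apply ccont_mult; [|now apply ccont_inv]); auto.
    apply ccont_mult; auto. apply ccont_mult; auto using ccont_const.
  - unfold o, formula_w. apply ccont_minus; (apply ccont_mult; [|now apply ccont_inv]); auto.
    apply ccont_mult; auto. apply ccont_mult; auto using ccont_const.
Qed.

(** On the axis the denominator 1 + c S K equals 2 S'^2 / D; both values follow from this and from
    [CD_Kfun]. *)
Lemma axis_values : rloc s0 (fun s => F (RtoC s) = RtoC (a s) /\ w (RtoC s) = beta (RtoC s)).
Proof.
  assert (Hn := near_rloc _ _ (near_and _ _ _ CD_Kfun (near_and _ _ _ near_Dfun_nz near_S1_nz))).
  eapply rloc_imp; [|exact (rloc_and _ _ _ Haxis Hn)]. intros s [[EA _] [EK [ND NS]]].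
  assert (Nc := c_nz).
  assert (E1 : (1 + RtoC c * S (RtoC s) * Kfun (RtoC s))%C = (2 * (CD S (RtoC s) * CD S (RtoC s)) / Dfun (RtoC s))%C).
  { unfold Kfun. unfold Dfun in *. field. split; auto. }
  unfold F, w, formula, formula_w, r0, r1. rewrite Cconj_RtoC, E1, EK, <- EA.
  split; [field; auto|]. 
  replace (CD (CD S) (RtoC s)) with (Nfun (RtoC s) + beta (RtoC s) * CD S (RtoC s))%C by (unfold Nfun; ring).
  unfold Kfun. field. auto.
Qed.

(** Along the axis F' = F (w + o), while F = A there and A' = A (beta + conj beta). As [w] is [beta]
    and [a] is nonzero, [o] is conj(beta). *)
Lemma axis_conj : rloc s0 (fun s => o (RtoC s) = Cconj (w (RtoC s))).
Proof.
  assert (Ha : rloc s0 (fun s => RtoC (a s) <> RtoC 0)).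
  { eapply rloc_imp; [|exact (rloc_and _ _ _ Haxis (near_rloc _ _ (near_ccont_neq A z0 _ (holo_at_ccont _ _ HA) A_nz)))].
    intros s [[E _] Hn]. now rewrite <- E. }
  assert (Hn := near_rloc _ _ (near_and _ _ _ near_jet0 (holo_at_near _ _ HA))).
  eapply rloc_imp; [|exact (rloc_and _ _ _ (rloc_and _ _ _ (rloc_rloc _ _ (rloc_and _ _ _ Haxis axis_values)) Ha) Hn)].
  intros s [[Hloc Hna] [[[WF _] _] hA]].
  assert (E := rder_unique _ _ _ _
    (rder_ext_rloc (fun t => A (RtoC t)) _ _ _ (rloc_imp _ _ _ (fun t H => eq_trans (proj1 (proj1 H)) (eq_sym (proj1 (proj2 H)))) Hloc)
       (cder_rder _ _ _ (holo_at_cder _ _ hA))) WF).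
  destruct (rloc_self _ _ Hloc) as [[EA EA'] [EF Ew]].
  rewrite EA', EA, EF, Ew in E. rewrite Ew.
  assert (E' : (RtoC (a s) * (o (RtoC s) - Cconj (beta (RtoC s))))%C = RtoC 0).
  { replace (RtoC (a s) * (o (RtoC s) - Cconj (beta (RtoC s))))%C with
     ((RtoC (a s) * beta (RtoC s) + RtoC (a s) * o (RtoC s)) - RtoC (a s) * (beta (RtoC s) + Cconj (beta (RtoC s))))%C by ring.
    rewrite <- E. ring. }
  apply Ceq_minus. destruct (Classical_Prop.classic ((o (RtoC s) - Cconj (beta (RtoC s)))%C = RtoC 0)) as [H|H]; auto.
  now destruct (Cmult_neq_0 _ _ Hna H).
Qed.

(** Differentiating o = conj(w) along the axis and comparing with the jet equations gives schw K =
    conj(schw S) there. Both sides continue holomorphically, the right one by reflection, so they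
    agree near [z0]. *)
Lemma near_schw_conj : near z0 (fun z => schw Kfun (Cconj z) = Cconj (schw S z)).
Proof.
  assert (hKs : holo_at (schw Kfun) z0) by (apply holo_at_schw; [apply holo_Kfun|apply CD_Kfun_nz]).
  assert (hSs : holo_at (crefl (schw S)) z0).
  { apply holo_at_crefl. unfold z0; rewrite Cconj_RtoC. now apply holo_at_schw. }
  assert (H : near z0 (fun z => (schw Kfun z - crefl (schw S) z)%C = RtoC 0)).
  { apply holo_zero_real; [now apply holo_at_minus|].
    apply rloc_rpunct.
    eapply rloc_imp; [|exact (rloc_and _ _ _ (rloc_rloc _ _ (rloc_and _ _ _ axis_conj axis_values)) (near_rloc _ _ near_jet0))].
    intros s [Hloc (_ & [Ww _] & [Wo _])].
    assert (E := rder_unique _ _ _ _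
      (rder_ext_rloc _ (fun t => o (RtoC t)) _ _ (rloc_imp _ _ _ (fun t H => eq_sym (proj1 H)) Hloc) (rder_conj _ _ _ Ww)) Wo).
    destruct (rloc_self _ _ Hloc) as [Eo [EF _]].
    rewrite Eo, EF, Cconj_RtoC in E. unfold crefl. rewrite Cconj_RtoC.
    rewrite !Cplus_conj, Cdiv_conj, Cpow_conj, Cmult_conj in E by apply C2_nz.
    rewrite Cconj_RtoC in E.
    replace (Cconj (- (RtoC c / 2))) with (- (RtoC c / 2))%C in E.
    2:{ rewrite Copp_conj, Cdiv_conj, !Cconj_RtoC by apply C2_nz. reflexivity. }
    apply Ceq_minus in E. rewrite Cconj_RtoC in E. apply (f_equal Copp) in E. rewrite Copp_0 in E. rewrite <- E.
    ring. }
  apply near_conj in H. eapply near_imp; [|exact H]. intros z Hz. unfold crefl in Hz. rewrite Cconj_conj in Hz.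
  now apply Ceq_minus.
Qed.

Lemma local_core : exists phi : C -> R,
  near z0 (fun z => 0 < phi z /\ RtoC (phi z) = F z /\ ccont (schw S) z /\ ccont (fun v => RtoC (phi v)) z /\ ccont w z /\
     liouville_jet c (schw S) (fun v => RtoC (phi v)) w (fun v => Cconj (w v)) z) /\
  rloc s0 (fun s => phi (RtoC s) = a s /\ w (RtoC s) = beta (RtoC s)).
Proof.
  assert (J1 : near z0 (fun z => liouville_jet c (schw S) F w o z)).
  { eapply near_imp; [|exact (near_and _ _ _ near_jet0 near_schw_conj)].
    intros z [(H1 & H2 & H3) E]. rewrite E in H3. now split; [|split]. }
  assert (Ck : Cconj (- (RtoC c / 2)) = (- (RtoC c / 2))%C).
  { rewrite Copp_conj, Cdiv_conj, !Cconj_RtoC by apply C2_nz. reflexivity. }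
  (* Conjugation exchanges the second and third entries, so the conjugate jet has the same [Q];
     comparing it with the original shows that [F] is real and [o] is conj(w). *)
  assert (J2 : near z0 (fun z => liouville_jet c (schw S) (fun v => Cconj (F v)) (fun v => Cconj (o v)) (fun v => Cconj (w v)) z)).
  { eapply near_imp; [|exact J1]. intros z (H1 & H2 & H3). split; [|split].
    - eapply wirt_eq; [| |exact (wirt_conj _ _ _ _ H1)]; now rewrite Cmult_conj.
    - eapply wirt_eq; [| |exact (wirt_conj _ _ _ _ H3)].
      + rewrite Cplus_conj, Cconj_conj, Cdiv_conj, Cpow_conj, Cconj_RtoC by apply C2_nz. reflexivity.
      + now rewrite Cmult_conj, Ck.
    - eapply wirt_eq; [| |exact (wirt_conj _ _ _ _ H2)].
      + now rewrite Cmult_conj, Ck.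
      + rewrite Cplus_conj, Cdiv_conj, Cpow_conj, Cconj_RtoC by apply C2_nz. reflexivity. }
  destruct (near_box _ _ (near_and _ _ _ J1 J2)) as [r [Hr Hbox]].
  destruct (rloc_self _ _ axis_values) as [F0 _]. assert (o0 := rloc_self _ _ axis_conj).
  change (F z0 = RtoC (a s0)) in F0. change (o z0 = Cconj (w z0)) in o0.
  assert (HU : forall z, box z0 r z -> F z = Cconj (F z) /\ w z = Cconj (o z) /\ o z = Cconj (w z)).
  { apply (jet_unique c (schw S) z0 r).
    - intros z Hz; now apply Hbox.
    - intros z Hz; now apply Hbox.
    - now rewrite F0, Cconj_RtoC.
    - now rewrite o0, Cconj_conj.
    - exact o0. }
  assert (HUn : near z0 (fun z => F z = RtoC (Re (F z)) /\ o z = Cconj (w z))).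
  { exists r; split; auto. intros z Hz. destruct (HU z (box_Cmod _ _ _ Hr Hz)) as (E1 & _ & E3). split; auto.
    rewrite re_alt, <- E1. field. }
  exists (fun z => Re (F z)). split.
  - assert (Hpos : near z0 (fun z => 0 < Re (F z))).
    { assert (cF := proj1 (near_self _ _ near_ccont)). destruct (cF (a s0) Ha0) as [d [Hd Hw]].
      exists d; split; auto. intros z Hz. specialize (Hw z Hz). rewrite F0 in Hw.
      assert (Hre := re_le_Cmod (F z - RtoC (a s0))%C).
      change (Re (F z - RtoC (a s0))%C) with (Re (F z) - a s0) in Hre.
      assert (Hlt : Rabs (Re (F z) - a s0) < a s0) by lra. apply Rabs_def2 in Hlt. lra. }
    eapply near_imp; [|exact (near_and _ _ _ Hpos (near_and _ _ _ (near_near _ _ HUn) (near_and _ _ _ near_ccont J1)))].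
    intros z (P1 & P2 & (c1 & c2 & c3 & c4) & (H1 & H2 & H3)).
    assert (EF : near z (fun v => F v = RtoC (Re (F v)))) by (eapply near_imp; [|exact P2]; intros v Hv; apply Hv).
    assert (Eo : near z (fun v => o v = Cconj (w v))) by (eapply near_imp; [|exact P2]; intros v Hv; apply Hv).
    assert (EFz := near_self _ _ EF). assert (Eoz := near_self _ _ Eo). cbv beta in EFz, Eoz.
    split; [exact P1|]. split; [now symmetry|]. split; [exact c4|].
    split; [exact (ccont_ext_near _ _ _ EF c1)|]. split; [exact c2|].
    split; [|split]; cbv beta; rewrite <- ?EFz, <- ?Eoz.
    + exact (wirt_ext_near _ _ _ _ _ EF H1).
    + exact H2.
    + exact (wirt_ext_near _ _ _ _ _ Eo H3).
  - eapply rloc_imp; [|exact axis_values]. intros s [E1 E2]; split; auto. now rewrite E1.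
Qed.
End LocalCore.

(** * Local existence *)

Lemma holomorphic_at_iff f z : holomorphic_at f z <-> holo_at f z.
Proof.
  unfold holomorphic_at. rewrite C_locally_Cmod. unfold holo_at.
  split; intros [d [Hd H]]; exists d; split; auto; intros w Hw; destruct (H w Hw) as [l Hl];
    exists l; now apply cder_is_derive.
Qed.

Lemma C_locally'_near z P : locally' (T := C_UniformSpace) z P <-> near z (fun w => w <> z -> P w).
Proof. unfold locally', within. rewrite C_locally_Cmod. reflexivity. Qed.

Lemma near_punct_near z P : near z (fun w => w <> z -> P w) -> near z (fun w => w <> z -> near w P).
Proof.
  intros H. apply near_near in H. eapply near_imp; [|exact H]. intros w Hw Hne.
  eapply near_imp; [|exact (near_and _ _ _ Hw (near_neq w z Hne))]. intros u [H1 H2]; auto.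
Qed.

Lemma near_punct_rpunct s P : near (RtoC s) (fun w => w <> RtoC s -> P w) -> rpunct s (fun t => P (RtoC t)).
Proof.
  intros H. destruct (near_rloc _ _ H) as [d [Hd Ht]]. exists d; split; auto.
  intros t H1 H2. apply Ht; auto. intros E; now apply H2, RtoC_inj.
Qed.

Lemma Cinv_neq_0 z : z <> RtoC 0 -> (/ z)%C <> RtoC 0.
Proof. intros H E. apply C1_nz. rewrite <- (Cinv_r z H), E. ring. Qed.

(** Without a pole [F] is translated to vanish at [z0]; at a pole S = 1/F. The last hypothesis
    excludes F = 0 near [z0], where no order of vanishing exists. *)
Lemma meromorphic_chart F z0 n g : holo_at g z0 ->
  near z0 (fun w => w <> z0 -> F w = (g w / (w - z0) ^ n)%C) ->
  ~ near z0 (fun w => w <> z0 -> F w = RtoC 0) ->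
  exists S k1 k2 k3 k4, holo_at S z0 /\ S z0 = RtoC 0 /\ (k1 * k4 - k2 * k3)%C <> RtoC 0 /\
    near z0 (fun w => w <> z0 -> (k3 * S w + k4)%C <> RtoC 0 /\ F w = mob k1 k2 k3 k4 S w).
Proof.
  intros Hg HF Hnz. destruct (holo_factor g z0 Hg) as [H0|(m & h & Hh & Hh0 & E)].
  { destruct Hnz. eapply near_imp; [|exact (near_and _ _ _ HF H0)]. intros w [H1 H2] Hne.
    rewrite H1, H2 by auto. unfold Cdiv; ring. }
  assert (hx : holo_at (fun w => w - z0)%C z0) by (apply holo_at_minus; [apply holo_at_id|apply holo_at_const]).
  assert (HF' : near z0 (fun w => w <> z0 -> F w = ((w - z0) ^ m * h w / (w - z0) ^ n)%C)).
  { eapply near_imp; [|exact HF]. intros w Hw Hne. now rewrite <- E, Hw. }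
  destruct (Nat.le_gt_cases n m) as [Hle|Hgt].
  - set (T := fun w => ((w - z0) ^ (m - n) * h w)%C).
    assert (hT : holo_at T z0) by (apply holo_at_mult; auto; now apply (holo_at_pow (fun w => w - z0)%C)).
    exists (fun w => T w - T z0)%C, (RtoC 1), (T z0), (RtoC 0), (RtoC 1). split; [|split; [|split]].
    + apply holo_at_minus; [exact hT|apply holo_at_const].
    + ring.
    + replace (1 * 1 - T z0 * 0)%C with (RtoC 1) by ring. apply C1_nz.
    + eapply near_imp; [|exact HF']. intros w Hw Hne. split.
      * replace (0 * (T w - T z0) + 1)%C with (RtoC 1) by ring. apply C1_nz.
      * rewrite Hw by auto. unfold mob.
        replace (1 * (T w - T z0) + T z0)%C with (T w) by ring.
        replace (0 * (T w - T z0) + 1)%C with (RtoC 1) by ring. unfold T.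
        replace m with (n + (m - n))%nat at 1 by lia. rewrite Cpow_add_r. field.
        now apply Cpow_nz, Cminus_neq.
  - exists (fun w => (w - z0) ^ (n - m) / h w)%C, (RtoC 0), (RtoC 1), (RtoC 1), (RtoC 0). split; [|split; [|split]].
    + apply (holo_at_div (fun w => (w - z0) ^ (n - m))%C h); auto. now apply (holo_at_pow (fun w => w - z0)%C).
    + replace (n - m)%nat with (S (n - m - 1)) by lia. simpl Cpow.
      replace (z0 - z0)%C with (RtoC 0) by ring. unfold Cdiv; ring.
    + replace (0 * 0 - 1 * 1)%C with (- (1))%C by ring. intros E'. apply C1_nz.
      rewrite <- (Copp_0), <- E'. ring.
    + eapply near_imp; [|exact (near_and _ _ _ HF' (near_ccont_neq _ _ _ (holo_at_ccont _ _ Hh) Hh0))].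
      intros w [Hw Hhw] Hne.
      assert (Hx : (w - z0)%C <> RtoC 0) by now apply Cminus_neq.
      assert (Hp : ((w - z0) ^ (n - m))%C <> RtoC 0) by now apply Cpow_nz.
      assert (Hq : ((w - z0) ^ m)%C <> RtoC 0) by now apply Cpow_nz.
      split.
      * replace (1 * ((w - z0) ^ (n - m) / h w) + 0)%C with ((w - z0) ^ (n - m) * / h w)%C by (unfold Cdiv; ring).
        apply Cmult_neq_0; auto. now apply Cinv_neq_0.
      * rewrite Hw by auto. unfold mob. replace n with (m + (n - m))%nat at 1 by lia.
        rewrite Cpow_add_r. field. auto.
Qed.

Lemma CD_kappa (c : R) (k1 k2 k3 k4 : C) (K : C -> C) v : RtoC c <> RtoC 0 -> holo_at K v ->
  (k1 - k2 * (RtoC c * K v))%C <> RtoC 0 ->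
  cder (fun z => (k4 * (RtoC c * K z) - k3) / (RtoC c * (k1 - k2 * (RtoC c * K z))))%C v
   ((k1 * k4 - k2 * k3) * CD K v / (k1 - k2 * (RtoC c * K v)) ^ 2)%C.
Proof.
  intros Hc HK HG. assert (d0 := holo_at_cder _ _ HK).
  eapply der_eq; [|apply (der_div (fun z => z) (fun z => k4 * (RtoC c * K z) - k3)%C (fun z => RtoC c * (k1 - k2 * (RtoC c * K z)))%C)].
  2: now apply Cmult_neq_0.
  2: apply der_minus; [apply der_scal, der_scal; exact d0|apply der_const].
  2: apply der_scal, der_minus; [apply der_const|apply der_scal, der_scal; exact d0].
  field. auto.
Qed.

(* The data [R] of the Moebius image of [S]: the coefficient matrix acts contragrediently. *)
Definition contra (c : R) (k1 k2 k3 k4 : C) (K : C -> C) (z : C) : C :=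
  ((k4 * (RtoC c * K z) - k3) / (RtoC c * (k1 - k2 * (RtoC c * K z))))%C.

Section Contragredient.
Variables (c : R) (k1 k2 k3 k4 : C) (S : C -> C).
Hypothesis (Hc : RtoC c <> RtoC 0) (HDelta : (k1 * k4 - k2 * k3)%C <> RtoC 0).

Lemma R_data_mob (a : R -> R) (b T : R -> C) (beta : C -> C) t :
  holo_at S (RtoC t) -> (k3 * S (RtoC t) + k4)%C <> RtoC 0 ->
  rloc t (fun t => mob k1 k2 k3 k4 S (RtoC t) = T t) -> CD S (RtoC t) <> RtoC 0 ->
  beta (RtoC t) = b_over_a a b t -> Dfun S beta (RtoC t) <> RtoC 0 ->
  (k1 - k2 * (RtoC c * Kfun c S beta (RtoC t)))%C <> RtoC 0 ->
  R_data c a b T t = Cconj (contra c k1 k2 k3 k4 (Kfun c S beta) (RtoC t)).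
Proof.
  intros hS Hp HT HS1 Eb HD HG. unfold R_data. f_equal.
  assert (hM := mob_holo k1 k2 k3 k4 S _ hS Hp).
  assert (E1 := rD_holo _ _ _ HT hM). assert (E2 := rD_holo _ _ _ E1 (holo_at_CD _ _ hM)).
  rewrite <- (rloc_self _ _ E2), <- (rloc_self _ _ E1), <- (rloc_self _ _ HT), <- Eb.
  rewrite CD_mob, CD2_mob by auto. unfold mob, contra.
  unfold Kfun, Dfun, Nfun in *.
  set (Delta := (k1 * k4 - k2 * k3)%C) in *.
  set (s1 := CD S (RtoC t)) in *. set (s2 := CD (CD S) (RtoC t)) in *. set (ss := S (RtoC t)) in *.
  set (be := beta (RtoC t)) in *.
  set (NN := (s2 - be * s1)%C) in *. set (DD := (2 * (s1 * s1) - ss * NN)%C) in *.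
  assert (EG : (k1 - k2 * (RtoC c * (NN / (RtoC c * DD))))%C = ((k1 * DD - k2 * NN) / DD)%C) by (field; auto).
  assert (HG' : (k1 * DD - k2 * NN)%C <> RtoC 0).
  { intros E. apply HG. rewrite EG, E. unfold Cdiv; ring. }
  set (p := (k3 * ss + k4)%C) in *.
  (* Up to the common factor Delta / p^3, the numerator and denominator of [R_data] transform
     linearly in the pair (N, D); in the quotient only the matrix remains. *)
  replace (Delta * (s2 * p - 2 * k3 * s1 ^ 2) / p ^ 3 - be * (Delta * s1 / p ^ 2))%C with
    (Delta / p ^ 3 * (k4 * NN - k3 * DD))%C.
  2:{ unfold DD, NN. unfold p in *. field. exact Hp. }
  replace (2 * (Delta * s1 / p ^ 2) ^ 2 - (k1 * ss + k2) / p * (Delta * (s2 * p - 2 * k3 * s1 ^ 2) / p ^ 3) +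
    be * ((k1 * ss + k2) / p) * (Delta * s1 / p ^ 2))%C with (Delta / p ^ 3 * (k1 * DD - k2 * NN))%C.
  2:{ unfold DD, NN, Delta. unfold p in *. field. exact Hp. }
  rewrite EG. field. repeat split; auto.
Qed.

(** T' gains Delta / p^2, conj(R') gains Delta / q^2 and 1 + c T conj(R) gains Delta / (p q), where
    p = k3 S + k4 and q = k1 - k2 c K(conj z); all factors cancel in the formula. *)
Lemma liouville_formula_mob (K Tz Rz : C -> C) z :
  holo_at S z -> holo_at K (Cconj z) -> (k3 * S z + k4)%C <> RtoC 0 ->
  (k1 - k2 * (RtoC c * K (Cconj z)))%C <> RtoC 0 -> (1 + RtoC c * S z * K (Cconj z))%C <> RtoC 0 ->
  near z (fun w => mob k1 k2 k3 k4 S w = Tz w) -> near z (fun w => crefl (contra c k1 k2 k3 k4 K) w = Rz w) ->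
  liouville_regular c Tz Rz z /\
  liouville_formula c Tz Rz z = formula c (CD S) (fun z => CD K (Cconj z)) S (fun z => K (Cconj z)) z.
Proof.
  intros hS hK Hp HG n3 HT HR.
  assert (hM := mob_holo k1 k2 k3 k4 S _ hS Hp).
  assert (dk := CD_kappa c k1 k2 k3 k4 K (Cconj z) Hc hK HG).
  assert (hk : holo_at (contra c k1 k2 k3 k4 K) (Cconj z)).
  { apply (holo_at_div (fun z => k4 * (RtoC c * K z) - k3)%C (fun z => RtoC c * (k1 - k2 * (RtoC c * K z)))%C);
      [now apply Cmult_neq_0| |].
    - apply holo_at_minus; [now apply holo_at_scal, holo_at_scal|apply holo_at_const].
    - apply holo_at_scal, holo_at_minus; [apply holo_at_const|now apply holo_at_scal, holo_at_scal]. }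
  assert (dT : dz Tz z = ((k1 * k4 - k2 * k3) * CD S z / (k3 * S z + k4) ^ 2)%C).
  { rewrite <- CD_mob by auto. eapply wirt_dz, wirt_holo. apply (cder_ext_near _ _ _ _ HT). now apply holo_at_cder. }
  assert (dR : Cconj (dz Rz z) = ((k1 * k4 - k2 * k3) * CD K (Cconj z) / (k1 - k2 * (RtoC c * K (Cconj z))) ^ 2)%C).
  { rewrite <- (Cconj_conj (_ / _)). f_equal. eapply wirt_dz, wirt_holo.
    apply (cder_ext_near _ _ _ _ HR). exact (cder_conj_refl _ _ _ dk). }
  assert (Eden : (1 + RtoC c * Tz z * Cconj (Rz z))%C = ((k1 * k4 - k2 * k3) * (1 + RtoC c * S z * K (Cconj z)) /
      ((k3 * S z + k4) * (k1 - k2 * (RtoC c * K (Cconj z)))))%C).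
  { rewrite <- (near_self _ _ HT), <- (near_self _ _ HR). unfold crefl. rewrite Cconj_conj. unfold mob, contra. field. auto. }
  split; [split; [|split]|].
  - apply holomorphic_at_iff. now apply (holo_at_ext _ _ _ HT).
  - apply holomorphic_at_iff. now apply (holo_at_ext _ _ _ HR), holo_at_crefl.
  - rewrite Eden. apply Cmult_neq_0; [now apply Cmult_neq_0|]. apply Cinv_neq_0; now apply Cmult_neq_0.
  - unfold liouville_formula. rewrite Eden, dT, dR. unfold formula. field. repeat split; auto.
Qed.
End Contragredient.

(** The formula is claimed off the centre only, the one point of the square where [T], [R] or the
    denominator may misbehave. *)
Definition local_solution (c : R) (I : R -> Prop) (a : R -> R) (b : R -> C) (D : C -> Prop) (Tz Rz : C -> C)
    (s0 rho : R) (phi : C -> R) : Prop :=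
  (forall z, box (RtoC s0) rho z -> D z) /\
  (forall s, Rabs (s - s0) < rho -> I s) /\
  Ck_on 2 (box (RtoC s0) rho) phi /\
  (forall z, box (RtoC s0) rho z -> 0 < phi z) /\
  (forall z, box (RtoC s0) rho z -> dzbar (dz (fun w => RtoC (ln (phi w)))) z = RtoC (- (c / 2) * phi z)) /\
  (forall s, Rabs (s - s0) < rho -> phi (RtoC s) = a s /\ dz (fun w => RtoC (phi w)) (RtoC s) = b s) /\
  (forall z, box (RtoC s0) rho z -> z <> RtoC s0 ->
     liouville_regular c Tz Rz z /\ RtoC (phi z) = liouville_formula c Tz Rz z).

Lemma box_axis s0 rho s : 0 < rho -> box (RtoC s0) rho (RtoC s) <-> Rabs (s - s0) < rho.
Proof.
  intros Hr; unfold box; simpl. rewrite Rminus_diag, Rabs_R0. tauto.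
Qed.

(** The hypotheses on [T] and [R] hold off isolated points, so near [s0] only [s0] can be
    exceptional. The chart [S] and its [K] are holomorphic there in any case; [T] and [R] are
    recovered from them on a punctured neighbourhood. *)
Lemma local_existence (c : R) (lo hi : Rbar) (a : R -> R) (b T : R -> C) (D : C -> Prop) (Tz Rz : C -> C) :
  let I := interval_oo lo hi in
  c <> 0 ->
  real_analytic_on (V := R_NormedModule) I a ->
  (forall s, I s -> 0 < a s) ->
  real_analytic_on (V := C_R_NormedModule) I b ->
  (forall s, I s -> 2 * Re (b s) = Derive a s) ->
  off_isolated (S := R_UniformSpace) I (schwarzian_eq_at T (Upsilon c a b)) ->
  open (T := C_UniformSpace) D ->
  (forall s, I s -> D (RtoC s)) ->
  meromorphic_extension I T D Tz ->
  meromorphic_extension I (R_data c a b T) D Rz ->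
  forall s0, I s0 -> exists rho phi, 0 < rho /\ local_solution c I a b D Tz Rz s0 rho phi.
Proof.
  intros I Hc Han Hapos Hbn Hab Hsch Dopen DI [HTm HTe] [HRm HRe] s0 Hs0.
  set (z0 := RtoC s0).
  destruct (real_analytic_extension I _ s0 (real_analytic_RtoC I a Han) Hs0) as (A & hA & EA).
  destruct (real_analytic_extension I b s0 Hbn Hs0) as (B & hB & EB).
  fold z0 in hA, hB.
  assert (HI : rloc s0 I) by exact (interval_oo_open lo hi s0 Hs0).
  assert (A0 : A z0 <> RtoC 0).
  { unfold z0; rewrite (rloc_self s0 (fun t => A (RtoC t) = RtoC (a t)) EA). apply RtoC_neq. specialize (Hapos s0 Hs0); lra. }
  set (beta := fun z => (B z / A z)%C).
  assert (hbeta : holo_at beta z0) by now apply holo_at_div.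
  assert (Ebeta : rloc s0 (fun s => beta (RtoC s) = b_over_a a b s)).
  { eapply rloc_imp; [|exact (rloc_and _ _ _ EA EB)]. intros s [E1 E2]. unfold beta, b_over_a. cbv beta. now rewrite E1, E2. }
  assert (Ebeta' := rD_holo _ _ _ Ebeta hbeta).
  assert (EA' := rD_holo _ _ _ EA hA).
  assert (Haxis : rloc s0 (fun s => A (RtoC s) = RtoC (a s) /\
     CD A (RtoC s) = (A (RtoC s) * (beta (RtoC s) + Cconj (beta (RtoC s))))%C)).
  { eapply rloc_imp; [|exact (rloc_and _ _ _ (rloc_and _ _ _ EA EA') (rloc_and _ _ _ Ebeta HI))].
    intros s [[E1 E2] [E3 Is]]. split; [exact E1|]. rewrite E2, E1, E3.
    assert (Hna : RtoC (a s) <> RtoC 0) by (apply RtoC_neq; specialize (Hapos s Is); lra).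
    unfold b_over_a. rewrite Cdiv_conj, Cconj_RtoC by exact Hna.
    replace (RtoC (a s) * (b s / RtoC (a s) + Cconj (b s) / RtoC (a s)))%C with (b s + Cconj (b s))%C by (field; exact Hna).
    apply injective_projections.
    - change (Derive a s = Re (b s) + Re (b s)). rewrite <- Hab by auto. ring.
    - change (Derive (fun _ => 0) s = Im (b s) + - Im (b s)). rewrite Derive_const. ring. }
  destruct (HTm z0 (DI s0 Hs0)) as (n & g & hg & Hg).
  apply holomorphic_at_iff in hg. apply C_locally'_near in Hg.
  specialize (Hsch s0 Hs0). specialize (HTe s0 Hs0). specialize (HRe s0 Hs0).
  apply rpunct_locally' in Hsch, HTe, HRe.
  destruct (meromorphic_chart Tz z0 n g hg Hg) as (S & k1 & k2 & k3 & k4 & hS & S0 & HDelta & Hmob).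
  (* If [Tz] vanished near [s0], so would [T] on the punctured axis, against the nonvanishing of T'
     there. *)
  { intros H0. assert (H0' := rpunct_and _ _ _ (near_punct_rpunct _ _ H0) HTe).
    destruct (rpunct_ex _ _ (rpunct_and _ _ _ Hsch (rpunct_rloc _ _ H0'))) as [t (_ & (_ & _ & _ & Hne & _) & Hl)].
    apply Hne. apply rder_rD. apply (rder_ext_rloc (fun _ => RtoC 0)); [|apply der_const].
    eapply rloc_imp; [|exact Hl]. intros u [E1 E2]. congruence. }
  set (Delta := (k1 * k4 - k2 * k3)%C) in *.
  set (M := mob k1 k2 k3 k4 S) in *.
  assert (HTM : rpunct s0 (fun t => M (RtoC t) = T t)).
  { eapply rpunct_imp; [|exact (rpunct_and _ _ _ (near_punct_rpunct _ _ Hmob) HTe)].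
    intros t [[_ E1] E2]. congruence. }
  assert (Hloc : rpunct s0 (fun t => holo_at S (RtoC t) /\ (k3 * S (RtoC t) + k4)%C <> RtoC 0 /\
     rloc t (fun t => M (RtoC t) = T t) /\ rD T t <> RtoC 0 /\ schwarzian T t = Upsilon c a b t)).
  { eapply rpunct_imp; [|exact (rpunct_and _ _ _ (rpunct_and _ _ _ Hsch (rpunct_rloc _ _ HTM))
       (rpunct_and _ _ _ (near_punct_rpunct _ _ Hmob) (rloc_rpunct _ _ (near_rloc _ _ (holo_at_near _ _ hS)))))].
    intros t [[(_ & _ & _ & H1 & H2) H3] [[H4 _] H5]]. tauto. }
  assert (Hschw : rpunct s0 (fun s => CD S (RtoC s) <> RtoC 0 /\ schw S (RtoC s) =
    ((2 * CD beta (RtoC s) - beta (RtoC s) ^ 2 + RtoC c * A (RtoC s)) / 2)%C)).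
  { eapply rpunct_imp; [|exact (rpunct_and _ _ _ Hloc (rloc_rpunct _ _ (rloc_and _ _ _ EA (rloc_and _ _ _ Ebeta Ebeta'))))].
    intros t [(H1 & H2 & H3 & H4 & H5) [E1 [E2 E3]]].
    destruct (schwarzian_mob k1 k2 k3 k4 S T t HDelta H1 H2 H3 H4) as [G1 G2].
    split; [exact G1|]. unfold schw. rewrite <- G2, H5, E1, E2, E3. reflexivity. }
  assert (S1 : CD S z0 <> RtoC 0).
  { apply (schwarzian_immersion S (fun z => (2 * CD beta z - beta z ^ 2 + RtoC c * A z) / 2)%C s0 hS); [|exact Hschw].
    apply (holo_at_div (fun z => 2 * CD beta z - beta z ^ 2 + RtoC c * A z)%C (fun _ => RtoC 2)); [apply C2_nz| |apply holo_at_const].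
    apply (holo_at_plus (fun z => 2 * CD beta z - beta z ^ 2)%C (fun z => RtoC c * A z)%C).
    + apply (holo_at_minus (fun z => 2 * CD beta z)%C (fun z => beta z ^ 2)%C); [now apply holo_at_scal, holo_at_CD|now apply holo_at_pow].
    + now apply holo_at_scal. }
  assert (Hschw' := rpunct_imp _ _ _ (fun s H => proj2 H) Hschw).
  assert (Ha0 := Hapos s0 Hs0). assert (Nc := RtoC_neq c 0 Hc).
  destruct (local_core c a S A beta s0 Hc hS hA hbeta S0 S1 Ha0 Haxis Hschw') as (phi & Hphi & Haxis2).
  set (K := Kfun c S beta) in *. fold z0 in Hphi.
  assert (hK : holo_at K z0) by (apply (holo_Kfun c S beta s0); auto).
  assert (K1 : CD K z0 <> RtoC 0) by (now apply (CD_Kfun_nz c a S A beta s0)).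
  set (G := fun z => (k1 - k2 * (RtoC c * K z))%C).
  assert (hG : holo_at G z0).
  { apply holo_at_minus; [apply holo_at_const|]. now apply holo_at_scal, holo_at_scal. }
  assert (HG : near z0 (fun w => w <> z0 -> G w <> RtoC 0)).
  (* If [G] vanished near [z0], its derivative -k2 c K' would too; as K' is nonzero at [z0], k2 = 0,
     then k1 = 0, against [HDelta]. *)
  { destruct (holo_isolated G z0 hG) as [HG0|HG0]; auto. exfalso.
    assert (dG : cder G z0 (0 - k2 * (RtoC c * CD K z0))%C).
    { apply der_minus; [apply der_const|]. apply der_scal, der_scal. now apply holo_at_cder. }
    assert (dG0 : cder G z0 (RtoC 0)).
    { apply (cder_ext_near (fun _ => RtoC 0)); [|apply der_const]. eapply near_imp; [|exact HG0]; auto. }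
    assert (E := cder_unique _ _ _ _ dG dG0).
    destruct (Classical_Prop.classic (k2 = RtoC 0)) as [E2|E2].
    - apply HDelta. apply near_self in HG0. unfold G in HG0. unfold Delta. rewrite E2 in *.
      assert (E1 : k1 = RtoC 0) by (rewrite <- HG0; ring). rewrite E1. ring.
    - apply (Cmult_neq_0 _ _ E2 (Cmult_neq_0 _ _ Nc K1)).
      replace (k2 * (RtoC c * CD K z0))%C with (- (0 - k2 * (RtoC c * CD K z0)))%C by ring. rewrite E. ring. }
  set (num := fun z => (k4 * (RtoC c * K z) - k3)%C).
  assert (hnum : holo_at num z0).
  { apply holo_at_minus; [|apply holo_at_const]. now apply holo_at_scal, holo_at_scal. }
  set (kappa := contra c k1 k2 k3 k4 K).
  assert (HRreal : rpunct s0 (fun s => Rz (RtoC s) = Cconj (kappa (RtoC s)))).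
  { eapply rpunct_imp; [|exact (rpunct_and _ _ _ (rpunct_and _ _ _ Hloc HRe) (rpunct_and _ _ _
       (rpunct_and _ _ _ (near_punct_rpunct _ _ HG) Hschw)
       (rpunct_and _ _ _ (rloc_rpunct _ _ Ebeta) (rloc_rpunct _ _ (near_rloc _ _ (near_Dfun_nz S beta s0 hS hbeta S0 S1))))))].
    intros t [[(H1 & H2 & H3 & H4 & _) ER] [[HGt [HS1 _]] [Eb HD]]].
    rewrite ER. now apply R_data_mob. }
  destruct (HRm z0 (DI s0 Hs0)) as (m & gR & hgR & HgR).
  apply holomorphic_at_iff in hgR. apply C_locally'_near in HgR.
  assert (Ez0 : Cconj z0 = z0) by apply Cconj_RtoC.
  assert (HGc : near z0 (fun w => w <> z0 -> G (Cconj w) <> RtoC 0)).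
  { eapply near_imp; [|exact (near_conj s0 _ HG)]. intros w Hw Hne. apply Hw. intros E; apply Hne.
    now rewrite <- (Cconj_conj w), E, Ez0. }
  assert (HRz : near z0 (fun w => w <> z0 -> Rz w = crefl kappa w)).
  { assert (hcG : holo_at (crefl (fun z => RtoC c * G z)%C) z0).
    { apply holo_at_crefl. rewrite Ez0. now apply holo_at_scal. }
    assert (hcn : holo_at (crefl num) z0) by (apply holo_at_crefl; now rewrite Ez0).
    assert (hx : holo_at (fun w => (w - z0) ^ m)%C z0).
    { apply (holo_at_pow (fun w => w - z0)%C). apply holo_at_minus; [apply holo_at_id|apply holo_at_const]. }
    (* [Rz] and the reflected [kappa] are known to agree only on the punctured axis and may both
       have poles; cross-multiplied, their equality is between holomorphic functions and spreads to
       the plane. *)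
    assert (Hid : near z0 (fun w => (gR w * crefl (fun z => RtoC c * G z) w - (w - z0) ^ m * crefl num w)%C = RtoC 0)).
    { apply holo_zero_real.
      - apply holo_at_minus; now apply holo_at_mult.
      - eapply rpunct_imp; [|exact (rpunct_and _ _ _ (rpunct_and _ _ _ HRreal (near_punct_rpunct _ _ HG))
          (rpunct_and _ _ _ (near_punct_rpunct _ _ HgR) (near_punct_rpunct _ (fun w => w <> z0) (ex_intro _ 1 (conj Rlt_0_1 (fun w _ H => H))))))].
        intros t [[E1 E2] [E3 E4]]. rewrite E3 in E1.
        assert (Hx : ((RtoC t - z0) ^ m)%C <> RtoC 0) by (apply Cpow_nz, Cminus_neq; exact E4).
        assert (HcG : (RtoC c * G (RtoC t))%C <> RtoC 0) by now apply Cmult_neq_0.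
        unfold crefl. rewrite Cconj_RtoC.
        change (kappa (RtoC t)) with (num (RtoC t) / (RtoC c * G (RtoC t)))%C in E1.
        rewrite Cdiv_conj in E1 by exact HcG.
        assert (HcG' : Cconj (RtoC c * G (RtoC t))%C <> RtoC 0) by (intros E; now apply HcG, Cconj_inj_0).
        replace (gR (RtoC t)) with (gR (RtoC t) / (RtoC t - z0) ^ m * (RtoC t - z0) ^ m)%C by (field; exact Hx).
        rewrite E1. field. exact HcG'. }
    eapply near_imp; [|exact (near_and _ _ _ Hid (near_and _ _ _ HgR HGc))].
    intros w (E1 & E2 & E3) Hne. specialize (E2 Hne). specialize (E3 Hne).
    assert (Hx : ((w - z0) ^ m)%C <> RtoC 0) by (apply Cpow_nz, Cminus_neq; exact Hne).
    assert (HcG : (RtoC c * G (Cconj w))%C <> RtoC 0) by now apply Cmult_neq_0.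
    assert (HcG' : Cconj (RtoC c * G (Cconj w))%C <> RtoC 0) by (intros E; now apply HcG, Cconj_inj_0).
    rewrite E2. unfold crefl in *.
    change (kappa (Cconj w)) with (num (Cconj w) / (RtoC c * G (Cconj w)))%C. rewrite Cdiv_conj by exact HcG.
    apply (proj2 (Ceq_minus _ _)) in E1.
    replace (gR w / (w - z0) ^ m)%C with (gR w * Cconj (RtoC c * G (Cconj w)) / ((w - z0) ^ m * Cconj (RtoC c * G (Cconj w))))%C
      by (field; auto).
    rewrite E1. field. auto. }
  assert (Hall := near_all c a S A beta s0 Hc hS hA hbeta S0 S1 Ha0 Haxis Hschw').
  cbv beta zeta in Hall. fold K z0 in Hall.
  assert (HD0 : near z0 D) by exact (proj1 (open_near D) Dopen z0 (DI s0 Hs0)).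
  (* The axis statements are phrased at [Re z], so that a single square serves them and the planar
     ones. *)
  assert (Hax : near z0 (fun z => rloc (Re z) (fun s => I s) /\ phi (RtoC (Re z)) = a (Re z) /\ 
     formula_w c S (CD S) (CD (CD S)) (fun z => K (Cconj z)) (RtoC (Re z)) = b_over_a a b (Re z))).
  { destruct (rloc_and _ _ _ (rloc_rloc _ _ HI) (rloc_and _ _ _ Haxis2 Ebeta)) as [d [Hd H]].
    exists d; split; auto. intros z Hz. destruct (H (Re z)) as (H1 & [H2 H3] & H4).
    - eapply Rle_lt_trans; [apply (re_le_Cmod (z - z0)%C)|exact Hz].
    - repeat split; auto. etransitivity; [exact H3|exact H4]. }
  destruct (near_box _ _ (near_and _ _ _ (near_and _ _ _ HD0 Hax) (near_and _ _ _ (near_and _ _ _ Hphi Hall)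
     (near_and _ _ _ HGc (near_and _ _ _ (near_punct_near _ _ Hmob) (near_punct_near _ _ HRz)))))) as [rho [Hrho Hbox]].
  exists rho, phi. split; [exact Hrho|].
  assert (Uo : forall z, box z0 rho z -> near z (box z0 rho)) by (intros z Hz; now apply box_open).
  destruct (jet_solution c (box z0 rho) (schw S) phi (formula_w c S (CD S) (CD (CD S)) (fun z => K (Cconj z))) Uo) as (J1 & J2 & J3).
  { intros z Hz. destruct (Hbox z Hz) as (_ & ((H & _) & _) & _). exact H. }
  { intros z Hz. destruct (Hbox z Hz) as (_ & ((_ & _ & H) & _) & _). exact H. }
  unfold local_solution. fold z0. repeat match goal with |- _ /\ _ => split end.
  - intros z Hz. apply (Hbox z Hz).
  - intros s Hs. apply (box_axis s0 rho s Hrho) in Hs. destruct (Hbox _ Hs) as ((_ & H & _) & _).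
    exact (rloc_self _ _ H).
  - exact J1.
  - intros z Hz. apply (Hbox z Hz).
  - exact J3.
  - intros s Hs. apply (box_axis s0 rho s Hrho) in Hs. fold z0 in Hs. destruct (Hbox _ Hs) as ((_ & H1 & H2 & H3) & _).
    change (Re (RtoC s)) with s in *. split; [exact H2|].
    rewrite J2 by exact Hs. rewrite H2, H3. unfold b_over_a.
    assert (Is := rloc_self _ _ H1). cbv beta in Is. specialize (Hapos s Is). field. apply RtoC_neq; lra.
  - intros z Hz Hne.
    destruct (Hbox z Hz) as (_ & ((_ & EF & _) & (hSz & hKz & n1 & n2 & n3)) & HGz & HMz & HRzz).
    specialize (HGz Hne). specialize (HMz Hne). specialize (HRzz Hne).
    assert (HMn : near z (fun w => M w = Tz w)) by (eapply near_imp; [|exact HMz]; intros v Hv; symmetry; apply Hv).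
    assert (HRn : near z (fun w => crefl kappa w = Rz w)) by (eapply near_imp; [|exact HRzz]; intros v Hv; symmetry; apply Hv).
    destruct (near_self _ _ HMz) as [Hp _].
    destruct (liouville_formula_mob c k1 k2 k3 k4 S Nc HDelta K Tz Rz z) as [Hreg Hform]; auto.
    split; [exact Hreg|]. rewrite Hform. exact EF.
Qed.

(** * Gluing *)

(** The indicator of [A] along the path is locally constant, so it has derivative zero and equal
    values at both ends. *)
Lemma path_transfer (W A B : C -> Prop) (gam : R -> C) :
  (forall z, W z -> near z W) -> (forall z, A z -> near z A) -> (forall z, B z -> near z B) ->
  (forall z, W z -> A z \/ B z) -> (forall z, W z -> A z -> B z -> False) ->
  (forall t, rcont gam t) -> (forall t, 0 <= t <= 1 -> W (gam t)) -> A (gam 0) -> A (gam 1).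
Proof.
  intros Wo Ao Bo HAB Hdis Hc HW H0.
  set (g := fun t => if excluded_middle_informative (A (gam t)) then 1 else 0).
  assert (Hpull : forall P t, near (gam t) P -> exists d : posreal, forall u, Rabs (u - t) < d -> P (gam u)).
  { intros P t [e [He HP]]. destruct (Hc t e He) as [d [Hd Hu]]. exists (mkposreal d Hd).
    intros u Hud; apply HP, Hu, Hud. }
  assert (Hg : forall t, 0 <= t <= 1 -> is_derive g t 0).
  { intros t Ht. destruct (Classical_Prop.classic (A (gam t))) as [HA|HA].
    - destruct (Hpull A t (Ao _ HA)) as [d Hd].
      apply (is_derive_ext_loc (V := R_NormedModule) (fun _ => 1)); [|apply (is_derive_const (V := R_NormedModule) 1)].
      exists d. intros u Hu. unfold g. destruct (excluded_middle_informative (A (gam u))) as [|n]; auto.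
      destruct n; now apply Hd.
    - assert (HB : B (gam t)) by (destruct (HAB _ (HW t Ht)); tauto).
      destruct (Hpull _ t (near_and _ _ _ (Bo _ HB) (Wo _ (HW t Ht)))) as [d Hd].
      apply (is_derive_ext_loc (V := R_NormedModule) (fun _ => 0)); [|apply (is_derive_const (V := R_NormedModule) 0)].
      exists d. intros u Hu. unfold g. destruct (excluded_middle_informative (A (gam u))) as [HAu|]; auto.
      destruct (Hd u Hu) as [HBu HWu]. now destruct (Hdis _ HWu HAu HBu). }
  assert (E := eq_is_derive (V := R_NormedModule) g 0 1 Hg Rlt_0_1).
  unfold g in E.
  destruct (excluded_middle_informative (A (gam 0))) as [_|]; [|contradiction].
  destruct (excluded_middle_informative (A (gam 1))) as [HA|_]; auto. 
  exfalso; apply R1_neq_R0; exact E.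
Qed.

Lemma rcont_segment (p q : C) t : rcont (fun t => p + RtoC t * (q - p))%C t.
Proof.
  eapply rder_rcont. apply der_plus; [apply der_const|]. apply der_mult; [apply der_id|apply der_const].
Qed.

Lemma Rabs_segment (p q m t r : R) : 0 <= t <= 1 -> Rabs (p - m) < r -> Rabs (q - m) < r ->
  Rabs (p + t * (q - p) - m) < r.
Proof.
  intros Ht Hp Hq. replace (p + t * (q - p) - m) with ((1 - t) * (p - m) + t * (q - m)) by ring.
  eapply Rle_lt_trans; [apply Rabs_triang|]. rewrite !Rabs_mult, (Rabs_right (1 - t)), (Rabs_right t) by lra.
  apply Rle_lt_trans with (Rmax (Rabs (p - m)) (Rabs (q - m))); [|now apply Rmax_lub_lt].
  generalize (Rmax_l (Rabs (p - m)) (Rabs (q - m))) (Rmax_r (Rabs (p - m)) (Rabs (q - m))). nra.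
Qed.

Lemma box_segment z0 r p q t : 0 <= t <= 1 -> box z0 r p -> box z0 r q -> box z0 r (p + RtoC t * (q - p))%C.
Proof.
  intros Ht [H1 H2] [H3 H4]. destruct p as [px py], q as [qx qy]. unfold box, Re, Im in *. simpl in *. split.
  - replace (px + (t * (qx + - px) - 0 * (qy + - py))) with (px + t * (qx - px)) by ring. now apply Rabs_segment.
  - replace (py + (t * (qy + - py) + 0 * (qx + - px))) with (py + t * (qy - py)) by ring. now apply Rabs_segment.
Qed.

(** Any two points are joined by three segments: to the centre of a square, along the axis to the
    centre of another, and out to the second point. *)
Lemma connected_open_boxes lo hi (W : C -> Prop) :
  (forall s, interval_oo lo hi s -> W (RtoC s)) ->
  (forall z, W z -> exists s r, interval_oo lo hi s /\ box (RtoC s) r z /\ forall v, box (RtoC s) r v -> W v) ->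
  connected_open W.
Proof.
  intros HI Hbox.
  assert (Wo : forall z, W z -> near z W).
  { intros z Hz. destruct (Hbox z Hz) as (s & r & _ & Hb & HW).
    eapply near_imp; [exact HW|]. now apply box_open. }
  split; [now apply open_near|].
  intros A B Ao Bo HAB [zA [WA HA]] [zB [WB HB]].
  rewrite open_near in Ao, Bo.
  apply Classical_Prop.NNPP; intros Hno.
  assert (Hdis : forall z, W z -> A z -> B z -> False) by (intros z H1 H2 H3; apply Hno; now exists z).
  assert (Hpath := fun gam => path_transfer W A B gam Wo Ao Bo HAB Hdis).
  assert (Hseg : forall p q, (forall t, 0 <= t <= 1 -> W (p + RtoC t * (q - p))%C) -> A p -> A q).
  { intros p q HW Hp.
    assert (H := Hpath (fun t => p + RtoC t * (q - p))%C (rcont_segment p q) HW). cbv beta in H.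
    replace (p + 0 * (q - p))%C with p in H by ring. replace (p + 1 * (q - p))%C with q in H by ring. auto. }
  destruct (Hbox zA WA) as (s1 & r1 & I1 & B1 & W1). destruct (Hbox zB WB) as (s2 & r2 & I2 & B2 & W2).
  assert (Hcen : forall s r z, box (RtoC s) r z -> box (RtoC s) r (RtoC s)).
  { intros s r z [Hz _]. apply box_Cmod; [|rewrite Cmod_diag]; (eapply Rle_lt_trans; [apply Rabs_pos|exact Hz]). }
  assert (A1 : A (RtoC s1)).
  { apply (Hseg zA); auto. intros t Ht. apply W1, box_segment; eauto. }
  assert (A2 : A (RtoC s2)).
  { apply (Hseg (RtoC s1)); auto. intros t Ht.
    replace (RtoC s1 + RtoC t * (RtoC s2 - RtoC s1))%C with (RtoC (s1 + t * (s2 - s1))).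
    - apply HI, (interval_oo_convex lo hi s1 s2); auto. unfold Rmin, Rmax; destruct (Rle_dec s1 s2); nra.
    - now rewrite RtoC_plus, RtoC_mult, RtoC_minus. }
  apply (Hdis zB); auto. apply (Hseg (RtoC s2)); auto.
  intros t Ht. apply W2, box_segment; eauto.
Qed.

Section Glue.
Variables (c : R) (lo hi : Rbar) (a : R -> R) (b : R -> C) (D : C -> Prop) (Tz Rz : C -> C).
Let I := interval_oo lo hi.

Definition patch (z : C) (f : C -> R) (s r : R) : Prop :=
  I s /\ 0 < r /\ local_solution c I a b D Tz Rz s r f /\ box (RtoC s) r z.

Definition glue_dom (z : C) : Prop := exists f s r, patch z f s r.
Definition glue_fun (z : C) : R := epsilon (inhabits 0) (fun y => exists f s r, patch z f s r /\ y = f z).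

(** Away from both centres the two local solutions equal the same Liouville expression; a centre is
    real, and there both equal [a]. *)
Lemma patch_agree z f s r f' s' r' : patch z f s r -> patch z f' s' r' -> f z = f' z.
Proof.
  intros (Is & Hr & (_ & _ & _ & _ & _ & Hd & Hf) & Hz) (Is' & Hr' & (_ & _ & _ & _ & _ & Hd' & Hf') & Hz').
  assert (Hreal : forall t, z = RtoC t -> f z = f' z).
  { intros t ->. rewrite box_axis in Hz, Hz' by assumption.
    now rewrite (proj1 (Hd t Hz)), (proj1 (Hd' t Hz')). }
  destruct (Classical_Prop.classic (z = RtoC s)) as [E|E]; [now apply (Hreal s)|].
  destruct (Classical_Prop.classic (z = RtoC s')) as [E'|E']; [now apply (Hreal s')|].
  apply RtoC_inj. rewrite (proj2 (Hf z Hz E)), (proj2 (Hf' z Hz' E')). reflexivity.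
Qed.

Lemma glue_fun_patch z f s r : patch z f s r -> glue_fun z = f z.
Proof.
  intros H. unfold glue_fun.
  destruct (epsilon_spec (inhabits 0) (fun y => exists f s r, patch z f s r /\ y = f z)) as (f' & s' & r' & H' & E).
  - now exists (f z), f, s, r.
  - rewrite E. now apply (patch_agree z f' s' r' f s r).
Qed.

Lemma patch_box z f s r v : patch z f s r -> box (RtoC s) r v -> patch v f s r.
Proof. intros (H1 & H2 & H3 & _) Hv; exact (conj H1 (conj H2 (conj H3 Hv))). Qed.

Hypothesis Hlocal : forall s, I s -> exists rho phi, 0 < rho /\ local_solution c I a b D Tz Rz s rho phi.

Lemma patch_center s : I s -> exists f r, patch (RtoC s) f s r.
Proof.
  intros Is; destruct (Hlocal s Is) as (r & f & Hr & H). exists f, r.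
  refine (conj Is (conj Hr (conj H _))). apply box_axis; auto. now rewrite Rminus_diag, Rabs_R0.
Qed.

Lemma near_glue_fun z f s r : patch z f s r -> near z (fun v => f v = glue_fun v).
Proof.
  intros H. destruct (box_open _ _ _ (proj2 (proj2 (proj2 H)))) as [d [Hd Hb]].
  exists d; split; auto. intros v Hv. symmetry; apply (glue_fun_patch v f s r).
  apply (patch_box z f s r v H), Hb, Hv.
Qed.

Lemma glue_cauchy_solution : cauchy_solution c I a b glue_dom glue_fun.
Proof.
  assert (Wo : forall z, glue_dom z -> near z glue_dom).
  { intros z (f & s & r & H). destruct (box_open _ _ _ (proj2 (proj2 (proj2 H)))) as [d [Hd Hb]].
    exists d; split; auto. intros v Hv. exists f, s, r. apply (patch_box z f s r v H), Hb, Hv. }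
  split; [now apply open_near|]. split; [|split; [|split; [|split]]].
  - intros s Is. destruct (patch_center s Is) as (f & r & H). now exists f, s, r.
  - apply Ck_on_local. intros z (f & s & r & H). exists (box (RtoC s) r). split; [apply H|].
    apply (Ck_on_ext 2 (box (RtoC s) r)) with (f := f).
    + intros v Hv; now apply box_open.
    + intros v Hv; symmetry; apply (glue_fun_patch v f s r), (patch_box z f s r v H Hv).
    + apply H.
  - intros z (f & s & r & H). rewrite (glue_fun_patch z f s r H).
    destruct H as (_ & _ & (_ & _ & _ & Hpos & _) & Hz). now apply Hpos.
  - intros z (f & s & r & H). rewrite (glue_fun_patch z f s r H).
    destruct H as (H1 & H2 & H3 & H4). rewrite <- (proj1 (proj2 (proj2 (proj2 (proj2 H3)))) z H4).
    apply dzbar_ext_near.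
    eapply near_imp; [|exact (near_near _ _ (near_glue_fun z f s r (conj H1 (conj H2 (conj H3 H4)))))].
    intros v Hv. apply dz_ext_near. eapply near_imp; [|exact Hv]. intros u Hu. cbv beta in *. now rewrite Hu.
  - intros s Is. destruct (patch_center s Is) as (f & r & H).
    destruct H as (H1 & H2 & H3 & H4). 
    destruct (proj1 (proj2 (proj2 (proj2 (proj2 (proj2 H3))))) s) as [E1 E2].
    { rewrite Rminus_diag, Rabs_R0; auto. }
    split.
    + rewrite (glue_fun_patch _ f s r); [exact E1|exact (conj H1 (conj H2 (conj H3 H4)))].
    + rewrite <- E2. apply dz_ext_near.
      eapply near_imp; [|exact (near_glue_fun (RtoC s) f s r (conj H1 (conj H2 (conj H3 H4))))].
      intros u Hu. cbv beta in *. now rewrite Hu.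
Qed.

Lemma glue_connected : connected_open glue_dom.
Proof.
  apply (connected_open_boxes lo hi).
  - intros s Is. destruct (patch_center s Is) as (f & r & H). now exists f, s, r.
  - intros z (f & s & r & H). exists s, r. split; [exact (proj1 H)|].
    split; [exact (proj2 (proj2 (proj2 H)))|].
    intros v Hv. exists f, s, r. apply (patch_box z f s r v H Hv).
Qed.

(** Only the centre of the patch around [z] has to be avoided: a punctured neighbourhood of [z] does
    so, whether or not [z] is that centre. *)
Lemma glue_formula : off_isolated (S := C_UniformSpace) glue_dom (fun z =>
  liouville_regular c Tz Rz z /\ RtoC (glue_fun z) = liouville_formula c Tz Rz z).
Proof.
  intros z (f & s & r & H). apply C_locally'_near.
  assert (Hb : near z (fun v => box (RtoC s) r v)) by (apply box_open, H).
  assert (Hne : near z (fun v => v <> z -> v <> RtoC s)).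
  { destruct (Classical_Prop.classic (z = RtoC s)) as [->|E].
    - exists 1; split; [lra|auto].
    - eapply near_imp; [|exact (near_neq _ _ E)]. auto. }
  eapply near_imp; [|exact (near_and _ _ _ Hb Hne)]. intros v [Hv Hv'] Hvz.
  assert (Hp := patch_box z f s r v H Hv). rewrite (glue_fun_patch v f s r Hp).
  destruct H as (_ & _ & (_ & _ & _ & _ & _ & _ & Hf) & _). auto.
Qed.

Lemma glue_dom_D z : glue_dom z -> D z.
Proof. intros (f & s & r & _ & _ & (HD & _) & Hz). now apply HD. Qed.
End Glue.

Theorem theorem1 :
  forall (c : R) (lo hi : Rbar) (a : R -> R) (b T : R -> C)
         (D : C -> Prop) (Tz Rz : C -> C),
    let I := interval_oo lo hi in
    c <> 0 ->
    Rbar_lt lo hi ->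
    real_analytic_on (V := R_NormedModule) I a ->
    (forall s, I s -> 0 < a s) ->
    real_analytic_on (V := C_R_NormedModule) I b ->
    (forall s, I s -> 2 * Re (b s) = Derive a s) ->
    off_isolated (S := R_UniformSpace) I
      (schwarzian_eq_at T (Upsilon c a b)) ->
    open (T := C_UniformSpace) D ->
    (forall s, I s -> D (RtoC s)) ->
    meromorphic_extension I T D Tz ->
    meromorphic_extension I (R_data c a b T) D Rz ->
    exists (W : C -> Prop) (phi : C -> R),
      connected_open W /\
      (forall z, W z -> D z) /\
      cauchy_solution c I a b W phi /\
      off_isolated (S := C_UniformSpace) W (fun z =>
        liouville_regular c Tz Rz z /\
        RtoC (phi z) = liouville_formula c Tz Rz z) /\
      (forall (U : C -> Prop) (psi : C -> R),
         cauchy_solution c I a b U psi ->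
         forall V : C -> Prop,
           connected_open V ->
           (forall s, I s -> V (RtoC s)) ->
           (forall z, V z -> U z /\ W z) ->
           forall z, V z -> psi z = phi z).
Proof.
  intros c lo hi a b T D Tz Rz I Hc Hlh Ha Hapos Hb Hab HT HD HDI HTz HRz.
  assert (Hlocal := local_existence c lo hi a b T D Tz Rz Hc Ha Hapos Hb Hab HT HD HDI HTz HRz).
  exists (glue_dom c lo hi a b D Tz Rz), (glue_fun c lo hi a b D Tz Rz).
  split; [now apply glue_connected|]. split; [now apply glue_dom_D|].
  split; [now apply glue_cauchy_solution|]. split; [now apply glue_formula|].
  intros U psi HU V HV HVI HVUW.
  apply (cauchy_solution_unique c lo hi a b U psi (glue_dom c lo hi a b D Tz Rz) _ V Hlh HU); auto.
  now apply glue_cauchy_solution.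
Qed.
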